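(* The following statements about a finite digraph $G$ are equivalent: (1) $G$ is diagonal; (2) the distance algebra $\sigma G$ over $\mathbb{K}$ is Koszul for any field $\mathbb{K}$; (3) $G$ satisfies property $(\mathcal{V}_2)$ (any two shortest paths connecting the same vertices are $2$-shortly congruent, and any long path is $2$-quasi-reducible), and the path cochain algebra $\Omega^\bullet(G)$ over $\mathbb{K}$ is Koszul for any field $\mathbb{K}$.
   Context: A digraph $G$ consists of a set of vertices and a set of arrows, which are ordered pairs of distinct vertices. A path of length $n\ge 0$ is a tuple of vertices $p=(p_0,\dots,p_n)$ such that each $(p_i,p_{i+1})$ is an arrow; $d(x,y)$ is the infimum of lengths of paths from $x$ to $y$ ($\infty$ if there are none). A path is shortest if $d(p_0,p_n)=n$, and long otherwise. A subpath of $p$ is a path $(p_i,\dots,p_j)$. Paths connect the same vertices if they have the same initial and terminal vertices. Magnitude homology: put $|x_0,\dots,x_n|=\sum_{i=0}^{n-1}d(x_i,x_{i+1})$. $\mathrm{MC}_{n,\ell}(G,\mathbb{Z})$ is the free abelian group on tuples of vertices with $x_i\neq x_{i+1}$ and $|x_0,\dots,x_n|=\ell$; the differential is $\sum_i(-1)^i\partial_{n,i}$, where $\partial_{n,i}$ deletes $x_i$ if the resulting tuple still has norm $\ell$ and is $0$ otherwise. $\mathrm{MH}_{n,\ell}(G,\mathbb{Z})=H_n(\mathrm{MC}_{\bullet,\ell}(G,\mathbb{Z}))$. $G$ is diagonal if $\mathrm{MH}_{n,\ell}(G,\mathbb{Z})=0$ for all $\ell\neq n$. An equivalence relation $\sim$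 on paths is a congruence if $p\sim\tilde p$ implies that $p,\tilde p$ connect the same vertices and $qpq'\sim q\tilde pq'$ whenever the concatenations are defined. The $2$-short congruence is the minimal congruence such that any two shortest paths connecting the same two vertices at distance at most $2$ are equivalent. A long path is $2$-reducible if it contains a long subpath of length at most $2$, and $2$-quasi-reducible if it is $2$-shortly congruent to a $2$-reducible path. The distance algebra $\sigma G$ has $\mathbb{K}$-basis the pairs $(x,y)$ of vertices such that there is a path from $x$ to $y$, product $(x,y)(y',z)=(x,z)$ if $y=y'$ and $d(x,y)+d(y,z)=d(x,z)$ and $0$ otherwise, and degree $|(x,y)|=d(x,y)$. $\mathbb{K}G$ is the path algebra (free on all paths, product = concatenation or zero, graded by length). The path cochain algebra $\Omega^\bullet(G)$ is isomorphic as a graded algebra to $\mathbb{K}G/T$, where $T$ is the ideal generated by the elements $t_{x,y}=\sum_v(x,v,y)$ for all pairs with $d(x,y)=2$, the sum running over all vertices $v$ such that $(x,v,y)$ is a path; here this may be taken as its definition. A non-negatively graded ring $A=\bigoplus_{n\ge0}A_n$ is Koszul if $S=A_0$ is a semisimple ring and there is a graded projective resolution $\cdots\to P_1\to P_0\to S\to0$ over $A$ such that each $P_n$ is generated in degree $n$. *)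

(* Defs.v *)
From HB Require Import structures.
From mathcomp Require Import all_boot all_order all_algebra.
From mathcomp Require Import generic_quotient ring_quotient.
From mathcomp Require Import finmap boolp.
From mathcomp.multinomials Require Import monalg.

Set Implicit Arguments.
Unset Strict Implicit.
Unset Printing Implicit Defensive.

Import GRing.Theory.
Local Open Scope ring_scope.

(* A grading V = \bigoplus_i V_i is given by the projections pr i : V -> V
   onto its components, so that V_i = {v | pr i v = v}. *)
Record is_grading (I : eqType) (V : zmodType) (pr : I -> V -> V) : Prop :=
  IsGrading {
    gradB : forall i, {morph pr i : u v / u - v};
    gradK : forall i j v, pr i (pr j v) = if i == j then pr j v else 0;
    grad_sum : forall v, exists2 s : seq I, uniq s & v = \sum_(i <- s) pr i v
  }.

Definition homog (I : eqType) (V : zmodType) (pr : I -> V -> V) (i : I) :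
    {pred V} :=
  fun v => pr i v == v.

Section GradingTheory.
Variables (I : eqType) (V : zmodType) (pr : I -> V -> V).
Hypothesis gr : is_grading pr.

Lemma grad0 i : pr i 0 = 0.
Proof. by rewrite -[X in pr i X](subrr 0) (gradB gr) subrr. Qed.

Lemma gradN i v : pr i (- v) = - pr i v.
Proof. by rewrite -sub0r (gradB gr) grad0 sub0r. Qed.

Lemma gradD i u v : pr i (u + v) = pr i u + pr i v.
Proof. by rewrite -[v in LHS]opprK (gradB gr) gradN opprK. Qed.

Lemma grad_bigsum i (J : Type) (r : seq J) (P : pred J) (F : J -> V) :
  pr i (\sum_(j <- r | P j) F j) = \sum_(j <- r | P j) pr i (F j).
Proof. exact: (big_morph (pr i) (gradD i) (grad0 i)). Qed.

Lemma homogP i v : pr i v \in homog pr i.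
Proof. by rewrite unfold_in /homog (gradK gr) eqxx. Qed.

Lemma homogE i v : v \in homog pr i -> pr i v = v.
Proof. by rewrite unfold_in => /eqP. Qed.

End GradingTheory.

Record gradedRing := GradedRing {
  gr_ring :> pzRingType;
  gr_pr : nat -> gr_ring -> gr_ring;
  gr_grading : is_grading gr_pr;
  gr_one : 1 \in homog gr_pr 0%N;
  gr_mul : forall i j a b, a \in homog gr_pr i -> b \in homog gr_pr j ->
    a * b \in homog gr_pr (i + j)%N
}.

Lemma gr_prM (A : gradedRing) n (a b : A) i j :
  gr_pr n (gr_pr i a * gr_pr j b) =
  if n == (i + j)%N then gr_pr i a * gr_pr j b else 0.
Proof.
have gA := gr_grading A.
have hM := homogE (gr_mul (homogP gA i a) (homogP gA j b)).
by rewrite -{1}hM (gradK gA) hM.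
Qed.

Section DegreeZero.
Variable A : gradedRing.

Definition deg0_pred : {pred A} := homog (@gr_pr A) 0%N.

Fact deg0_subring : subring_closed deg0_pred.
Proof.
have gA := gr_grading A; split; first exact: gr_one.
- move=> u v /(homogE) hu /homogE hv.
  by rewrite unfold_in /deg0_pred/= (gradB gA) hu hv.
- by move=> u v hu hv; apply: (gr_mul hu hv).
Qed.

Definition deg0 := {a : A | a \in deg0_pred}.
HB.instance Definition _ := SubChoice.on deg0.
HB.instance Definition _ :=
  GRing.SubChoice_isSubPzRing.Build A deg0_pred deg0 deg0_subring.

(* A acts on A_0 = A / A_{>0}. *)
Fact deg0_act_subproof (a : A) (s : deg0) :
  gr_pr 0%N a * val s \in deg0_pred.
Proof. exact: (gr_mul (homogP (gr_grading A) _ _) (valP s)). Qed.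

Definition deg0_act (a : A) (s : deg0) : deg0 :=
  Sub (gr_pr 0%N a * val s) (deg0_act_subproof a s).

Lemma deg0_prM (a b : A) : gr_pr 0%N (a * b) = gr_pr 0%N a * gr_pr 0%N b.
Proof.
have gA := gr_grading A.
have [s us es] := grad_sum gA a; have [t ut et] := grad_sum gA b.
have pr0 (c : A) (r : seq nat) : uniq r -> c = \sum_(i <- r) gr_pr i c ->
    gr_pr 0 c = \sum_(i <- r | i == 0%N) gr_pr i c.
  move=> ur er; rewrite {1}er (grad_bigsum gA) [RHS]big_mkcond.
  by apply: eq_bigr => i _; rewrite (gradK gA) eq_sym.
rewrite {1}es {1}et mulr_suml (grad_bigsum gA) (pr0 a s) // (pr0 b t) //.
rewrite mulr_suml [RHS]big_mkcond; apply: eq_bigr => i _.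
rewrite mulr_sumr (grad_bigsum gA).
case: eqP => [-> | ni0]; last first.
  by apply: big1 => j _; rewrite gr_prM; case: i ni0.
rewrite mulr_sumr [RHS]big_mkcond; apply: eq_bigr => j _.
by rewrite gr_prM add0n eq_sym; case: eqP => // ->.
Qed.

Fact deg0_actA a b s : deg0_act a (deg0_act b s) = deg0_act (a * b) s.
Proof. by apply: val_inj; rewrite /= deg0_prM mulrA. Qed.
Fact deg0_act1 : left_id 1 deg0_act.
Proof.
by move=> s; apply: val_inj; rewrite /= (homogE (@gr_one A)) mul1r.
Qed.
Fact deg0_actDr : right_distributive deg0_act +%R.
Proof. by move=> a s t; apply: val_inj; rewrite /= mulrDr. Qed.
Fact deg0_actDl s : {morph deg0_act^~ s : a b / a + b}.
Proof.
by move=> a b; apply: val_inj; rewrite /= (gradD (gr_grading A)) mulrDl.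
Qed.

HB.instance Definition _ := GRing.Zmodule_isLmodule.Build A deg0
  deg0_actA deg0_act1 deg0_actDr deg0_actDl.

End DegreeZero.

Section Modules.
Variable R : pzRingType.

Definition is_submod (M : lmodType R) (N : M -> Prop) : Prop :=
  N 0 /\ forall (a : R) u v, N u -> N v -> N (a *: u + v).

Definition semisimple_mod (M : lmodType R) : Prop :=
  forall N : M -> Prop, is_submod N ->
  exists N' : M -> Prop,
    [/\ is_submod N',
        forall m, exists u v, [/\ N u, N' v & m = u + v]
      & forall m, N m -> N' m -> m = 0].

Definition projective (P : lmodType R) : Prop :=
  forall (M N : lmodType R) (g : {linear M -> N}) (f : {linear P -> N}),
  (forall y, exists x, g x = y) ->
  exists h : {linear P -> M}, forall p, g (h p) = f p.

End Modules.

Definition semisimple_ring (R : pzRingType) : Prop := semisimple_mod R^o.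

Record gradedModule (A : gradedRing) := GradedModule {
  gm_mod :> lmodType A;
  gm_pr : int -> gm_mod -> gm_mod;
  gm_grading : is_grading gm_pr;
  gm_scale : forall (i : nat) (j : int) (a : A) (m : gm_mod),
    a \in homog (@gr_pr A) i -> m \in homog gm_pr j ->
    a *: m \in homog gm_pr (i%:Z + j)
}.

Definition graded_hom (A : gradedRing) (M N : gradedModule A)
    (f : {linear M -> N}) : Prop :=
  forall i m, f (gm_pr i m) = gm_pr i (f m).

Definition generated_in_degree (A : gradedRing) (M : gradedModule A)
    (i : int) : Prop :=
  forall m : M, exists (k : nat) (a : 'I_k -> A) (x : 'I_k -> M),
    (forall r, x r \in homog (@gm_pr A M) i) /\ m = \sum_(r < k) a r *: x r.

Section TrivialModule.
Variable A : gradedRing.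

Definition deg0_pr (i : int) (s : deg0 A) : deg0 A :=
  if i == 0 then s else 0.

Fact deg0_grading : is_grading deg0_pr.
Proof.
split=> [i u v | i j v | v]; rewrite /deg0_pr.
- by case: eqP; rewrite ?subrr.
- have [<-|] := eqVneq i j; first by case: (i == 0).
  by have [->|//] := eqVneq i 0; rewrite eq_sym => /negbTE ->.
- by exists [:: 0] => //; rewrite big_seq1.
Qed.

Fact deg0_scale (i : nat) (j : int) (a : A) (s : deg0 A) :
  a \in homog (@gr_pr A) i -> s \in homog deg0_pr j ->
  a *: s \in homog deg0_pr (i%:Z + j).
Proof.
move=> ha hs; have := homogE hs; rewrite unfold_in /homog /deg0_pr.
case: eqP => [-> _ | _ <-]; last by rewrite scaler0; case: ifP.
case: i ha => [|i] ha; first by rewrite addr0 !eqxx.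
rewrite addr0 /=; apply/eqP/val_inj; rewrite /= -[a](homogE ha).
by rewrite (gradK (gr_grading A)) mul0r.
Qed.

Definition deg0_gmod : gradedModule A := GradedModule deg0_grading deg0_scale.

End TrivialModule.

Definition koszul (A : gradedRing) : Prop :=
  semisimple_ring (deg0 A) /\
  exists (P : nat -> gradedModule A)
         (d : forall n, {linear P n.+1 -> P n})
         (eps : {linear P 0%N -> deg0_gmod A}),
    [/\ forall n, projective (P n),
        forall n, generated_in_degree (P n) n%:Z,
        graded_hom eps /\ forall n, graded_hom (d n),
        forall s, exists p, eps p = s
      & (forall p, eps p = 0 <-> exists q, d 0%N q = p) /\
        (forall n p, d n p = 0 <-> exists q, d n.+1 q = p)].

Record is_ideal (A : pzRingType) (I : A -> Prop) : Prop := IsIdeal {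
  ideal0 : I 0;
  idealB : forall u v, I u -> I v -> I (u - v);
  idealMl : forall a u, I u -> I (a * u);
  idealMr : forall a u, I u -> I (u * a)
}.

(* The smallest two-sided ideal containing X. *)
Definition ideal_gen (A : pzRingType) (X : A -> Prop) (a : A) : Prop :=
  forall I, is_ideal I -> (forall x, X x -> I x) -> I a.

Lemma ideal_gen_ideal (A : pzRingType) (X : A -> Prop) :
  is_ideal (ideal_gen X).
Proof.
split=> [I hI _ | u v hu hv I hI XI | a u hu I hI XI | a u hu I hI XI].
- exact: ideal0.
- by apply: idealB => //; [exact: hu | exact: hv].
- by apply: idealMl => //; exact: hu.
- by apply: idealMr => //; exact: hu.
Qed.

Lemma ideal_sum (A : pzRingType) (I : A -> Prop) (hI : is_ideal I)
    (J : Type) (r : seq J) (P : pred J) (F : J -> A) :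
  (forall j, P j -> I (F j)) -> I (\sum_(j <- r | P j) F j).
Proof.
move=> hF; apply: big_ind => //; first exact: ideal0.
move=> x y hx hy; rewrite -[y]opprK; apply: (idealB hI) => //.
by rewrite -sub0r; apply: (idealB hI) => //; exact: ideal0.
Qed.

Section QuotientRing.
Variables (A : gradedRing) (X : A -> Prop).

Definition ideal_pred : {pred A} := fun a => `[< ideal_gen X a >].

Lemma ideal_predP a : reflect (ideal_gen X a) (a \in ideal_pred).
Proof. exact: asboolP. Qed.

Fact ideal_pred_zmod : zmod_closed ideal_pred.
Proof.
have hI := ideal_gen_ideal X; split; first by apply/ideal_predP; exact: ideal0.
by move=> u v /ideal_predP hu /ideal_predP hv; apply/ideal_predP; exact: (idealB hI).
Qed.
HB.instance Definition _ := GRing.isZmodClosed.Build A ideal_pred ideal_pred_zmod.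

Definition qring := Quotient.quot ideal_pred.
HB.instance Definition _ := GRing.Zmodule.on qring.

Definition qclass : {additive A -> qring} := \pi_(Quotient.quot ideal_pred)%qT.
Definition qrepr (q : qring) : A := repr q.

Lemma qreprK q : qclass (qrepr q) = q.
Proof. exact: reprK. Qed.

Lemma qclassP a b : qclass a = qclass b <-> ideal_gen X (a - b).
Proof.
split=> [e | /ideal_predP]; last first.
  by rewrite Quotient.idealrBE => /eqP.
by apply/ideal_predP; rewrite Quotient.idealrBE; apply/eqP.
Qed.

Definition qone : qring := qclass 1.
Definition qmul (p q : qring) : qring := qclass (qrepr p * qrepr q).

Lemma qclassM a b : qclass (a * b) = qmul (qclass a) (qclass b).
Proof.
have hI := ideal_gen_ideal X; apply/qclassP.
set a' := qrepr _; set b' := qrepr _.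
have ha : ideal_gen X (a - a') by apply/qclassP; rewrite qreprK.
have hb : ideal_gen X (b - b') by apply/qclassP; rewrite qreprK.
have -> : a * b - a' * b' = a * (b - b') - - ((a - a') * b').
  by rewrite opprK mulrBr mulrBl addrA subrK.
apply: (idealB hI); first exact: (idealMl hI).
by rewrite -sub0r; apply: (idealB hI); [exact: ideal0 | exact: (idealMr hI)].
Qed.

Fact qmulA : associative qmul.
Proof.
move=> x y z; rewrite -[x]qreprK -[y]qreprK -[z]qreprK -!qclassM.
by rewrite mulrA.
Qed.
Fact qmul1r : left_id qone qmul.
Proof. by move=> x; rewrite -[x]qreprK -qclassM mul1r. Qed.
Fact qmulr1 : right_id qone qmul.
Proof. by move=> x; rewrite -[x]qreprK -qclassM mulr1. Qed.
Fact qmulDl : left_distributive qmul +%R.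
Proof.
move=> x y z; rewrite -[x]qreprK -[y]qreprK -[z]qreprK.
by rewrite -raddfD -!qclassM mulrDl raddfD.
Qed.
Fact qmulDr : right_distributive qmul +%R.
Proof.
move=> x y z; rewrite -[x]qreprK -[y]qreprK -[z]qreprK.
by rewrite -raddfD -!qclassM mulrDr raddfD.
Qed.

HB.instance Definition _ := GRing.Zmodule_isPzRing.Build qring
  qmulA qmul1r qmulr1 qmulDl qmulDr.

Definition qpr (n : nat) (q : qring) : qring := qclass (gr_pr n (qrepr q)).

Hypothesis Xhomog : forall x, X x -> exists n, x \in homog (@gr_pr A) n.

Let gA := gr_grading A.

Lemma ideal_gen_pr n a : ideal_gen X a -> ideal_gen X (gr_pr n a).
Proof.
move=> ha; have hI := ideal_gen_ideal X.
have prn_ind (u v : A) : (forall i j, ideal_gen X (gr_pr i u * gr_pr j v)) ->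
    forall k, ideal_gen X (gr_pr k (u * v)).
  move=> huv k; have [s _ ->] := grad_sum gA u; have [t _ ->] := grad_sum gA v.
  rewrite mulr_suml (grad_bigsum gA); apply: (ideal_sum hI) => i _.
  rewrite mulr_sumr (grad_bigsum gA); apply: (ideal_sum hI) => j _.
  by rewrite gr_prM; case: ifP => // _; exact: ideal0.
apply: (ha (fun a => forall n, ideal_gen X (gr_pr n a))) => //.
- split.
  + by move=> k; rewrite (grad0 gA); exact: ideal0.
  + by move=> u v hu hv k; rewrite (gradB gA); exact: (idealB hI).
  + by move=> b u hu; apply: prn_ind => i j; exact: (idealMl hI).
  + by move=> b u hu; apply: prn_ind => i j; exact: (idealMr hI).
- move=> x Xx k; have [m hm] := Xhomog Xx.
  rewrite -(homogE hm) (gradK gA); case: eqP => _; last exact: ideal0.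
  by rewrite (homogE hm) => I _; apply.
Qed.

Lemma qprE n a : qpr n (qclass a) = qclass (gr_pr n a).
Proof.
apply/qclassP; rewrite -(gradB gA); apply: ideal_gen_pr.
by apply/qclassP; rewrite qreprK.
Qed.

Fact qpr_grading : is_grading qpr.
Proof.
split=> [n u v | i j v | v].
- by rewrite -[u]qreprK -[v]qreprK -raddfB !qprE (gradB gA) raddfB.
- rewrite -[v]qreprK !qprE (gradK gA).
  by case: eqP => // _; rewrite raddf0.
- have [s us es] := grad_sum gA (qrepr v); exists s => //.
  rewrite -{1}[v]qreprK es raddf_sum; apply: eq_bigr => i _.
  by rewrite -{2}[v]qreprK qprE.
Qed.

Fact qpr_one : 1 \in homog qpr 0%N.
Proof.
rewrite unfold_in /homog; apply/eqP.
by rewrite [LHS]qprE (homogE (@gr_one A)).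
Qed.

Fact qpr_mul i j (a b : qring) :
  a \in homog qpr i -> b \in homog qpr j -> a * b \in homog qpr (i + j)%N.
Proof.
move=> /homogE <- /homogE <-; rewrite -[a]qreprK -[b]qreprK !qprE.
rewrite unfold_in /homog; apply/eqP; rewrite -[_ * _]qclassM qprE.
by rewrite gr_prM eqxx.
Qed.

Definition quotient_gradedRing : gradedRing :=
  GradedRing qpr_grading qpr_one qpr_mul.

End QuotientRing.

(* A K-algebra with a basis B on which products are either basis elements or
   zero (None), and whose unit is the sum of the idempotents bs_id x. *)
Record basis (V : finType) := Basis {
  bs_sort :> choiceType;
  bs_mul : bs_sort -> bs_sort -> option bs_sort;
  bs_id : V -> bs_sort;
  bs_src : bs_sort -> V;
  bs_tgt : bs_sort -> V;
  bs_deg : bs_sort -> nat;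
  bs_mulA : forall a b c,
    obind (bs_mul^~ c) (bs_mul a b) = obind (bs_mul a) (bs_mul b c);
  bs_mul1l : forall x b, bs_mul (bs_id x) b = if x == bs_src b then Some b else None;
  bs_mul1r : forall b x, bs_mul b (bs_id x) = if bs_tgt b == x then Some b else None;
  bs_deg_id : forall x, bs_deg (bs_id x) = 0%N;
  bs_degM : forall a b c, bs_mul a b = Some c -> bs_deg c = (bs_deg a + bs_deg b)%N
}.

Section BasisAlgebra.
Variables (K : fieldType) (V : finType) (B : basis V).

Definition balg := {malg K[B]}.
HB.instance Definition _ := GRing.Lmodule.on balg.

Definition bgen (b : option B) : balg := if b is Some c then << c >> else 0.

Definition bmul (f g : balg) : balg :=
  \sum_(a <- msupp f) \sum_(b <- msupp g) (f@_a * g@_b) *: bgen (bs_mul a b).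

Definition bone : balg := \sum_(x : V) << bs_id B x >>.

Definition bpr (n : nat) (f : balg) : balg :=
  \sum_(a <- msupp f | bs_deg a == n) << f@_a *g a >>.

Let ext (h : B -> balg) (f : balg) : balg := \sum_(a <- msupp f) f@_a *: h a.

Let extw (h : B -> balg) (f : balg) (d : {fset B}) :
  (msupp f `<=` d)%fset -> ext h f = \sum_(a <- d) f@_a *: h a.
Proof.
move=> le; rewrite /ext (big_fset_incl _ le) // => a _ /mcoeff_outdom ->.
by rewrite scale0r.
Qed.

Let extD h f g : ext h (f + g) = ext h f + ext h g.
Proof.
rewrite (extw h (msuppD_le f g)).
rewrite (extw h (fsubsetUl (msupp f) (msupp g))).
rewrite (extw h (fsubsetUr (msupp f) (msupp g))) -big_split /=.
by apply: eq_bigr => a _; rewrite mcoeffD scalerDl.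
Qed.

Let extZ h c f : ext h (c *: f) = c *: ext h f.
Proof.
rewrite (extw h (msuppZ_le c f)) scaler_sumr.
by apply: eq_bigr => a _; rewrite mcoeffZ scalerA.
Qed.

Let ext0 h : ext h 0 = 0.
Proof. by have := extZ h 0 0; rewrite !scale0r. Qed.

Let extU h a : ext h << a >> = h a.
Proof.
by rewrite (extw h msuppU_le) big_seq_fset1 mcoeffUU scale1r.
Qed.

Let ext_sum h (J : Type) (r : seq J) (P : pred J) F :
  ext h (\sum_(j <- r | P j) F j) = \sum_(j <- r | P j) ext h (F j).
Proof. exact: (big_morph (ext h) (extD h) (ext0 h)). Qed.

Let balgE (f : balg) : f = \sum_(a <- msupp f) f@_a *: (<< a >> : balg).
Proof.
rewrite {1}[f]monalgE; apply: eq_bigr => a _.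
by apply/malgP => b; rewrite mcoeffZ !mcoeffU mulr_natr.
Qed.

Let bmulE f g : bmul f g = ext (fun a => ext (fun b => bgen (bs_mul a b)) g) f.
Proof.
apply: eq_bigr => a _; rewrite scaler_sumr.
by apply: eq_bigr => b _; rewrite scalerA.
Qed.

Lemma bmulDl : left_distributive bmul +%R.
Proof. by move=> f g h; rewrite !bmulE extD. Qed.

Lemma bmulDr : right_distributive bmul +%R.
Proof.
move=> f g h; rewrite !bmulE -[RHS]big_split; apply: eq_bigr => a _.
by rewrite /= extD scalerDr.
Qed.

Let bmulZl c f g : bmul (c *: f) g = c *: bmul f g.
Proof. by rewrite !bmulE extZ. Qed.

Let bmulZr c f g : bmul f (c *: g) = c *: bmul f g.
Proof.
have extZh h : ext (fun a => c *: h a) f = c *: ext h f.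
  rewrite /ext scaler_sumr; apply: eq_bigr => a _.
  by rewrite !scalerA mulrC.
by rewrite !bmulE -extZh; apply: eq_bigr => a _; rewrite extZ.
Qed.

Let bmul_suml g (J : Type) (r : seq J) (P : pred J) F :
  bmul (\sum_(j <- r | P j) F j) g = \sum_(j <- r | P j) bmul (F j) g.
Proof. by rewrite bmulE ext_sum; apply: eq_bigr => j _; rewrite bmulE. Qed.

Let bmul0r g : bmul 0 g = 0.
Proof. by rewrite bmulE ext0. Qed.

Let bmulr0 f : bmul f 0 = 0.
Proof. by have := bmulZr 0 f 0; rewrite !scale0r. Qed.

Let bmul_sumr f (J : Type) (r : seq J) (P : pred J) F :
  bmul f (\sum_(j <- r | P j) F j) = \sum_(j <- r | P j) bmul f (F j).
Proof. exact: (big_morph (bmul f) (bmulDr f) (bmulr0 f)). Qed.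

Let bmulUU a b : bmul << a >> << b >> = bgen (bs_mul a b).
Proof. by rewrite bmulE !extU. Qed.

Let bmulEl f g : bmul f g = \sum_(a <- msupp f) f@_a *: bmul << a >> g.
Proof.
by rewrite {1}[f]balgE bmul_suml; apply: eq_bigr => a _; rewrite bmulZl.
Qed.

Let bmulEr f g : bmul f g = \sum_(a <- msupp g) g@_a *: bmul f << a >>.
Proof.
by rewrite {1}[g]balgE bmul_sumr; apply: eq_bigr => a _; rewrite bmulZr.
Qed.

Lemma bmulA : associative bmul.
Proof.
move=> f g h; rewrite (bmulEl f) (bmulEl f g) bmul_suml.
apply: eq_bigr => a _; rewrite bmulZl; congr (_ *: _).
rewrite (bmulEl g h) bmul_sumr (bmulEr _ g) bmul_suml.
apply: eq_bigr => b _; rewrite bmulZr bmulZl; congr (_ *: _).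
rewrite (bmulEr << b >> h) (bmulEr _ h) bmul_sumr.
apply: eq_bigr => c _; rewrite bmulZr; congr (_ *: _).
rewrite !bmulUU; have := bs_mulA a b c.
case: (bs_mul a b) => [ab|] /=; case: (bs_mul b c) => [bc|] /= e;
  by rewrite ?bmul0r ?bmulr0 ?bmulUU // ?e // -e.
Qed.

Lemma bmul1f : left_id bone bmul.
Proof.
move=> f; rewrite bmulEr [RHS]balgE; apply: eq_bigr => a _.
congr (_ *: _); rewrite bmul_suml (bigD1 (bs_src a)) //= bmulUU bs_mul1l eqxx.
rewrite big1 ?addr0 // => x /negbTE nx.
by rewrite bmulUU bs_mul1l nx.
Qed.

Lemma bmulf1 : right_id bone bmul.
Proof.
move=> f; rewrite bmulEl [RHS]balgE; apply: eq_bigr => a _.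
congr (_ *: _); rewrite bmul_sumr (bigD1 (bs_tgt a)) //= bmulUU bs_mul1r eqxx.
rewrite big1 ?addr0 // => x /negbTE nx.
by rewrite bmulUU bs_mul1r eq_sym nx.
Qed.

HB.instance Definition _ := GRing.Zmodule_isPzRing.Build balg
  bmulA bmul1f bmulf1 bmulDl bmulDr.

Lemma bprE n (f : balg) a : (bpr n f)@_a = if bs_deg a == n then f@_a else 0.
Proof.
rewrite raddf_sum /=; case: (msuppP f a) => [ha|ha].
  rewrite big_mkcond (big_fsetD1 _ ha) /= big1_fset ?addr0.
    by case: ifP; rewrite // mcoeffUU.
  move=> b; rewrite in_fsetD1 => /andP[/negbTE nb _] _.
  by case: ifP; rewrite // mcoeffU nb.
rewrite if_same big1_fset // => b hb _; rewrite mcoeffU.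
by case: eqP hb ha => // -> ->.
Qed.

Fact bpr_grading : is_grading bpr.
Proof.
split=> [n f g | i j f | f].
- apply/malgP => a; rewrite !(bprE, mcoeffB).
  by case: ifP; rewrite ?subrr.
- apply/malgP => a; rewrite bprE; have [->|nij] := eqVneq i j.
    by rewrite !bprE; case: (bs_deg a == j).
  rewrite mcoeff0 bprE; case: eqP => // ->.
  by rewrite (negbTE nij).
- exists (undup [seq bs_deg a | a <- msupp f]); first exact: undup_uniq.
  apply/malgP => a; rewrite raddf_sum /=.
  under eq_bigr => i _ do rewrite bprE.
  case: (msuppP f a) => [ha|ha]; last by rewrite big1 // => i _; case: ifP.
  rewrite (bigD1_seq (bs_deg a)) ?undup_uniq ?mem_undup ?map_f //= eqxx.
  by rewrite big1 ?addr0 // => i /negbTE; rewrite eq_sym => ->.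
Qed.

Fact bpr_one : 1 \in homog bpr 0%N.
Proof.
rewrite unfold_in /homog; apply/eqP/malgP => a.
rewrite bprE; case: eqP => // na.
rewrite [in RHS]raddf_sum big1 // => x _; rewrite /= mcoeffU.
by case: eqP na => // <-; rewrite bs_deg_id.
Qed.

Let homog_bprP n (f : balg) :
  f \in homog bpr n <-> forall a, bs_deg a != n -> f@_a = 0.
Proof.
rewrite unfold_in /homog; split=> [/eqP <- a /negbTE na | h].
  by rewrite bprE na.
by apply/eqP/malgP => a; rewrite bprE; case: eqP => // /eqP /h ->.
Qed.

Fact bpr_mul i j (f g : balg) :
  f \in homog bpr i -> g \in homog bpr j -> f * g \in homog bpr (i + j)%N.
Proof.
move=> /homog_bprP hf /homog_bprP hg; apply/homog_bprP => c nc.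
rewrite [_ * _]/(bmul f g) raddf_sum big1 // => a _.
rewrite raddf_sum big1 //= => b _; rewrite mcoeffZ.
have [da|/hf ->] := eqVneq (bs_deg a) i; last by rewrite !mul0r.
have [db|/hg ->] := eqVneq (bs_deg b) j; last by rewrite mulr0 mul0r.
case e: (bs_mul a b) => [d|] /=; last by rewrite mcoeff0 mulr0.
rewrite mcoeffU; case: eqP => [dc|]; last by rewrite mulr0.
by move: nc; rewrite -dc (bs_degM e) da db eqxx.
Qed.

Definition basis_gradedRing : gradedRing :=
  GradedRing bpr_grading bpr_one bpr_mul.

End BasisAlgebra.

(* Lengths in nat with infinity, represented by None. *)
Definition oaddn (m n : option nat) : option nat :=
  if m is Some a then (if n is Some b then Some (a + b)%N else None) else None.

Record digraph := Digraph {
  vert :> finType;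
  arrow : rel vert;
  arrow_irr : irreflexive arrow
}.

Section Digraph.
Variable G : digraph.
Local Notation e := (@arrow G).

Definition has_path (x y : G) (n : nat) : bool :=
  [exists p : n.-tuple G, path e x p && (last x p == y)].

Lemma has_pathP x y n :
  reflect (exists2 p, path e x p & last x p = y /\ size p = n) (has_path x y n).
Proof.
apply: (iffP existsP) => [[p /andP[pp /eqP lp]] | [p pp [lp sp]]].
  by exists p; rewrite ?size_tuple.
have sp' : size p == n by apply/eqP.
by exists (Tuple sp'); rewrite /= pp lp eqxx.
Qed.

Lemma connect_has_path x y : connect e x y -> exists n, has_path x y n.
Proof.
by move=> /connectP[p pp lp]; exists (size p); apply/has_pathP; exists p.
Qed.

Definition dist (x y : G) : option nat :=
  if @idP (connect e x y) is ReflectT c then Some (ex_minn (connect_has_path c))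
  else None.

Lemma distP x y n :
  dist x y = Some n <-> has_path x y n /\ (forall m, has_path x y m -> (n <= m)%N).
Proof.
rewrite /dist; case: {-}_ / idP => [c | nc].
  case: ex_minnP => m hm mmin; split=> [[<-] // | [hn nmin]].
  by congr Some; apply/eqP; rewrite eqn_leq mmin // nmin.
split=> // -[/has_pathP[p pp [lp _]] _]; case: nc; apply/connectP.
by exists p.
Qed.

Lemma dist_connect x y : connect e x y = isSome (dist x y).
Proof. by rewrite /dist; case: {-}_ / idP => [c | /negP/negbTE nc] /=. Qed.

Lemma has_path_cat x y z m n :
  has_path x y m -> has_path y z n -> has_path x z (m + n).
Proof.
move=> /has_pathP[p pp [lp sp]] /has_pathP[q pq [lq sq]]; apply/has_pathP.
exists (p ++ q); first by rewrite cat_path pp lp.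
by rewrite last_cat lp lq size_cat sp sq.
Qed.

Lemma dist_triangle x y z m n k :
  dist x y = Some m -> dist y z = Some n -> dist x z = Some k -> (k <= m + n)%N.
Proof.
move=> /distP[hm _] /distP[hn _] /distP[_ kmin].
exact: kmin (has_path_cat hm hn).
Qed.

Lemma dist_xx x : dist x x = Some 0%N.
Proof. by apply/distP; split=> //; apply/has_pathP; exists [::]. Qed.

(* Paths (p_0, ..., p_n), encoded as p_0 and the sequence of other vertices. *)
Definition gpath := {p : G * seq G | path e p.1 p.2}.
HB.instance Definition _ := SubChoice.on gpath.

Definition psrc (p : gpath) : G := (val p).1.
Definition ptgt (p : gpath) : G := last (val p).1 (val p).2.
Definition plen (p : gpath) : nat := size (val p).2.
Definition pverts (p : gpath) : seq G := (val p).1 :: (val p).2.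

Definition pconst (x : G) : gpath := Sub (x, [::]) isT.

Definition pcat (p q : gpath) : option gpath :=
  if ptgt p == psrc q then insub (psrc p, (val p).2 ++ (val q).2) else None.

Lemma pcat_val p q r : pcat p q = Some r <->
  ptgt p = psrc q /\ val r = (psrc p, (val p).2 ++ (val q).2).
Proof.
rewrite /pcat; split=> [|[-> er]].
  by case: eqP => // epq; case: insubP => // u _ eu [<-].
by rewrite eqxx -er valK.
Qed.

Lemma pcatN p q : pcat p q = None <-> ptgt p <> psrc q.
Proof.
rewrite /pcat; case: eqP => // epq; split=> //.
case: insubP => // /negP []; rewrite /= cat_path (valP p).
by have := valP q; rewrite -/(psrc q) -epq.
Qed.

Definition connect_same (p q : gpath) : Prop :=
  psrc p = psrc q /\ ptgt p = ptgt q.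

Definition shortest (p : gpath) : Prop := dist (psrc p) (ptgt p) = Some (plen p).
Definition long (p : gpath) : Prop := ~ shortest p.

Definition subpath (r p : gpath) : bool := infix (pverts r) (pverts p).

Definition pcat3 (q p q' : gpath) : option gpath := obind (pcat^~ q') (pcat q p).

Record congruence (R : gpath -> gpath -> Prop) : Prop := Congruence {
  congr_refl : forall p, R p p;
  congr_sym : forall p q, R p q -> R q p;
  congr_trans : forall p q r, R p q -> R q r -> R p r;
  congr_ends : forall p q, R p q -> connect_same p q;
  congr_cat : forall p p' q q' r r', R p p' ->
    pcat3 q p q' = Some r -> pcat3 q p' q' = Some r' -> R r r'
}.

(* The minimal congruence is the intersection of all those congruences. *)
Definition two_short_congruent (p q : gpath) : Prop :=
  forall R : gpath -> gpath -> Prop, congruence R ->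
  (forall p' q', shortest p' -> shortest q' -> connect_same p' q' ->
     (plen p' <= 2)%N -> R p' q') ->
  R p q.

Definition two_reducible (p : gpath) : Prop :=
  long p /\ exists r, [/\ subpath r p, long r & (plen r <= 2)%N].

Definition two_quasi_reducible (p : gpath) : Prop :=
  long p /\ exists q, two_short_congruent p q /\ two_reducible q.

Definition property_V2 : Prop :=
  (forall p q, shortest p -> shortest q -> connect_same p q ->
     two_short_congruent p q) /\
  (forall p, long p -> two_quasi_reducible p).

Definition mnorm (s : seq G) : option nat :=
  if s is x :: s' then foldr oaddn (Some 0%N) (pairmap dist x s') else Some 0%N.

Definition mtuple (n l : nat) :=
  {t : n.+1.-tuple G | sorted (fun x y => x != y) t && (mnorm t == Some l)}.
HB.instance Definition _ n l := SubFinite.on (mtuple n l).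

Definition MC (n l : nat) : zmodType := {ffun mtuple n l -> int}.

Definition mgen n l (t : mtuple n l) : MC n l := [ffun s => (s == t)%:R].

Definition mdelete n (i : 'I_n.+2) (t : n.+2.-tuple G) : n.+1.-tuple G :=
  [tuple tnth t (lift i j) | j < n.+1].

(* Deletion of x_i, or 0 if this does not give a generator of MC n l. When the
   norm is preserved, consecutive entries remain distinct. *)
Definition mface n l (i : 'I_n.+2) (t : mtuple n.+1 l) : MC n l :=
  if insub (mdelete i (val t)) is Some s then mgen s else 0.

Definition mdiff n l (f : MC n.+1 l) : MC n l :=
  \sum_(t : mtuple n.+1 l) \sum_(i < n.+2) mface i t *~ ((-1) ^+ i * f t).

Fact mdiffB n l : {morph @mdiff n l : f g / f - g}.
Proof.
move=> f g; rewrite /mdiff -sumrB; apply: eq_bigr => t _.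
rewrite -sumrB; apply: eq_bigr => i _.
by rewrite !ffunE mulrBr mulrzBr.
Qed.

Definition mcycle n l : {pred MC n l} :=
  match n with 0%N => fun=> true | n'.+1 => fun f => @mdiff n' l f == 0 end.

Fact mcycle_zmod n l : zmod_closed (@mcycle n l).
Proof.
case: n => [|n]; split=> //; rewrite ?unfold_in /=.
  by have := @mdiffB n l 0 0; rewrite !subrr => ->.
by move=> f g; rewrite !unfold_in /= mdiffB => /eqP -> /eqP ->; rewrite subrr.
Qed.

Definition MZ n l := {f : MC n l | f \in @mcycle n l}.
HB.instance Definition _ n l := SubChoice.on (MZ n l).
HB.instance Definition _ n l :=
  GRing.SubChoice_isSubZmodule.Build _ _ (MZ n l) (@mcycle_zmod n l).

Definition mboundary n l : {pred MZ n l} :=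
  fun z => `[< exists g : MC n.+1 l, mdiff g = val z >].

Fact mboundary_zmod n l : zmod_closed (@mboundary n l).
Proof.
split=> [|u v]; rewrite !unfold_in.
  by apply/asboolP; exists 0; have := @mdiffB n l 0 0; rewrite !subrr.
move=> /asboolP[f hf] /asboolP[g hg]; apply/asboolP.
by exists (f - g); rewrite mdiffB hf hg.
Qed.
HB.instance Definition _ n l :=
  GRing.isZmodClosed.Build (MZ n l) (@mboundary n l) (@mboundary_zmod n l).

Definition MH n l : zmodType := Quotient.quot (@mboundary n l).

Definition diagonal : Prop := forall n l, l <> n -> forall h : MH n l, h = 0.

Definition dpair := {p : G * G | connect e p.1 p.2}.
HB.instance Definition _ := SubChoice.on dpair.

Definition dsrc (p : dpair) : G := (val p).1.
Definition dtgt (p : dpair) : G := (val p).2.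

Definition dpair_mul (p q : dpair) : option dpair :=
  if (dtgt p == dsrc q) &&
     (oaddn (dist (dsrc p) (dtgt p)) (dist (dsrc q) (dtgt q))
        == dist (dsrc p) (dtgt q))
  then insub (dsrc p, dtgt q) else None.

Definition dpair_id (x : G) : dpair := Sub (x, x) (connect0 e x).

(* The distance is finite on pairs connected by a path. *)
Definition dpair_deg (p : dpair) : nat := odflt 0%N (dist (dsrc p) (dtgt p)).

Lemma dpair_dist p : dist (dsrc p) (dtgt p) = Some (dpair_deg p).
Proof.
by have := valP p; rewrite /= dist_connect /dpair_deg; case: dist.
Qed.

Lemma dpair_mul_val p q r : dpair_mul p q = Some r <->
  [/\ dtgt p = dsrc q, dsrc r = dsrc p, dtgt r = dtgt q
    & dpair_deg r = (dpair_deg p + dpair_deg q)%N].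
Proof.
rewrite /dpair_mul !dpair_dist /=; split.
  case: eqP => //= epq; case: eqP => // d; case: insubP => // u _ eu [<-].
  have e1 : dsrc u = dsrc p by rewrite /dsrc eu.
  have e2 : dtgt u = dtgt q by rewrite /dtgt eu.
  by split=> //; rewrite /dpair_deg e1 e2 -d.
case=> -> e1 e2 d; rewrite -e1 -e2 dpair_dist d !eqxx /=.
by rewrite /dsrc /dtgt -surjective_pairing valK.
Qed.

Fact dpair_mulA a b c :
  obind (dpair_mul^~ c) (dpair_mul a b) = obind (dpair_mul a) (dpair_mul b c).
Proof.
suff h r : obind (dpair_mul^~ c) (dpair_mul a b) = Some r <->
           obind (dpair_mul a) (dpair_mul b c) = Some r.
  case E: (obind _ (dpair_mul a b)) => [r|]; first by apply/esym/h.
  case F: (obind _ (dpair_mul b c)) => [r|//].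
  by move/h: F; rewrite E.
split.
- case E: dpair_mul => [ab|//] /=.
  move/dpair_mul_val: E => [e1 e2 e3 d1] /dpair_mul_val[f1 f2 f3 d2].
  rewrite e3 in f1; have bc : connect e (dsrc b) (dtgt c).
    by apply: connect_trans (valP b) _; rewrite -/(dtgt b) f1; exact: (valP c).
  pose u : dpair := Sub (dsrc b, dtgt c) bc.
  have le1 : (dpair_deg u <= dpair_deg b + dpair_deg c)%N.
    apply: dist_triangle (dpair_dist b) _ (dpair_dist u).
    by rewrite f1; exact: dpair_dist.
  have le2 : (dpair_deg r <= dpair_deg a + dpair_deg u)%N.
    apply: dist_triangle (dpair_dist a) _ _.
      by rewrite e1; exact: (dpair_dist u).
    by rewrite -e2 -f2 /u {1}/dtgt /= -f3; exact: dpair_dist.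
  have du : dpair_deg u = (dpair_deg b + dpair_deg c)%N.
    apply/eqP; rewrite eqn_leq le1 /= -(leq_add2l (dpair_deg a)).
    by rewrite addnA -d1 -d2.
  have -> : dpair_mul b c = Some u by apply/dpair_mul_val.
  by apply/dpair_mul_val; split=> //; [rewrite f2 | rewrite du addnA -d1].
- case E: dpair_mul => [bc|//] /=.
  move/dpair_mul_val: E => [e1 e2 e3 d1] /dpair_mul_val[f1 f2 f3 d2].
  rewrite e2 in f1; have ab : connect e (dsrc a) (dtgt b).
    by apply: connect_trans (valP a) _; rewrite -/(dtgt a) f1; exact: (valP b).
  pose u : dpair := Sub (dsrc a, dtgt b) ab.
  have le1 : (dpair_deg u <= dpair_deg a + dpair_deg b)%N.
    apply: dist_triangle (dpair_dist a) _ (dpair_dist u).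
    by rewrite f1; exact: dpair_dist.
  have le2 : (dpair_deg r <= dpair_deg u + dpair_deg c)%N.
    apply: dist_triangle (dpair_dist u) _ _.
      by rewrite /u {1}/dtgt /= e1; exact: (dpair_dist c).
    by rewrite /u {1}/dsrc /= -f2 -e3 -f3; exact: dpair_dist.
  have du : dpair_deg u = (dpair_deg a + dpair_deg b)%N.
    apply/eqP; rewrite eqn_leq le1 /= -(leq_add2r (dpair_deg c)).
    by rewrite -addnA -d1 -d2.
  have -> : dpair_mul a b = Some u by apply/dpair_mul_val.
  by apply/dpair_mul_val; split=> //; [rewrite f3 | rewrite du -addnA -d1].
Qed.

Fact dpair_deg_id x : dpair_deg (dpair_id x) = 0%N.
Proof. by rewrite /dpair_deg dist_xx. Qed.

Fact dpair_mul1l x b :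
  dpair_mul (dpair_id x) b = if x == dsrc b then Some b else None.
Proof.
case: eqP => [->|nx]; last by rewrite /dpair_mul /= (introF eqP nx).
by apply/dpair_mul_val; split=> //; rewrite dpair_deg_id.
Qed.

Fact dpair_mul1r b x :
  dpair_mul b (dpair_id x) = if dtgt b == x then Some b else None.
Proof.
case: eqP => [<-|nx]; last by rewrite /dpair_mul /= (introF eqP nx).
by apply/dpair_mul_val; split=> //; rewrite dpair_deg_id addn0.
Qed.

Fact dpair_degM a b c :
  dpair_mul a b = Some c -> dpair_deg c = (dpair_deg a + dpair_deg b)%N.
Proof. by case/dpair_mul_val. Qed.

Definition distance_basis : basis G :=
  Basis dpair_mulA dpair_mul1l dpair_mul1r dpair_deg_id dpair_degM.

Definition distance_algebra (K : fieldType) : gradedRing :=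
  basis_gradedRing K distance_basis.

Fact pcatA a b c : obind (pcat^~ c) (pcat a b) = obind (pcat a) (pcat b c).
Proof.
case E: (pcat a b) => [ab|] /=; case F: (pcat b c) => [bc|] //=.
- move/pcat_val: E => [e1 e2]; move/pcat_val: F => [f1 f2].
  have e3 : ptgt ab = ptgt b by rewrite /ptgt e2 /= last_cat -/(ptgt a) e1.
  have f3 : psrc bc = psrc b by rewrite {1}/psrc f2.
  rewrite /pcat e3 f3 e1 f1 !eqxx /psrc e2 f2 /=.
  by rewrite catA.
- move/pcat_val: E => [e1 e2]; move/pcatN: F => F.
  by apply/pcatN; rewrite /ptgt e2 /= last_cat -/(ptgt a) e1.
- move/pcat_val: F => [f1 f2]; move/pcatN: E => E.
  by apply/esym/pcatN; rewrite {1}/psrc f2.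
Qed.

Fact pcat1l x b : pcat (pconst x) b = if x == psrc b then Some b else None.
Proof.
case: eqP => [->|nx]; last exact/pcatN.
by apply/pcat_val; split=> //; rewrite /psrc /= -surjective_pairing.
Qed.

Fact pcat1r b x : pcat b (pconst x) = if ptgt b == x then Some b else None.
Proof.
case: eqP => [<-|nx]; last exact/pcatN.
by apply/pcat_val; split=> //; rewrite /psrc /= cats0 -surjective_pairing.
Qed.

Fact plen_const x : plen (pconst x) = 0%N.
Proof. by []. Qed.

Fact plen_cat a b c : pcat a b = Some c -> plen c = (plen a + plen b)%N.
Proof. by case/pcat_val => _ ec; rewrite /plen ec size_cat. Qed.

Definition path_basis : basis G :=
  Basis pcatA pcat1l pcat1r plen_const plen_cat.

Definition path_algebra (K : fieldType) : gradedRing :=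
  basis_gradedRing K path_basis.

(* bgen sends None, hence a sequence of vertices which is not a path, to 0. *)
Definition t_elt (K : fieldType) (x y : G) : path_algebra K :=
  \sum_(v : G) @bgen K G path_basis (insub (x, [:: v; y])).

Definition t_rel (K : fieldType) (a : path_algebra K) : Prop :=
  exists x y, dist x y = Some 2%N /\ a = t_elt K x y.

Fact t_rel_homog (K : fieldType) (a : path_algebra K) :
  t_rel a -> exists n, a \in homog (@gr_pr (path_algebra K)) n.
Proof.
case=> x [y [_ ->]]; exists 2%N; rewrite unfold_in /homog.
rewrite /t_elt (grad_bigsum (gr_grading _)); apply/eqP/eq_bigr => v _.
apply/malgP => p; rewrite [LHS]bprE; case: eqP => // np.
case: insubP => [q _ eq|_] /=; last by rewrite mcoeff0.
rewrite mcoeffU; case: eqP np => // <- [].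
by rewrite /= /plen eq.
Qed.

Definition path_cochain_algebra (K : fieldType) : gradedRing :=
  quotient_gradedRing (@t_rel_homog K).

End Digraph.

(* Main.v *)
From HB Require Import structures.
Require Import Defs.
From mathcomp Require Import all_boot all_order all_algebra.
From mathcomp Require Import generic_quotient ring_quotient.
From mathcomp Require Import finmap boolp zify.
From mathcomp.multinomials Require Import monalg.

(** Over one field K, all three statements are compared with the exactness of
    one complex attached to the distance d. Let N_k be the space of functions
    on the paths with k arrows that are killed by every inner face
    c |-> sum_v c (.., x, v, y, ..), where v runs over the vertices strictly
    between x and y. For a vertex z, appending to a path y the first step v of
    a geodesic from the end of y to z gives a differential
      (kappa g) (y, z) = sum_v g (y v, z)
    from families in N_(k+1) to families in N_k; this couples the
    coalgebra dual to K G / T with the distance algebra, and is called the Koszul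
    complex below.

    Magnitude homology. The Koszul complex is exact in positive degrees exactly
    when the magnitude chains with coefficients in K have no homology off the
    diagonal. Given exactness, a cycle of norm larger than its length is changed
    by boundaries until it lives on tuples whose first j steps have length one;
    the vanishing of kappa on the part that follows is what allows j to grow
    (adapt_step), and a tuple with only unit steps has norm equal to length. The
    converse goes by induction on the total length. Integral homology is
    recovered from the fields: a complex of integer matrices is exact when it
    is so over Q and every F_p, by the Smith normal form, and conversely
    exactness at two consecutive places passes to every field. This gives
    diagonal_off_diagonal_exact.

    Koszul algebras. Comparing with the resolution of the definition, a complex
    of graded projective modules, the n-th one generated in degree n, that is
    exact in the lowest degrees is exact if and only if the algebra is Koszul,
    once its part of degree zero is semisimple (exact_koszul, koszul_exact). For
    the distance algebra such a complex is given by kappa for the opposite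
    distance, because left modules append at the beginning of a path; its
    exactness in the lowest degrees is automatic.
    The magnitude chain complex does not see the direction of the distance
    (off_diagonal_exact_transpose), so (1) and (2) are equivalent.

    For the path cochain algebra, degree k of the ideal T is the annihilator of
    N_k (ideal_ppair, ppair_ideal), so that K G / T is dual to N in each degree.
    The functions f with f (x, z) in (K G / T) e_x, supported on the pairs at
    distance n, form a complex whose homogeneous parts are dual to the kappa
    complexes of the vertices z at fixed distance n; by the Fredholm alternative
    one is exact if and only if the other is. Now exactness in the lowest
    degrees is not automatic: it is the exactness of kappa on paths of one
    arrow, and this is equivalent to the property V_2
    (property_V2_level_exact, level_exact_property_V2). A linear functional
    that kills the image of kappa is a function of the first arrow of a path to
    z which is unchanged by 2-short moves and vanishes on 2-reducible paths;
    V_2 makes it constant, and conversely the indicator functions of the first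
    arrows of a congruence class, or of the paths that are not
    2-quasi-reducible, are such functionals. *)

Set Implicit Arguments.
Unset Strict Implicit.
Unset Printing Implicit Defensive.

Import GRing.Theory.
Local Open Scope ring_scope.

(** * Finite systems of linear equations *)

Lemma sum_enum_val (R : nmodType) (X : finType) (f : X -> R) :
  \sum_(i < #|X|) f (enum_val i) = \sum_x f x.
Proof. by rewrite [RHS](reindex _ (onW_bij _ (@enum_val_bij X))). Qed.

Section LinearFunctionals.
Variable K : fieldType.

(** Functionals on the functions X -> K, kept as bare predicates so that faces,
    evaluations and their restrictions can be used without packaging. *)
Definition linear_functional (X : Type) (F : (X -> K) -> K) :=
  forall a u v, F (fun x => a * u x + v x) = a * F u + F v.

Definition unit_fun (X : eqType) (x y : X) : K := (y == x)%:R.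

Lemma linear_functional0 (X : Type) F : @linear_functional X F -> F (fun=> 0) = 0.
Proof.
move=> linF; have := linF (-1) (fun=> 0) (fun=> 0).
by rewrite mulN1r addNr => {1}->; rewrite mulN1r addNr.
Qed.

Lemma linear_functionalE (X : finType) F (w : X -> K) : @linear_functional X F ->
  F w = \sum_x w x * F (unit_fun x).
Proof.
move=> linF.
have aux (r : seq X) : F (fun y => \sum_(x <- r) w x * unit_fun x y) =
    \sum_(x <- r) w x * F (unit_fun x).
  elim: r => [|x r IHr].
    rewrite big_nil -[RHS](linear_functional0 linF).
    by congr F; apply/funext => y; rewrite big_nil.
  rewrite big_cons -IHr -linF; congr F.
  by apply/funext => y; rewrite big_cons.
rewrite -aux; congr F; apply/funext => y.
rewrite (bigD1 y) //= big1 ?addr0 /unit_fun ?eqxx ?mulr1 // => x nxy.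
by rewrite eq_sym (negbTE nxy) mulr0.
Qed.

(** Row spaces contain the vectors killed by their cokernel: here the rows are
    the functionals F c, written in the basis of unit functions. *)
Lemma fredholm (X C : finType) (F : C -> (X -> K) -> K) (g : (X -> K) -> K) :
  (forall c, linear_functional (F c)) -> linear_functional g ->
  (forall w, (forall c, F c w = 0) -> g w = 0) ->
  exists a : C -> K, forall w, g w = \sum_c a c * F c w.
Proof.
move=> linF ling hg.
pose M := \matrix_(c < #|C|, x < #|X|) F (enum_val c) (unit_fun (enum_val x)).
pose v := \row_(x < #|X|) g (unit_fun (enum_val x)).
have : (v <= M)%MS.
  rewrite submxE; apply/eqP/rowP => j; rewrite [RHS]mxE.
  pose w x := cokermx M (enum_rank x) j.
  have ext (f : (X -> K) -> K) : linear_functional f ->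
      f w = \sum_i f (unit_fun (enum_val i)) * cokermx M i j.
    move=> linf; rewrite (linear_functionalE w linf) -sum_enum_val.
    by apply: eq_bigr => i _; rewrite /w enum_valK mulrC.
  have : g w = 0.
    apply: hg => c; rewrite ext //.
    have /matrixP/(_ (enum_rank c) j) := mulmx_coker M; rewrite !mxE => e.
    apply: etrans e; apply: eq_bigr => i _.
    by rewrite [M _ _]mxE enum_rankK.
  rewrite ext // => e; apply: etrans e; rewrite mxE.
  by apply: eq_bigr => i _; rewrite [v _ _]mxE.
case/submxP => a ea; exists (fun c => a 0 (enum_rank c)) => w.
rewrite (linear_functionalE w ling).
under [RHS]eq_bigr => c _ do rewrite (linear_functionalE w (linF c)) mulr_sumr.
rewrite exchange_big /=; apply: eq_bigr => x _.
have /rowP/(_ (enum_rank x)) := ea; rewrite !mxE enum_rankK => ->.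
rewrite mulr_sumr -[RHS]sum_enum_val; apply: eq_bigr => i _.
by rewrite [M _ _]mxE enum_rankK enum_valK mulrCA.
Qed.

(** This is fredholm for the transposed system: its unknowns are the
    coefficients a, its equations are indexed by X. *)
Lemma fredholm_solve (X C : finType) (F : C -> (X -> K) -> K) (g : C -> K) :
  (forall c, linear_functional (F c)) ->
  (forall a : C -> K, (forall w, \sum_c a c * F c w = 0) -> \sum_c a c * g c = 0) ->
  exists w, forall c, F c w = g c.
Proof.
move=> linF hg.
have lin_sum (h : C -> K) : linear_functional (fun a : C -> K => \sum_c a c * h c).
  move=> a u v; rewrite mulr_sumr -big_split /=.
  by apply: eq_bigr => c _; rewrite mulrDl mulrA.
have [|w hw] := @fredholm C X (fun x a => \sum_c a c * F c (unit_fun x))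
  (fun a => \sum_c a c * g c) (fun=> lin_sum _) (lin_sum _).
  move=> a ha; apply: hg => w.
  under eq_bigr => c _ do rewrite (linear_functionalE w (linF c)) mulr_sumr.
  rewrite exchange_big /= big1 // => x _.
  under eq_bigr => c _ do rewrite mulrCA.
  by rewrite -mulr_sumr ha mulr0.
have pick (h : C -> K) c : \sum_c' unit_fun c c' * h c' = h c.
  rewrite (bigD1 c) //= /unit_fun eqxx mul1r big1 ?addr0 // => c' /negbTE ->.
  by rewrite mul0r.
exists w => c; rewrite (linear_functionalE w (linF c)) -[RHS]pick hw.
by apply: eq_bigr => x _; rewrite pick.
Qed.

(** The space of solutions is a row kernel B, and pinvmx B *m B is a projection
    onto it. *)
Lemma projector_exists (X C : finType) (F : C -> (X -> K) -> K) :
  (forall c, linear_functional (F c)) ->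
  exists E : X -> X -> K, (forall x c, F c (E x) = 0) /\
    forall g, (forall c, F c g = 0) -> forall y, \sum_x g x * E x y = g y.
Proof.
move=> linF.
pose M := \matrix_(x < #|X|, c < #|C|) F (enum_val c) (unit_fun (enum_val x)).
have FE (w : 'rV_#|X|) c : F c (fun y => w 0 (enum_rank y)) = (w *m M) 0 (enum_rank c).
  rewrite (linear_functionalE _ (linF c)) -sum_enum_val mxE.
  by apply: eq_bigr => i _; rewrite [M _ _]mxE enum_rankK enum_valK.
pose B := kermx M; pose E := pinvmx B *m B.
exists (fun x y => E (enum_rank x) (enum_rank y)); split=> [x c | g hg y].
  have := FE (row (enum_rank x) E) c.
  rewrite -row_mul {2}/E -mulmxA (mulmx_ker M : B *m M = 0) mulmx0.
  rewrite row0 [in RHS]mxE => e; apply: etrans e; congr F.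
  by apply/funext => y'; rewrite [RHS]mxE.
pose w : 'rV_#|X| := \row_i g (enum_val i).
have gw : g = fun y => w 0 (enum_rank y) by apply/funext => y'; rewrite mxE enum_rankK.
have wB : (w <= B)%MS.
  apply/sub_kermxP/rowP => c; rewrite [RHS]mxE.
  by rewrite -[c]enum_valK -FE -gw.
have /rowP/(_ (enum_rank y)) := mulmxKpV wB.
rewrite -mulmxA -/E mxE [w _ _]mxE enum_rankK => e; apply: etrans e.
rewrite -sum_enum_val; apply: eq_bigr => i _.
by rewrite [w _ _]mxE enum_valK.
Qed.

End LinearFunctionals.

(** * Faces of tuples in a finite metric *)

(** What a distance between vertices and its opposite have in common; the last
    clause says that geodesics can be followed by unit steps. *)
Record is_metric (V : eqType) (d : V -> V -> option nat) : Prop := IsMetric {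
  metric_eq0 : forall x y, d x y = Some 0%N <-> x = y;
  metric_triangle : forall x y z a b, d x y = Some a -> d y z = Some b ->
    exists2 c, d x z = Some c & (c <= a + b)%N;
  metric_geodesic : forall x y m, d x y = Some m.+1 ->
    exists2 v, d x v = Some 1%N & d v y = Some m
}.

Definition norm_along (V : Type) (d : V -> V -> option nat) (s : seq V) :=
  if s is x :: s' then foldr oaddn (Some 0%N) (pairmap d x s') else Some 0%N.

Section MetricChains.
Variables (K : fieldType) (V : finType) (d : V -> V -> option nat).
Hypothesis dM : is_metric d.
Local Notation nrm := (norm_along d).
Implicit Types (x y z v w : V) (s t p q r : seq V).

Definition between x v y :=
  [&& x != v, v != y, d x y != None & oaddn (d x v) (d v y) == d x y].

Lemma betweenP x v y : reflect
  (exists a b, [/\ d x v = Some a.+1, d v y = Some b.+1 & d x y = Some (a + b).+2])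
  (between x v y).
Proof.
apply: (iffP and4P) => [[nxv nvy]|].
  case exy: (d x y) => [m|//] _; case exv: (d x v) => [a|//].
  case evy: (d v y) => [b|//] /= /eqP[<-].
  case: a exv => [|a] exv; first by case/eqP: nxv; apply/(metric_eq0 dM).
  case: b evy => [|b] evy; first by case/eqP: nvy; apply/(metric_eq0 dM).
  by exists a, b; rewrite addnS.
case=> a [b [exv evy exy]]; split; rewrite ?exv ?evy ?exy //=.
- by apply/eqP => /(metric_eq0 dM); rewrite exv.
- by apply/eqP => /(metric_eq0 dM); rewrite evy.
- by rewrite addnS.
Qed.

(** Inserting w between v and y and then v between x and w, or the other way
    round, is the same condition; hence faces commute. *)
Lemma between_assoc x v w y :
  between x v w && between x w y = between v w y && between x v y.
Proof.
apply/andP/andP => [[/betweenP[a [b [e1 e2 e3]]] /betweenP[a' [c [e4 e5 e6]]]] |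
  [/betweenP[b [c [e1 e2 e3]]] /betweenP[a [c' [e4 e5 e6]]]]].
- move: e4; rewrite e3 => -[ea].
  have [m evy lem] := metric_triangle dM e2 e5.
  have [m' exy lem'] := metric_triangle dM e1 evy.
  move: exy; rewrite e6 => -[em'].
  have em : m = (b + c).+2 by lia.
  split; apply/betweenP; first by exists b, c; rewrite evy em.
  by exists a, (b + c).+1; rewrite evy em e6; split=> //; congr Some; lia.
- move: e5; rewrite e3 => -[ec].
  have [m exw lem] := metric_triangle dM e4 e1.
  have [m' exy lem'] := metric_triangle dM exw e2.
  move: exy; rewrite e6 => -[em'].
  have em : m = (a + b).+2 by lia.
  split; apply/betweenP; first by exists a, b; rewrite exw em.
  by exists (a + b).+1, c; rewrite exw em e6; split=> //; congr Some; lia.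
Qed.

(** The coefficient at s of the face d_(i+1) of the chain c: the tuples with
    this face are those obtained from s by inserting a vertex in its gap i, and
    only vertices strictly between its two sides preserve the norm. The
    truncated cases make a face zero where s has no gap i, so that no dependent
    type records the length. *)
Fixpoint face (i : nat) (c : seq V -> K) s {struct i} : K :=
  match i, s with
  | 0, x :: y :: s' => \sum_v (between x v y)%:R * c (x :: v :: y :: s')
  | i'.+1, x :: s' => face i' (fun t => c (x :: t)) s'
  | _, _ => 0
  end.

Lemma face_cat p x y q c : face (size p) c (p ++ x :: y :: q) =
  \sum_v (between x v y)%:R * c (p ++ x :: v :: y :: q).
Proof. by elim: p c => [//|a p IHp] c /=; rewrite IHp. Qed.

Lemma gap_split i s : (i.+1 < size s)%N ->
  exists p x y q, s = p ++ x :: y :: q /\ size p = i.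
Proof.
move=> lt; case e: (drop i s) (size_drop i s) => [|x [|y q]] /=; try lia.
move=> _; exists (take i s), x, y, q; rewrite -e cat_take_drop size_take.
by case: ifP => //; lia.
Qed.

Lemma face_oversize i s c : (size s <= i.+1)%N -> face i c s = 0.
Proof.
by elim: i s c => [|i IHi] [|x s] c //=; [case: s | move=> lt; apply: IHi].
Qed.

Lemma face_neq0 i s c : face i c s != 0 -> exists p x y q v,
  [/\ s = p ++ x :: y :: q, size p = i, between x v y
    & c (p ++ x :: v :: y :: q) != 0].
Proof.
case: (leqP (size s) i.+1) => [/face_oversize->|]; first by rewrite eqxx.
case/gap_split=> p [x [y [q [-> <-]]]]; rewrite face_cat => nz.
have [v hv] : exists v, (between x v y)%:R * c (p ++ x :: v :: y :: q) != 0.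
  apply/existsP; apply: contraNT nz; rewrite negb_exists => /forallP h.
  by apply/eqP/big1 => v _; apply/eqP; have := h v; rewrite negbK.
exists p, x, y, q, v; move: hv; case: between => /=; rewrite ?mul0r ?eqxx //.
by rewrite mul1r.
Qed.

Lemma face_eq0 i s c : (forall p x y q v, s = p ++ x :: y :: q -> size p = i ->
  between x v y -> c (p ++ x :: v :: y :: q) = 0) -> face i c s = 0.
Proof.
move=> h; apply/eqP; apply: contraT => /face_neq0[p [x [y [q [v [e1 e2 e3]]]]]].
by rewrite (h p x y q v) ?eqxx.
Qed.

Lemma face_ext i s c c' : (forall p x y q v, s = p ++ x :: y :: q -> size p = i ->
  between x v y -> c (p ++ x :: v :: y :: q) = c' (p ++ x :: v :: y :: q)) ->
  face i c s = face i c' s.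
Proof.
case: (leqP (size s) i.+1) => [le|]; first by rewrite !face_oversize.
case/gap_split=> p [x [y [q [-> <-]]]] h; rewrite !face_cat.
apply: eq_bigr => v _; case e: between; last by rewrite !mul0r.
by rewrite h.
Qed.

Lemma face_linear i a (c c' : seq V -> K) s :
  face i (fun t => a * c t + c' t) s = a * face i c s + face i c' s.
Proof.
elim: i s c c' => [|i IHi] [|x s] c c' /=; rewrite ?mulr0 ?addr0 //.
case: s => [|y s]; rewrite ?mulr0 ?addr0 // mulr_sumr -big_split /=.
by apply: eq_bigr => v _; rewrite mulrDr mulrCA.
Qed.

Lemma face0 i s : face i (fun=> 0) s = 0.
Proof. exact: face_eq0. Qed.

Lemma faceZ i a c s : face i (fun t => a * c t) s = a * face i c s.
Proof.
have := face_linear i a c (fun=> 0) s; rewrite face0 addr0 => <-.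
by congr face; apply/funext => t; rewrite addr0.
Qed.

Lemma face_sum i (J : Type) (r : seq J) (P : pred J) (F : J -> seq V -> K) s :
  face i (fun t => \sum_(j <- r | P j) F j t) s = \sum_(j <- r | P j) face i (F j) s.
Proof.
elim: r => [|j r IHr].
  by rewrite big_nil -[RHS](face0 i s); congr face; apply/funext => t; rewrite big_nil.
rewrite big_cons; case Pj: (P j).
  rewrite -IHr -[face i (F j) s]mul1r -face_linear; congr face; apply/funext => t.
  by rewrite big_cons Pj mul1r.
by rewrite -IHr; congr face; apply/funext => t; rewrite big_cons Pj.
Qed.

(** Faces only look at tuples with the head of s. *)
Lemma face_headZ i a f g y s : (forall t, f (y :: t) = a * g (y :: t)) ->
  face i f (y :: s) = a * face i g (y :: s).
Proof.
move=> h; rewrite -faceZ; case: i => [|i] /=.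
  by case: s => // z s; apply: eq_bigr => v _; rewrite h.
by congr face; apply/funext => t; rewrite h.
Qed.

Lemma face_face i k c s : face i (face (i + k).+1 c) s = face (i + k) (face i c) s.
Proof.
elim: i s c => [|i IHi] [|x s] c; rewrite ?addSn //; first by case: k.
  case: s => [|y s]; first by case: k => [|[|k]].
  case: k => [|k]; rewrite ?addSn add0n.
    rewrite /=.
    under eq_bigr => v _ do rewrite mulr_sumr.
    under [RHS]eq_bigr => v _ do rewrite mulr_sumr.
    rewrite [RHS]exchange_big /=; apply: eq_bigr => v _; apply: eq_bigr => w _.
    by rewrite !mulrA -!natrM !mulnb (andbC (between x w y)) between_assoc andbC.
  rewrite [RHS]/=; transitivity (face k (fun t => \sum_v
      (if t is z :: _ then (between x v z)%:R else 0) * c (x :: v :: t)) (y :: s)).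
    rewrite face_sum /=; apply: eq_bigr => v _.
    by apply/esym/face_headZ.
  by apply: face_ext => p' x' y' q' v'; case: p' => [|a p'] [<- _] _ _.
exact: (IHi s (fun t => c (x :: t))).
Qed.

(** Faces that delete an end always lower the norm; the sum has one more term
    than there are gaps, and this last term is zero. *)
Definition boundary (c : seq V -> K) s : K := \sum_(i < size s) (-1) ^+ i * face i c s.

Lemma boundary_widen N c s : (size s <= N)%N -> boundary c s = \sum_(i < N) (-1) ^+ i * face i c s.
Proof.
move=> le; rewrite /boundary (big_ord_widen _ (fun i => (-1) ^+ i * face i c s) le).
rewrite big_mkcond; apply: eq_bigr => i _; case: ltnP => // h.
by rewrite face_oversize ?mulr0 // ltnW.
Qed.

(** The usual cancellation of the simplicial identities, after splitting the
    pairs of gaps along the diagonal. *)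
Lemma boundary_boundary c s : boundary (boundary c) s = 0.
Proof.
set N := size s; pose a i j : K := face i (face j c) s.
have -> : boundary (boundary c) s = \sum_(i < N) \sum_(j < N.+1) (-1) ^+ (i + j) * a i j.
  apply: eq_bigr => i _; have -> : face i (boundary c) s =
      face i (fun t => \sum_(j < N.+1) (-1) ^+ j * face j c t) s.
    apply: face_ext => p x y q v es _ _; apply: boundary_widen.
    by rewrite /N es !size_cat /= !addnS.
  rewrite face_sum mulr_sumr; apply: eq_bigr => j _.
  by rewrite faceZ mulrA exprD.
have aS i j : (i <= j)%N -> a i j.+1 = a j i.
  by move=> le; rewrite /a -(subnKC le) face_face.
have -> : \sum_(i < N) \sum_(j < N.+1) (-1) ^+ (i + j) * a i j =
  \sum_(i < N) \sum_(j < N | (j <= i)%N) (-1) ^+ (i + j) * a i j +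
  \sum_(i < N) \sum_(j < N | (i <= j)%N) (-1) ^+ (i + j).+1 * a i j.+1.
  rewrite -big_split; apply: eq_bigr => i _ /=.
  rewrite (bigID (fun j : 'I_N.+1 => (j <= i)%N)) /=; congr (_ + _).
    rewrite big_mkcond big_ord_recr /= leqNgt ltn_ord /= addr0.
    by rewrite [RHS]big_mkcond.
  rewrite big_mkcond big_ord_recl /= add0r [RHS]big_mkcond.
  by apply: eq_bigr => j _; rewrite /bump /= add1n -ltnNge ltnS addnS.
rewrite [X in X + _](exchange_big_dep xpredT) //= -big_split big1 // => i _ /=.
rewrite -big_split big1 //= => j le.
by rewrite aS // exprS mulN1r mulNr [(j + i)%N]addnC subrr.
Qed.

Lemma boundary_linear a c c' s : boundary (fun t => a * c t + c' t) s = a * boundary c s + boundary c' s.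
Proof.
rewrite /boundary mulr_sumr -big_split; apply: eq_bigr => i _ /=.
by rewrite face_linear mulrDr mulrCA.
Qed.

End MetricChains.

(** * The Koszul complex of a metric *)

Section KoszulChains.
Variables (K : fieldType) (V : finType) (d : V -> V -> option nat).
Hypothesis dM : is_metric d.
Local Notation nrm := (norm_along d).
Local Notation fc := (face d).
Local Notation bd := (boundary d).
Local Notation btw := (between d).
Implicit Types (x z v w : V) (s t p q r : seq V) (c : seq V -> K).
Implicit Types (g h : seq V -> V -> K).

Definition unit_step x y := d x y == Some 1%N.

Definition dist_last (y : seq V) (z : V) := if y is x :: y' then d (last x y') z else None.

Lemma dist_last_rcons y x z : dist_last (rcons y x) z = d x z.
Proof. by case: y => [|w y] //=; rewrite last_rcons. Qed.

(** The generators of the magnitude chains of length n and norm l. *)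
Definition norm_valid n l s :=
  [&& size s == n.+1, sorted (fun x y => x != y) s & nrm s == Some l].

Definition chain n l c := forall s, c s != 0 -> norm_valid n l s.

Lemma oaddnA : associative oaddn.
Proof. by move=> [a|] [b|] [c|] //=; rewrite addnA. Qed.

Lemma oadd0n : left_id (Some 0%N) oaddn. Proof. by case. Qed.
Lemma oaddn0 : right_id (Some 0%N) oaddn.
Proof. by case=> //= a; rewrite addn0. Qed.

Lemma nrm_cat p x q : nrm (p ++ x :: q) = oaddn (nrm (rcons p x)) (nrm (x :: q)).
Proof.
case: p => [|a p]; first by rewrite oadd0n.
elim: p a => [|b p IHp] a /=; first by rewrite oaddn0.
by rewrite -oaddnA; congr oaddn; apply: IHp.
Qed.

(** A vertex strictly between its neighbours changes neither the norm nor the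
    distinctness of consecutive entries. *)
Lemma valid_insert n l p x v y q : btw x v y ->
  norm_valid n.+1 l (p ++ x :: v :: y :: q) = norm_valid n l (p ++ x :: y :: q).
Proof.
move=> bt; rewrite /norm_valid !size_cat /= !addnS eqSS; congr [&& _, _ & _].
  have [nxv nvy nxy] : [/\ x != v, v != y & x != y].
    case/and4P: (bt) => -> -> _ _; split=> //.
    apply/eqP => exy; case/(betweenP dM): bt => a [b [_ _]].
    by rewrite exy (proj2 (metric_eq0 dM y y)).
  by case: p => [|a p] /=; rewrite ?cat_path /= nxv nvy nxy.
rewrite !nrm_cat; congr (_ == _); congr oaddn.
by rewrite /= oaddnA; case/and4P: bt => _ _ _ /eqP->.
Qed.

Definition restrict n l c s := if norm_valid n l s then c s else 0.

Lemma restrict_chain n l c : chain n l (restrict n l c).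
Proof. by move=> s; rewrite /restrict; case: ifP => //; rewrite eqxx. Qed.

Lemma face_restrict i n l c s :
  fc i (restrict n.+1 l c) s = restrict n l (fc i c) s.
Proof.
rewrite /restrict; case: ifP => vs.
  by apply: face_ext => p x y q v es _ bt; rewrite valid_insert // -es vs.
by apply: face_eq0 => p x y q v es _ bt; rewrite valid_insert // -es vs.
Qed.

Lemma face_chain i n l c : chain n.+1 l c -> chain n l (fc i c).
Proof.
move=> hc s /face_neq0[p [x [y [q [v [-> _ bt]]]]]] /hc.
by rewrite valid_insert.
Qed.

Lemma boundary_chain n l c : chain n.+1 l c -> chain n l (bd c).
Proof.
move=> hc s; apply: contraNT => vs; apply/eqP/big1 => i _.
suff /eqP-> : fc i c s == 0 by rewrite mulr0.
by apply: contraNT vs; apply: face_chain.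
Qed.

(** Vanishing of the magnitude homology with coefficients in K in the bidegrees
    with n < l; there are no chains for n > l. *)
Definition off_diagonal_exact := forall n l, (n < l)%N -> forall c, chain n l c ->
  (forall s, bd c s = 0) -> exists b, chain n.+1 l b /\ forall s, bd b s = c s.

(** An element of degree k of the Koszul complex: for each z a function on the
    paths of k unit steps, killed by all the inner faces, and supported on the
    paths whose end is at finite distance from z. *)
Definition koszul_cycle k g :=
  (forall y z, g y z != 0 ->
    [/\ size y = k.+1, sorted unit_step y & dist_last y z != None]) /\
  (forall i y z, fc i (g^~ z) y = 0).

(** The vertex v continues y by one unit step along a geodesic to z. *)
Definition koszul_step y v z :=
  [&& dist_last y v == Some 1%N, dist_last y z != None &
      dist_last y z == oaddn (Some 1%N) (d v z)].

(** The differential kappa. Appending one step towards z lowers the distance to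
    z by one and, in the transposed form used here, shortens the path. *)
Definition koszul_diff g y z := \sum_v (koszul_step y v z)%:R * g (rcons y v) z.

(** Exactness for the elements of total length below L, which is the form
    needed for an induction on the total length. *)
Definition koszul_exact_below L k := forall g, koszul_cycle k g ->
  (forall y z, g y z != 0 -> exists2 m, dist_last y z = Some m.+1 & (k + m.+1 < L)%N) ->
  (forall y z, koszul_diff g y z = 0) ->
  exists h, koszul_cycle k.+1 h /\ forall y z, koszul_diff h y z = g y z.

Definition starts_unit j c := forall s, c s != 0 -> sorted unit_step (take j.+1 s).

(** A unit step has no vertex in between; this is why faces respect the
    condition on the first steps. *)
Lemma unit_step_between x v y : btw x v y -> unit_step x y = false.
Proof.
by case/(betweenP dM) => a [b [_ _ e]]; apply/negbTE; rewrite /unit_step e.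
Qed.

Lemma take_insert m p x v y q : (m <= (size p).+1)%N ->
  take m (p ++ x :: v :: y :: q) = take m (p ++ x :: y :: q).
Proof.
move=> le; rewrite -![p ++ x :: _]cat_rcons !take_cat !size_rcons.
case: ltnP => // ge; have -> : (m - (size p).+1 = 0)%N by apply/eqP; rewrite subn_eq0.
by rewrite !take0.
Qed.

Lemma starts_unit_face i j c : (j <= i)%N -> starts_unit j c -> starts_unit j (fc i c).
Proof.
move=> le hc s /face_neq0[p [x [y [q [v [-> ei bt]]]]]] /hc.
by rewrite take_insert // ei.
Qed.

Lemma face_extended i s r c c' : (i.+1 < size s)%N ->
  (forall t, size t = (size s).+1 -> (forall x0, last x0 t = last x0 s) ->
     c (t ++ r) = c' t) ->
  fc i c (s ++ r) = fc i c' s.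
Proof.
case/gap_split=> p [x [y [q [-> <-]]]] h.
rewrite -catA /= !face_cat; apply: eq_bigr => v _; congr (_ * _).
rewrite -[in RHS]h.
- by rewrite -catA.
- by rewrite !size_cat /= !addnS.
- by move=> x0; rewrite !last_cat /=.
Qed.

(** The tuples at which the face in gap j can be nonzero have a step of length
    at least two there. The later faces vanish on them, the earlier ones vanish
    by hypothesis, so the boundary is this face up to sign; but the boundary
    vanishes on these tuples. *)
Lemma next_face_eq0 j b : starts_unit j.+1 b -> (forall i s, (i < j)%N -> fc i b s = 0) ->
  starts_unit j.+1 (bd b) -> forall s, fc j b s = 0.
Proof.
move=> ub b0 uD s; apply/eqP; apply: contraT => nz.
have nu : sorted unit_step (take j.+2 s) = false.
  case/face_neq0: nz => p [x [y [q [v [-> ep bt _]]]]].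
  have -> : take j.+2 (p ++ x :: y :: q) = p ++ [:: x; y].
    rewrite -ep take_cat; case: ltnP => [|_]; first lia.
    by rewrite -addn2 addKn /= take0.
  case: p {ep} => [|a p] /=; first by rewrite (unit_step_between bt).
  by rewrite cat_path /= (unit_step_between bt) /= !andbF.
have := contraNN (uD s); rewrite nu => /(_ isT); rewrite negbK => /eqP.
have js : (j < size s)%N.
  by case/face_neq0: nz => p [x [y [q [v [-> <- _ _]]]]]; rewrite size_cat /=; lia.
rewrite /bd (bigD1 (Ordinal js)) //= big1 => [|i ni]; last first.
  have [lt|ge] := ltnP i j; first by rewrite b0 ?mulr0.
  have {}ge : (j < i)%N.
    by rewrite ltn_neqAle ge andbT; apply: contraNneq ni => e; apply/eqP/val_inj.
  suff /eqP-> : fc i b s == 0 by rewrite mulr0.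
  by apply: contraFT nu => /(starts_unit_face ge ub).
rewrite addr0 => /eqP; rewrite mulf_eq0 signr_eq0 /=.
by rewrite (negbTE nz).
Qed.

Lemma sorted_cat_cons (e : rel V) p x z r :
  sorted e (p ++ x :: z :: r) -> e x z && sorted e (z :: r).
Proof. by case: p => [//|a p]; rewrite /= cat_path /= => /andP[_ /andP[_]]. Qed.

Lemma nrm_unit x s : path unit_step x s -> nrm (x :: s) = Some (size s).
Proof.
elim: s x => [//|y s IHs] x /= /andP[/eqP e1 ps].
by have := IHs y ps; rewrite /= e1 => ->.
Qed.

Lemma nrm_eq0 x z r : sorted (fun x y => x != y) (x :: z :: r) ->
  nrm (x :: z :: r) != Some 0%N.
Proof.
rewrite /= => /andP[nxz _]; apply/eqP; case e: (d x z) => [[|m]|//] /=.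
  by case/eqP: nxz; apply/(metric_eq0 dM).
by case: foldr.
Qed.

Lemma valid_split n l p x z r : norm_valid n l (rcons p x ++ z :: r) ->
  sorted unit_step (rcons p x) -> exists m a,
  [/\ d x z = Some m.+1, nrm (z :: r) = Some a,
    (size p + m.+1 + a)%N = l & r != [::] -> (0 < a)%N].
Proof.
rewrite cat_rcons => /and3P[_ srt /eqP]; rewrite nrm_cat => en up.
case/andP: (sorted_cat_cons srt) => nxz srt'.
have {}up : nrm (rcons p x) = Some (size p).
  case: p up {en srt} => [//|a p] up.
    by rewrite [LHS](@nrm_unit a (rcons p x)) ?size_rcons.
have eD : nrm (x :: z :: r) = oaddn (d x z) (nrm (z :: r)) by [].
move: en; rewrite up eD.
case exz: (d x z) => [[|m]|//]; first by case/eqP: nxz; apply/(metric_eq0 dM).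
case ea: (nrm (z :: r)) => [a|//] [el]; exists m, a; split=> //; first lia.
case: r {srt eD} srt' ea => [//|w r] /nrm_eq0 nz ea _.
by case: a {el} ea => // ea; rewrite ea in nz.
Qed.

Lemma sorted_rcons2 (e : rel V) p x v : sorted e (rcons (rcons p x) v) -> e x v.
Proof. by rewrite -cats1 cat_rcons => /sorted_cat_cons/andP[]. Qed.

Lemma koszul_step_between p x v z : unit_step x v -> v != z ->
  koszul_step (rcons p x) v z = btw x v z.
Proof.
move=> /eqP exv nvz; rewrite /koszul_step /btw !dist_last_rcons exv eqxx.
have -> : x != v by apply/eqP => /(metric_eq0 dM); rewrite exv.
by rewrite nvz [_ == d x z]eq_sym.
Qed.

(** For a path that ends with a unit step at x and does not stop at z,
    following a geodesic to z for one step means inserting a vertex between x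
    and z: kappa is the face in the last gap of the path completed by z. *)
Lemma kap_between p x z (f : V -> K) :
  (forall v, f v != 0 -> unit_step x v /\ v != z) ->
  \sum_v (koszul_step (rcons p x) v z)%:R * f v =
  \sum_v (btw x v z)%:R * f v.
Proof.
move=> h; apply: eq_bigr => v _; have [->|/h[uv nv]] := eqVneq (f v) 0.
  by rewrite !mulr0.
by rewrite koszul_step_between.
Qed.

Lemma faceB i c c' s : fc i (fun t => c t - c' t) s = fc i c s - fc i c' s.
Proof.
have := face_linear d i (-1) c' c s; rewrite mulN1r addrC => <-.
by congr face; apply/funext => t; rewrite mulN1r addrC.
Qed.

Lemma boundaryB c c' s : bd (fun t => c t - c' t) s = bd c s - bd c' s.
Proof.
by rewrite /boundary -sumrB; apply: eq_bigr => i _; rewrite faceB mulrBr.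
Qed.

Lemma boundaryD c c' s : bd (fun t => c t + c' t) s = bd c s + bd c' s.
Proof.
have := boundary_linear d 1 c c' s; rewrite mul1r => <-.
by congr boundary; apply/funext => t; rewrite mul1r.
Qed.

Lemma chainB n l c c' : chain n l c -> chain n l c' -> chain n l (fun s => c s - c' s).
Proof.
move=> hc hc' s; have [->|/hc//] := eqVneq (c s) 0.
by rewrite sub0r oppr_eq0 => /hc'.
Qed.

Lemma chainD n l c c' : chain n l c -> chain n l c' -> chain n l (fun s => c s + c' s).
Proof.
move=> hc hc' s; have [->|/hc//] := eqVneq (c s) 0.
by rewrite add0r => /hc'.
Qed.

Lemma dist_last_eq y t z : size t != 0%N -> size y != 0%N ->
  (forall x0, last x0 t = last x0 y) -> dist_last t z = dist_last y z.
Proof.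
case: y => // a y; case: t => //= b t _ _ h.
by have /= -> := h a.
Qed.

Lemma sorted_take (e : rel V) m s : sorted e s -> sorted e (take m s).
Proof. by rewrite -{1}(cat_take_drop m s) => /cat_sorted2[]. Qed.

(** Cutting a tuple after the first j+1 entries, and regarding the next entry
    as the target z, turns the chain c into an element of the Koszul complex
    for each tail r; the face in gap j - 1 becomes the differential kappa, so
    its vanishing says that kappa kills it. A solution h of kappa h = g, glued
    back to the tails, is a chain whose boundary cancels the tuples of c
    without unit step in gap j. *)
Lemma adapt_step L n l j c : chain n l c -> (j < n)%N -> starts_unit j c ->
  (forall i s, (i < j)%N -> fc i c s = 0) ->
  ((l < L) || (j.+1 < n) && (l <= L))%N -> koszul_exact_below L j ->
  exists c', [/\ chain n.+1 l c', starts_unit j.+1 (fun s => c s - bd c' s)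
    & forall i s, (i < j)%N -> fc i (fun s => c s - bd c' s) s = 0].
Proof.
move=> cc jn uc c0 hL EX.
(* The part of c before the tail r; y is the path and z the entry that follows
   it. *)
pose g r y z := if size y == j.+1 then c (y ++ z :: r) else 0.
have gE r p x z : size p = j -> g r (rcons p x) z = c (p ++ [:: x, z & r]).
  by move=> ep; rewrite /g size_rcons ep eqxx cat_rcons.
have gV r y z : g r y z != 0 -> exists p x, [/\ y = rcons p x, size p = j,
    sorted unit_step y, norm_valid n l (rcons p x ++ z :: r) & c (y ++ z :: r) != 0].
  rewrite /g; case: ifP => [/eqP sy|_]; last by rewrite eqxx.
  case/lastP: y sy => // p x; rewrite size_rcons => -[ep] nz.
  exists p, x; split=> //; last exact: cc.
  by have := uc _ nz; rewrite take_size_cat // size_rcons ep.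
have /choice[H HP] : forall r, exists h, koszul_cycle j.+1 h /\
    forall y z, koszul_diff h y z = g r y z.
  move=> r; apply: EX.
  - split=> [y z /gV[p [x [-> ep us vs _]]] | i y z].
      split=> //; first by rewrite size_rcons ep.
      have [m [a [e1 _ _ _]]] := valid_split vs us.
      by rewrite dist_last_rcons e1.
    have [sy|nsy] := eqVneq (size y) j; last first.
      apply: face_eq0 => p x w q v ey _ _; rewrite /g ifN //.
      by move: nsy; rewrite ey !size_cat /= !addnS.
    have [le|lt] := leqP (size y) i.+1; first exact: face_oversize.
    rewrite -(@face_extended i y (z :: r) c) ?c0 //; first by rewrite -sy; lia.
    by move=> t st _; rewrite /g st sy eqxx.
  - move=> y z /gV[p [x [-> ep us vs _]]].
    have [m [a [e1 e2 e3 e4]]] := valid_split vs us.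
    exists m; first by rewrite dist_last_rcons.
    case/orP: hL => [|/andP[jn' lL]]; first by lia.
    case/and3P: vs => /eqP; rewrite size_cat size_rcons /= => sr _ _.
    suff : (0 < a)%N by lia.
    by apply: e4; case: r sr {e2} => //= sr; lia.
  - move=> y z; case/lastP: y => [|p x]; first by rewrite /koszul_diff big1 // => v _; rewrite mul0r.
    rewrite /koszul_diff; have [sy|nsy] := eqVneq (size p).+1 j; last first.
      rewrite big1 // => v _; rewrite /g !size_rcons eqSS ifN ?mulr0 //.
    rewrite kap_between => [|v /gV[p' [x' [/rcons_inj[<- <-] _ us vs _]]]]; last first.
      split; first exact: sorted_rcons2 us.
      by move: vs; rewrite cat_rcons => /and3P[_ /sorted_cat_cons/andP[]].
    rewrite -[RHS](c0 (size p) (p ++ x :: z :: r)) ?sy ?face_cat // -?sy //.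
    by apply: eq_bigr => v _; rewrite gE ?size_rcons // cat_rcons.
pose b0 s := if drop j.+2 s is z :: r then
  if dist_last (take j.+2 s) z == Some 0%N then 0 else H r (take j.+2 s) z else 0.
have b0E y z r : size y = j.+2 -> b0 (y ++ z :: r) =
    if dist_last y z == Some 0%N then 0 else H r y z.
  by move=> sy; rewrite /b0 drop_size_cat // take_size_cat.
pose b := restrict n.+1 l (fun s => (-1) ^+ j * b0 s).
have bch : chain n.+1 l b by apply: restrict_chain.
have splits s m : (m < size s)%N -> exists y z r, s = y ++ z :: r /\ size y = m.
  move=> lt; case e: (drop m s) (size_drop m s) => [|z r] /=; first by lia.
  move=> _; exists (take m s), z, r; rewrite -e cat_take_drop size_take lt.
  by [].
have face_b i s : (i < j)%N -> fc i b s = 0.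
  move=> ij; rewrite face_restrict /restrict; case: ifP => // /and3P[/eqP ss _ _].
  rewrite faceZ; have [|y [z [r [es sy]]]] := splits s j.+1; first by rewrite ss; lia.
  rewrite es; suff -> : fc i b0 (y ++ z :: r) = 0 by rewrite mulr0.
  have [dz|dz] := boolP (dist_last y z == Some 0%N).
    rewrite (@face_extended i y (z :: r) _ (fun=> 0)) ?face0 ?sy // => t st lt.
    by rewrite b0E ?st ?sy // (@dist_last_eq y) ?dz ?st ?sy.
  rewrite (@face_extended i y (z :: r) _ ((H r)^~ z)) ?sy //.
    by have [[_ ->]] := HP r.
  move=> t st lt.
  by rewrite b0E ?st ?sy // (@dist_last_eq y) ?(negbTE dz) ?st ?sy.
have ub : starts_unit j.+1 b.
  move=> s; rewrite /b /restrict; case: ifP; rewrite ?eqxx // => _.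
  rewrite mulf_eq0 signr_eq0 /= /b0; case: drop => [|z r]; first by rewrite eqxx.
  case: ifP => [|_]; first by rewrite eqxx.
  by case: (HP r) => [[+ _] _] => /[apply] -[].
exists b; split=> //.
- move=> s; apply: contraNT => nu; rewrite subr_eq0; apply/eqP.
  have [vs|nvs] := boolP (norm_valid n l s); last first.
    have -> : c s = 0 by apply/eqP; apply: contraNT nvs => /cc.
    by apply/esym/eqP; apply: contraNT nvs => /(boundary_chain bch).
  case/and3P: (vs) => /eqP ss _ _.
  have js : (j < size s)%N by rewrite ss; lia.
  rewrite /boundary (bigD1 (Ordinal js)) //= big1 ?addr0 => [|i ni]; last first.
    have [lt|ge] := ltnP i j; first by rewrite face_b ?mulr0.
    have {}ge : (j < i)%N.
      by rewrite ltn_neqAle ge andbT; apply: contraNneq ni => e; apply/eqP/val_inj.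
    suff /eqP-> : fc i b s == 0 by rewrite mulr0.
    by apply: contraNT nu; apply: (starts_unit_face ge ub).
  have [|y [z [r [es sy]]]] := splits s j.+1; first by rewrite ss; lia.
  rewrite face_restrict /restrict vs faceZ mulrA -exprD -signr_odd oddD addbb mul1r.
  case/lastP: y sy es => // p x; rewrite size_rcons => -[ep] es.
  have := (HP r).2 (rcons p x) z; rewrite gE // -cat_rcons -es => <-.
  rewrite es cat_rcons -{1}ep face_cat /koszul_diff; apply: eq_bigr => v _.
  have b0v : b0 (p ++ [:: x, v, z & r]) =
      if d v z == Some 0%N then 0 else H r (rcons (rcons p x) v) z.
    rewrite -cat_rcons -cat_rcons b0E ?dist_last_rcons //.
    by rewrite !size_rcons ep.
  rewrite b0v; have [->|nvz] := eqVneq v z.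
    rewrite [between _ _ _ _]/between eqxx andbF mul0r.
    have [->|nz] := eqVneq (H r (rcons (rcons p x) z) z) 0; first by rewrite mulr0.
    case/negP: nu; have [_ + _] := (HP r).1.1 _ _ nz.
    by rewrite es -cat_rcons take_size_cat // !size_rcons ep.
  rewrite ifN; last by apply: contraNN nvz => /eqP/(metric_eq0 dM)->.
  have [->|nz] := eqVneq (H r (rcons (rcons p x) v) z) 0; first by rewrite !mulr0.
  rewrite koszul_step_between //.
  have [_ + _] := (HP r).1.1 _ _ nz.
  exact: sorted_rcons2.
- move=> i s ij; rewrite faceB c0 // sub0r; apply/eqP; rewrite oppr_eq0; apply/eqP.
  have -> : fc i (bd b) s = \sum_(k < (size s).+1) (-1) ^+ k * fc i (fc k b) s.
    transitivity (fc i (fun t => \sum_(k < (size s).+1) (-1) ^+ k * fc k b t) s).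
      apply: face_ext => p x y q v es _ _; apply: boundary_widen.
      by rewrite es !size_cat /= !addnS.
    by rewrite face_sum; apply: eq_bigr => k _; rewrite faceZ.
  apply: big1 => k _; have [ki|ik] := leqP k i.
    by rewrite (_ : fc k b = fun=> 0) ?face0 ?mulr0 //; apply/funext => t; apply: face_b; lia.
  have -> : nat_of_ord k = (i + (k - i.+1)).+1 by lia.
  rewrite face_face // (_ : fc i b = fun=> 0) ?face0 ?mulr0 //.
  by apply/funext => t; apply: face_b.
Qed.

End KoszulChains.

(** * Koszul exactness and off-diagonal exactness *)

Section KoszulVersusMagnitude.
Variables (K : fieldType) (V : finType) (d : V -> V -> option nat).
Hypothesis dM : is_metric d.
Local Notation nrm := (norm_along d).
Local Notation fc := (face d).
Local Notation bd := (boundary d).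
Local Notation btw := (between d).
Local Notation ustep := (unit_step d).
Local Notation dist_last := (dist_last d).
Local Notation nvalid := (norm_valid d).
Local Notation chain := (@chain K V d).
Local Notation kap := (koszul_diff d).
Local Notation koszul_cycle := (koszul_cycle d).
Local Notation starts_unit := (starts_unit d).
Implicit Types (x z v w : V) (s t p q r : seq V) (c : seq V -> K).
Implicit Types (g h : seq V -> V -> K).

Lemma sorted_unit_neq s : sorted ustep s -> sorted (fun x y => x != y) s.
Proof.
apply: sub_sorted => x y; apply: contraTneq => ->.
by rewrite /unit_step (proj2 (metric_eq0 dM y y)).
Qed.

(** By adapt_step every cycle is homologous to one on tuples of unit steps,
    whose norm is their length. *)
Theorem koszul_exact_off_diagonal :
  (forall L k, @koszul_exact_below K V d L k) -> @off_diagonal_exact K V d.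
Proof.
move=> EX n l nl c cc Dc.
have [b [bc ub _]] : exists b, [/\ chain n.+1 l b,
    starts_unit n (fun s => c s - bd b s)
    & forall i s, (i.+1 < n)%N -> fc i (fun s => c s - bd b s) s = 0].
  suff : forall j, (j <= n)%N -> exists b, [/\ chain n.+1 l b,
      starts_unit j (fun s => c s - bd b s)
      & forall i s, (i.+1 < j)%N -> fc i (fun s => c s - bd b s) s = 0].
    by move/(_ n (leqnn _)).
  elim=> [|j IHj] lejn.
    exists (fun=> 0); split=> //; first by move=> s; rewrite eqxx.
    by move=> [|x [|y s]].
  have [b [bc ub b0]] := IHj (ltnW lejn); clear IHj.
  pose c1 s := c s - bd b s.
  have c1c : chain n l c1 by apply: chainB => //; apply: boundary_chain.
  have Dc1 s : bd c1 s = 0 by rewrite boundaryB Dc boundary_boundary // subrr.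
  have c10 i s : (i < j)%N -> fc i c1 s = 0.
    case: j lejn ub b0 => // j _ ub b0; rewrite ltnS leq_eqVlt.
    case/orP=> [/eqP->|lt]; last exact: b0.
    apply: (next_face_eq0 dM ub) => [i' s' lt|s']; first exact: b0.
    by rewrite Dc1 eqxx.
  have [|b' [b'c ub' b'0]] :=
    adapt_step dM c1c lejn ub c10 _ (EX l.+1 j); first by rewrite ltnSn.
  have eb s : c s - bd (fun s => b s + b' s) s = c1 s - bd b' s.
    by rewrite boundaryD /c1 opprD addrA.
  exists (fun s => b s + b' s); split; first exact: chainD.
    by move=> s; rewrite eb; apply: ub'.
  move=> i s lt; rewrite -[RHS](b'0 i s) //; congr face.
  by apply/funext => t; rewrite eb.
exists b; split=> // s; apply/esym/eqP; rewrite -subr_eq0.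
apply: contraT => nz; have vs : nvalid n l s.
  by apply: (chainB cc (boundary_chain dM bc)) nz.
have := ub s nz; case/and3P: vs => /eqP ss _ /eqP.
rewrite take_oversize ?ss //; case: s ss {nz} => // x s [ss] + us.
by rewrite (nrm_unit us) ss => -[el]; rewrite el ltnn in nl.
Qed.

Section Filter.
Variable phi : option nat -> bool.

(** The distance from the end of the path to z drops by one under kappa, so
    each part of an element at a prescribed distance can be treated
    separately. *)
Definition level_filter (g : seq V -> V -> K) (y : seq V) z : K :=
  if phi (dist_last y z) then g y z else 0.

Lemma level_filter_cycle k g : koszul_cycle k g -> koszul_cycle k (level_filter g).
Proof.
case=> gs g0; split=> [y z | i y z].
  by rewrite /level_filter; case: ifP => _; [apply: gs | rewrite eqxx].
rewrite -[RHS](mulr0 (phi (dist_last y z))%:R) -(g0 i y z) -faceZ.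
apply: face_ext => p x w q v -> _ _; rewrite /level_filter.
rewrite (@dist_last_eq _ _ (p ++ [:: x, w & q])).
- by case: ifP; rewrite ?mul1r ?mul0r.
- by rewrite size_cat /= addnS.
- by rewrite size_cat /= addnS.
- by move=> x0; rewrite !last_cat.
Qed.

Lemma kap_level_filter g y z : kap g y z = 0 -> kap (level_filter g) y z = 0.
Proof.
move=> kg; pose a := if dist_last y z is Some m.+1 then phi (Some m) else false.
rewrite -[RHS](mulr0 a%:R) -kg mulr_sumr; apply: eq_bigr => v _.
rewrite mulrCA; case st: koszul_step; rewrite ?mul0r // !mul1r.
rewrite /level_filter dist_last_rcons /a.
case/and3P: st => _ nn; case: (d v z) => [m|] /=; last by rewrite (negbTE nn).
by rewrite add1n => /eqP->; case: ifP; rewrite ?mul1r ?mul0r.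
Qed.

End Filter.

(** At distance one from z the primitive is explicit: append z itself. That it
    is killed by the last face is the equation kappa g = 0. *)
Lemma koszul_step_bottom k g : koszul_cycle k g -> (forall y z, kap g y z = 0) ->
  (forall y z, g y z != 0 -> dist_last y z = Some 1%N) ->
  exists h, koszul_cycle k.+1 h /\ forall y z, kap h y z = g y z.
Proof.
case=> gs g0 kg g1.
pose h y z := if (size y == k.+2) && (dist_last y z == Some 0%N) then g (take k.+1 y) z else 0.
have hE y v z : h (rcons y v) z = if v == z then g y z else 0.
  rewrite /h size_rcons eqSS dist_last_rcons; have [->|nvz] := eqVneq v z; last first.
    by case: (d v z =P _) => [/(metric_eq0 dM) e|]; rewrite ?andbF // e eqxx in nvz *.
  rewrite (proj2 (metric_eq0 dM z z)) // eqxx andbT; case: eqP => [sy|ny].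
    by rewrite -cats1 take_size_cat.
  by apply/esym/eqP; apply: contraT => /gs[]/eqP; rewrite (introF eqP ny).
have hs y z : h y z != 0 -> exists2 y', y = rcons y' z & g y' z != 0.
  case/lastP: y => [|y v]; first by rewrite /h eqxx.
  by rewrite hE; case: ifP => [/eqP->|_]; [exists y | rewrite eqxx].
exists h; split; first split.
- move=> y z /hs[{}y -> nz]; have [sy uy _] := gs _ _ nz; split.
  + by rewrite size_rcons sy.
  + case: y sy uy nz => // a y _ /= uy /g1 /= e1.
    by rewrite rcons_path uy /unit_step e1 eqxx.
  + by rewrite dist_last_rcons (proj2 (metric_eq0 dM z z)).
- move=> i y z; case/lastP: y => [|y w]; first exact: face_oversize.
  case/lastP: y => [|p x]; first exact: face_oversize.
  have [->|nwz] := eqVneq w z; last first.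
    apply: face_eq0 => p' x' y' q' v e _ _; apply/eqP; apply: contraT => /hs[y'' e' _].
    have := congr1 (last x) e; rewrite last_rcons last_cat /= => ew.
    have := congr1 (last x) e'; rewrite last_cat last_rcons /= -ew => ez.
    by rewrite ez eqxx in nwz.
  have [lt|ge] := ltnP i (size p).
    rewrite -cats1 (@face_extended _ _ _ _ (rcons p x) _ _ (g^~ z)) ?size_rcons //.
    by move=> t _ _; rewrite cats1 hE eqxx.
  rewrite leq_eqVlt in ge; case/orP: ge => [/eqP<-|gt]; last first.
    by apply: face_oversize; rewrite !size_rcons.
  rewrite -[rcons (rcons _ _) _]cats1 cat_rcons face_cat -[RHS](kg (rcons p x) z).
  rewrite /koszul_diff kap_between // => [|v nz].
    by apply: eq_bigr => v _; rewrite -cat_rcons -cat_rcons cats1 hE eqxx.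
  have [_ us _] := gs _ _ nz; split; first exact: sorted_rcons2 us.
  have := g1 _ _ nz; rewrite dist_last_rcons => e1; apply/eqP => evz.
  by move: e1; rewrite evz (proj2 (metric_eq0 dM z z)).
- move=> y z; rewrite /koszul_diff (bigD1 z) //= big1 => [|v nv]; last first.
    by rewrite hE (negbTE nv) mulr0.
  rewrite hE eqxx addr0; have [->|/g1 e1] := eqVneq (g y z) 0; first by rewrite mulr0.
  by rewrite /koszul_step e1 (proj2 (metric_eq0 dM z z)) // !eqxx mul1r.
Qed.

(** Appending z to the path turns g into a cycle of magnitude chains whose norm
    L exceeds the length k+1. A primitive of it is first made to start with
    unit steps, by adapt_step and the induction hypothesis on the total length;
    its coefficients then form a primitive of g. *)
Lemma koszul_step_top L k g : @off_diagonal_exact K V d ->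
  (forall j, @koszul_exact_below K V d L j) ->
  koszul_cycle k g -> (forall y z, kap g y z = 0) -> (k.+1 < L)%N ->
  (forall y z, g y z != 0 -> dist_last y z = Some (L - k)%N) ->
  exists h, koszul_cycle k.+1 h /\ forall y z, kap h y z = g y z.
Proof.
move=> OD EX [gs g0] kg kL gL.
(* The chain of the paths completed by their target. *)
pose c s := if s is x :: s' then g (belast x s') (last x s') else 0.
have cE y z : c (rcons y z) = g y z.
  by case: y => [//|a y]; rewrite /c rcons_cons belast_rcons last_rcons.
have gstep p x v z : g (rcons (rcons p x) v) z != 0 -> ustep x v /\ v != z.
  move=> nz; have [_ us _] := gs _ _ nz; split; first exact: sorted_rcons2 us.
  have := gL _ _ nz; rewrite dist_last_rcons => e1; apply/eqP => evz.
  by move: e1; rewrite evz (proj2 (metric_eq0 dM z z)) // => -[]; lia.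
have cc : chain k.+1 L c.
  move=> s; case/lastP: s => [|y z]; rewrite ?eqxx ?cE // => nz.
  have [sy us _] := gs _ _ nz; have e1 := gL _ _ nz.
  rewrite /norm_valid size_rcons sy eqxx /=.
  case/lastP: y sy us e1 {nz} => // p x; rewrite size_rcons dist_last_rcons => -[sp] us e1.
  have nxz : x != z.
    by apply/eqP => e; move: e1; rewrite e (proj2 (metric_eq0 dM z z)) // => -[]; lia.
  rewrite -cats1 cat_rcons nrm_cat [nrm [:: x; z]]/= e1; apply/andP; split.
    have := sorted_unit_neq us; rewrite -cats1; case: (p) => [|a p'] /=; first by rewrite nxz.
    by rewrite !cat_path /= nxz !andbT.
  case: p us sp => [_ sp|a p us sp]; first by rewrite /= -sp addn0 subn0.
  rewrite /= in sp.
  rewrite [nrm _](@nrm_unit _ _ a (rcons p x)) // size_rcons /= addn0.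
  by apply/eqP; congr Some; lia.
have Dc s : bd c s = 0.
  apply: big1 => -[i /= _] _; apply/eqP; rewrite mulf_eq0 signr_eq0 /=.
  apply: contraT => nz; have [p [x [y [q [v [es ep bt _]]]]]] := face_neq0 nz; move: nz; rewrite es.
  case/lastP: q {es} => [|q z].
    rewrite -ep face_cat -[X in X != 0 -> _](_ : kap g (rcons p x) y = _); first by rewrite kg eqxx.
    rewrite /koszul_diff kap_between //; last by move=> v'; apply: gstep.
    by apply: eq_bigr => v' _; rewrite -cat_rcons -cat_rcons cats1 cE.
  rewrite -[p ++ _](_ : (p ++ x :: y :: q) ++ [:: z] = _); last by rewrite -catA /= cats1.
  rewrite (@face_extended _ _ _ _ (p ++ x :: y :: q) _ _ (g^~ z)) ?g0 ?eqxx //.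
    by rewrite size_cat /=; lia.
  by move=> t _ _; rewrite cats1 cE.
have [b0 [b0c Db0]] := OD _ _ kL _ cc Dc.
have uc j : (j <= k)%N -> starts_unit j c.
  move=> jk s; case/lastP: s => [|y z]; rewrite ?eqxx ?cE // => nz.
  have [sy us _] := gs _ _ nz; rewrite -cats1 takel_cat ?sy //.
  exact: sorted_take.
have [b [bc Db ub bi]] : exists b, [/\ chain k.+2 L b, forall s, bd b s = c s,
    starts_unit k.+1 b & forall i s, (i < k)%N -> fc i b s = 0].
  suff : forall j, (j <= k.+1)%N -> exists b, [/\ chain k.+2 L b,
    forall s, bd b s = c s, starts_unit j b & forall i s, (i.+1 < j)%N -> fc i b s = 0].
    by move/(_ k.+1 (leqnn _)).
  elim=> [|j IHj] jk; first by exists b0; split=> // -[|x [|y s]].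
  have [b [bc Db ub bi]] := IHj (ltnW jk); clear IHj.
  have b1 i s : (i < j)%N -> fc i b s = 0.
    case: j jk ub bi => // j jk ub bi; rewrite ltnS leq_eqVlt.
    case/orP=> [/eqP->|lt]; last exact: bi.
    apply: (next_face_eq0 dM ub) => [i' s' lt|s']; first exact: bi.
    by rewrite Db; apply: uc; lia.
  have [|b' [b'c ub' b'0]] := adapt_step dM bc (ltnW jk) ub b1 _ (EX j).
    by apply/orP; right; rewrite leqnn andbT; lia.
  exists (fun s => b s - bd b' s); split=> //; first by apply: chainB => //; apply: boundary_chain.
  by move=> s; rewrite boundaryB boundary_boundary // subr0.
(* The sign is that of the only face, in gap k, that contributes to the
   boundary of b. *)
pose h y z := if size y == k.+2 then (-1) ^+ k * b (rcons y z) else 0.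
have hs y z : h y z != 0 -> [/\ size y = k.+2, sorted ustep y & b (rcons y z) != 0].
  rewrite /h; case: ifP => [/eqP sy|]; last by rewrite eqxx.
  rewrite mulf_eq0 signr_eq0 /= => nz; split=> //.
  by have := ub _ nz; rewrite -cats1 take_size_cat.
exists h; split; first split.
- move=> y z /hs[sy us nz]; split=> //.
  case/lastP: y sy us nz => // p x _ us nz; rewrite dist_last_rcons.
  have := bc _ nz; rewrite -cats1 => vs.
  by have [m [a [-> _ _ _]]] := valid_split dM vs us.
- move=> i y z; have [sy|ny] := eqVneq (size y) k.+1; last first.
    apply: face_eq0 => p x w q v ey _ _; rewrite /h ifN //.
    by move: ny; rewrite ey !size_cat /= !addnS.
  have [ik|ki] := ltnP i k; last by apply: face_oversize; rewrite sy.
  rewrite -[RHS](mulr0 ((-1) ^+ k)) -(bi i (rcons y z) ik) -faceZ -cats1.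
  symmetry; apply: face_extended; first by rewrite sy.
  by move=> t st _; rewrite cats1 /h st sy eqxx.
- move=> y z; have [sy|ny] := eqVneq (size y) k.+1; last first.
    rewrite /koszul_diff big1 => [|v _].
      by apply/esym/eqP; apply: contraT => /gs[sy]; rewrite sy eqxx in ny.
    by rewrite /h size_rcons eqSS (negbTE ny) mulr0.
  rewrite -cE -Db; case/lastP: y sy => // p x; rewrite size_rcons => -[sp].
  have ks : (k < size (rcons (rcons p x) z))%N by rewrite !size_rcons sp; lia.
  rewrite /boundary (bigD1 (Ordinal ks)) //= big1 ?addr0 => [|[i hi] /= ni]; last first.
    have [lt|ge] := ltnP i k; first by rewrite bi ?mulr0.
    have {}ge : (k < i)%N.
      by rewrite ltn_neqAle ge andbT; apply: contraNneq ni => e; apply/eqP/val_inj.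
    by rewrite face_oversize ?mulr0 // !size_rcons sp.
  rewrite -[rcons (rcons _ _) _]cats1 cat_rcons -{2}sp face_cat mulr_sumr /koszul_diff kap_between //.
    apply: eq_bigr => v _; rewrite mulrCA /h !size_rcons sp eqxx.
    by rewrite -cat_rcons -cat_rcons cats1.
  move=> v /hs[_ us nz]; split; first exact: sorted_rcons2 us.
  move: (bc _ nz) => /and3P[_ srt _]; exact: sorted_rcons2 srt.
Qed.

Theorem off_diagonal_koszul_exact : @off_diagonal_exact K V d ->
  forall L k, @koszul_exact_below K V d L k.
Proof.
move=> OD; elim=> [|L IHL] k g gK gL kg.
  exists (fun _ _ => 0); split.
    by split=> [y z|i y z]; rewrite ?eqxx ?face0.
  move=> y z; rewrite /koszul_diff big1 => [|v _]; last by rewrite mulr0.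
  by apply/esym/eqP; apply: contraT => /gL[].
pose lev o := o == Some (L - k)%N.
pose g1 := level_filter lev g; pose g2 := level_filter (fun o => ~~ lev o) g.
have [g1K g2K] : koszul_cycle k g1 /\ koszul_cycle k g2.
  by split; apply: level_filter_cycle.
have [k1 k2] : (forall y z, kap g1 y z = 0) /\ (forall y z, kap g2 y z = 0).
  by split=> y z; apply: kap_level_filter.
have g1s y z : g1 y z != 0 -> dist_last y z = Some (L - k)%N.
  by rewrite /g1 /level_filter; case: ifP => [/eqP|]; rewrite ?eqxx.
have [h2 [h2K h2E]] : exists h, koszul_cycle k.+1 h /\ forall y z, kap h y z = g2 y z.
  apply: (IHL k _ g2K) => // y z; rewrite /g2 /level_filter /lev.
  case: ifP => [nl /gL[m em lm]|]; last by rewrite eqxx.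
  exists m => //; rewrite em in nl; rewrite ltnS leq_eqVlt in lm.
  by case/orP: lm => // /eqP el; move: nl; rewrite -el addKn eqxx.
have [h1 [h1K h1E]] : exists h, koszul_cycle k.+1 h /\ forall y z, kap h y z = g1 y z.
  have [lt|ge] := ltnP k.+1 L; first exact: koszul_step_top g1K k1 lt g1s.
  apply: (koszul_step_bottom g1K k1) => y z nz.
  have nz' : g y z != 0 by move: nz; rewrite /g1 /level_filter; case: ifP; rewrite ?eqxx.
  have [m em lm] := gL y z nz'; rewrite em; congr Some.
  by have := g1s y z nz; rewrite em => -[]; lia.
exists (fun y z => h1 y z + h2 y z); split; first split.
- move=> y z; have [->|nz _] := eqVneq (h1 y z) 0; last exact: h1K.1.
  by rewrite add0r; apply: h2K.1.
- move=> i y z; rewrite -[LHS](_ : fc i (fun t => 1 * h1 t z + h2 t z) y = _).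
    by rewrite face_linear h1K.2 h2K.2 mulr0 addr0.
  by congr face; apply/funext => t; rewrite mul1r.
- move=> y z; rewrite /koszul_diff; under eq_bigr => v _ do rewrite mulrDr.
  rewrite big_split /= -/(kap h1 y z) -/(kap h2 y z) h1E h2E.
  by rewrite /g1 /g2 /level_filter; case: ifP => _; rewrite ?addr0 ?add0r.
Qed.

(** On a finite set the total length is bounded, and elements at distance zero
    from z cannot be killed by kappa. *)
Lemma koszul_exact_unbounded : (forall L k, @koszul_exact_below K V d L k) ->
  forall k g, koszul_cycle k.+1 g -> (forall y z, kap g y z = 0) ->
  exists h, koszul_cycle k.+2 h /\ forall y z, kap h y z = g y z.
Proof.
move=> EX k g gK kg.
(* The diameter bounds the distance from the end of a path to z. *)
pose M := \max_(u : V * V) odflt 0%N (d u.1 u.2).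
apply: (EX (k.+1 + M.+1)%N k.+1 g gK _ kg) => y z nz.
have [sy us] := gK.1 y z nz.
case/lastP: y sy us nz => // y v; case/lastP: y => // p x; rewrite !dist_last_rcons.
rewrite !size_rcons => -[sp] us nz.
case e: (d v z) => [[|m]|//] _; last first.
  exists m => //; rewrite ltn_add2l ltnS.
  by have := leq_bigmax (F := fun u : (V * V)%type => odflt 0%N (d u.1 u.2)) (v, z); rewrite /= e.
have evz : v = z by apply/(metric_eq0 dM).
case/eqP: nz; have exv : ustep x v := sorted_rcons2 us.
rewrite -[RHS](kg (rcons p x) z) /koszul_diff (bigD1 v) //= big1 => [|w nw].
  rewrite /koszul_step !dist_last_rcons e /= -evz (eqP exv) !eqxx mul1r addr0 //.
rewrite /koszul_step !dist_last_rcons; case: and3P => [[_ _]|_]; last by rewrite mul0r.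
rewrite -evz (eqP exv); case ew: (d w v) => [[|a]|] //= _.
by case/eqP: nw; apply/(metric_eq0 dM).
Qed.

End KoszulVersusMagnitude.

(** * Reversal, and the distance of a digraph *)

Section Reversal.
Variables (K : fieldType) (V : finType).
Implicit Types (d : V -> V -> option nat) (s : seq V).

(** The distance of the opposite digraph. *)
Definition transpose d x y : option nat := d y x.

Lemma oaddnC : commutative oaddn.
Proof. by case=> [a|] [b|] //=; rewrite addnC. Qed.

Lemma between_transpose d x v y : between (transpose d) x v y = between d y v x.
Proof.
rewrite /between /transpose oaddnC (eq_sym x v) (eq_sym v y).
by rewrite andbCA.
Qed.

Lemma norm_along_rev d s : norm_along (transpose d) s = norm_along d (rev s).
Proof.
elim: s => // x [//|y s] IHs.
have -> : norm_along (transpose d) [:: x, y & s] =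
    oaddn (d y x) (norm_along (transpose d) (y :: s)) by [].
rewrite IHs [rev [:: x, y & s]]rev_cons -cats1 [rev (y :: s)]rev_cons.
by rewrite cat_rcons nrm_cat oaddnC /= oaddn0.
Qed.

Lemma valid_rev d n l s : norm_valid (transpose d) n l s = norm_valid d n l (rev s).
Proof.
rewrite /norm_valid size_rev norm_along_rev rev_sorted; congr [&& _, _ & _].
by case: s => // x s; apply: eq_path => a b; rewrite eq_sym.
Qed.

Lemma boundary_narrow d (c : seq V -> K) s : boundary d c s =
  \sum_(i < (size s).-1) (-1) ^+ i * face d i c s.
Proof.
rewrite /boundary; case es: (size s) => [|m]; first by rewrite !big_ord0.
by rewrite big_ord_recr /= face_oversize ?es // mulr0 addr0.
Qed.

Lemma face_rev d i (c : seq V -> K) s : (i.+1 < size s)%N ->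
  face (transpose d) i (fun t => c (rev t)) s = face d (size s - i.+2) c (rev s).
Proof.
case/gap_split=> p [x [y [q [-> <-]]]].
have -> : rev (p ++ x :: y :: q) = rev q ++ y :: x :: rev p.
  by rewrite rev_cat !rev_cons -!cats1 -!catA.
have -> : (size (p ++ x :: y :: q) - (size p).+2 = size (rev q))%N.
  by rewrite size_cat size_rev /=; lia.
rewrite !face_cat; apply: eq_bigr => v _; rewrite between_transpose.
by rewrite rev_cat !rev_cons -!cats1 -!catA.
Qed.

Lemma boundary_rev d (c : seq V -> K) s :
  boundary (transpose d) (fun t => c (rev t)) s = (-1) ^+ (size s) * boundary d c (rev s).
Proof.
rewrite !boundary_narrow size_rev; case es: (size s) => [|[|m]]; rewrite ?big_ord0 ?mulr0 //=.
rewrite (reindex_inj rev_ord_inj) /= mulr_sumr; apply: eq_bigr => -[i lt] _ /=.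
rewrite face_rev es; last by lia.
have -> : (m.+2 - (m - i).+2 = i)%N by lia.
rewrite mulrA -exprD; congr (_ * _).
have -> : (m.+1 - i.+1 = m - i)%N by lia.
by rewrite -signr_odd -[RHS]signr_odd oddB ?oddD //= negbK.
Qed.

(** Reversing the tuples is an isomorphism of complexes up to the sign of the
    number of entries. *)
Lemma off_diagonal_exact_transpose d : @off_diagonal_exact K V d ->
  @off_diagonal_exact K V (transpose d).
Proof.
move=> OD n l nl c cc Dc.
have [s /=|s|b [bc Db]] := OD n l nl (fun s => c (rev s)).
- by move/cc; rewrite valid_rev revK.
- have := boundary_rev (transpose d) c s; rewrite /boundary => ->; rewrite -/(boundary _ _ _).
  by rewrite Dc mulr0.
exists (fun s => (-1) ^+ n.+1 * b (rev s)); split.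
  by move=> s; rewrite mulf_eq0 signr_eq0 valid_rev => /bc.
move=> s; have -> : boundary (transpose d) (fun s => (-1) ^+ n.+1 * b (rev s)) s =
    (-1) ^+ n.+1 * boundary (transpose d) (fun s => b (rev s)) s.
  by rewrite /boundary mulr_sumr; apply: eq_bigr => i _; rewrite faceZ mulrCA.
rewrite boundary_rev Db revK mulrA; have [->|/cc/and3P[/eqP-> _ _]] := eqVneq (c s) 0.
  by rewrite mulr0.
by rewrite -exprD addnn -signr_odd odd_double mul1r.
Qed.

End Reversal.

Section DigraphMetric.
Variable G : digraph.
Local Notation e := (@arrow G).

Lemma dist_eq0 (x y : G) : dist x y = Some 0%N <-> x = y.
Proof.
split=> [/distP[/has_pathP[p _ [<- /size0nil->]] _] //|->]; exact: dist_xx.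
Qed.

Lemma dist_eq1 (x y : G) : (dist x y == Some 1%N) = e x y.
Proof.
apply/eqP/idP => [/distP[/has_pathP[p pp [lp sp]] _]|exy].
  by case: p pp lp sp => [|z [|w p]] //= /andP[exz _] <-.
apply/distP; split; first by apply/has_pathP; exists [:: y]; rewrite //= exy.
case=> // /has_pathP[p _ [lp /size0nil p0]].
by move: exy; rewrite -lp p0 arrow_irr.
Qed.

Lemma has_path_dist (x y : G) n : has_path x y n ->
  exists2 m, dist x y = Some m & (m <= n)%N.
Proof.
move=> hp; have : connect e x y.
  by case/has_pathP: hp => p pp [<- _]; apply/connectP; exists p.
rewrite dist_connect; case exy: (dist x y) => [m|//] _; exists m => //.
by case/distP: exy => _; apply.
Qed.

Lemma dist_metric : is_metric (@dist G).
Proof.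
split; first exact: dist_eq0.
  move=> x y z a b /distP[hx _] /distP[hy _].
  exact: has_path_dist (has_path_cat hx hy).
move=> x y m /distP[/has_pathP[p]]; case: p => [_ [] //|v p].
move=> /= /andP[xv pp] [lp [sp]] mmin.
exists v; first by apply/eqP; rewrite dist_eq1.
have hv : has_path v y m by apply/has_pathP; exists p.
have [k ek lek] := has_path_dist hv; rewrite ek; congr Some; apply/eqP.
rewrite eqn_leq lek -ltnS mmin // -add1n.
apply: has_path_cat (proj1 (proj1 (distP v y k) ek)).
by apply/has_pathP; exists [:: v]; rewrite //= xv.
Qed.

Lemma dist_transpose_metric : is_metric (transpose (@dist G)).
Proof.
split=> [x y|x y z a b exy eyz|x y m]; rewrite /transpose.
- by rewrite dist_eq0; split=> ->.
- by rewrite addnC; apply: (metric_triangle dist_metric eyz exy).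
move=> /distP[/has_pathP[p]]; case/lastP: p => [|p v]; first by move=> _ [].
rewrite rcons_path => /andP[pp ev] [lp]; rewrite size_rcons => -[sp] mmin.
rewrite last_rcons in lp; rewrite lp in ev.
exists (last y p); first by apply/eqP; rewrite dist_eq1.
have hv : has_path y (last y p) m by apply/has_pathP; exists p.
have [k ek lek] := has_path_dist hv; rewrite ek; congr Some; apply/eqP.
rewrite eqn_leq lek -ltnS mmin // -addn1.
apply: has_path_cat (proj1 (proj1 (distP _ _ k) ek)) _.
by apply/has_pathP; exists [:: x]; rewrite //= ev.
Qed.

End DigraphMetric.

(** * Exactness of integer matrices and of their reductions *)

Section SmithExactness.

(** Rows act on the right, so a chain is a row vector and M *m N = 0 for
    consecutive matrices. *)
Definition exact_mx (R : pzRingType) a b c (M : 'M[R]_(a, b)) (N : 'M[R]_(b, c)) :=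
  forall v : 'rV_b, v *m N = 0 -> exists u, u *m M = v.

Local Notation diag a b d := (\matrix_(i < a, j < b) (d`_i *+ (i == j :> nat))).

Lemma mul_diagE (R : pzRingType) a b (d : seq R) (y : 'rV_a) (i : 'I_a) (j : 'I_b) :
  i = j :> nat -> (y *m diag a b d) 0 j = y 0 i * d`_i.
Proof.
move=> eij; rewrite mxE (bigD1 i) //= big1 ?addr0 => [|k nk].
  by rewrite mxE eij eqxx.
rewrite mxE -eij; case: eqP => [e|_]; last by rewrite mulr0.
by case/eqP: nk; apply: val_inj.
Qed.

Lemma row_diagE (R : pzRingType) a b (d : seq R) (i : 'I_a) (j : 'I_b) :
  i = j :> nat -> row i (diag a b d) = d`_i *: delta_mx 0 j.
Proof.
move=> eij; apply/rowP => k; rewrite !mxE eqxx /= eij.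
by rewrite -[_ == k :> nat]/(j == k) eq_sym mulr_natr.
Qed.

Lemma row_diag0 (R : pzRingType) a b (d : seq R) (i : 'I_a) :
  (b <= i)%N -> row i (diag a b d) = 0.
Proof.
move=> le; apply/rowP => k; rewrite !mxE; case: eqP => // e.
by have := ltn_ord k; rewrite -e ltnNge le.
Qed.

Section SmithData.
Variables (a b c : nat) (M : 'M[int]_(a, b)) (N : 'M[int]_(b, c)).
Variables (L : 'M[int]_a) (R : 'M[int]_b) (d : seq int).
Hypotheses (MN0 : M *m N = 0) (uL : L \in unitmx) (uR : R \in unitmx).
Hypothesis eM : M = L *m diag a b d *m R.

Lemma smith_row_mul (i : 'I_a) : row i (invmx L) *m M = row i (diag a b d) *m R.
Proof. by rewrite eM !rowE !mulmxA -(mulmxA _ (invmx L)) mulVmx // mulmx1. Qed.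

(** The multiple of this row by the elementary divisor is a row of invmx L *m
    M, which N kills, and there is no torsion. *)
Lemma smith_row_ker (i : 'I_a) (j : 'I_b) : i = j :> nat -> d`_i != 0 ->
  row j R *m N = 0.
Proof.
move=> eij dn0; suff : d`_i *: (row j R *m N) = 0.
  by move/eqP; rewrite scalemx_eq0 (negbTE dn0) => /eqP.
have : row i (invmx L) *m M *m N = 0 by rewrite -mulmxA MN0 mulmx0.
by rewrite smith_row_mul (row_diagE _ eij) -!scalemxAl -rowE.
Qed.

Variable K : fieldType.
Local Notation "A ^f" := (map_mx (intr : int -> K) A).

Lemma smith_coef (u : 'rV[K]_a) (j : 'I_b) : u *m M^f = (row j R)^f ->
  u *m L^f *m (diag a b d)^f = delta_mx 0 j.
Proof.
move=> eu; have RV : R^f *m (invmx R)^f = 1%:M.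
  by rewrite -map_mxM mulmxV // map_mx1.
rewrite -[LHS]mulmx1 -RV mulmxA.
have -> : u *m L^f *m (diag a b d)^f *m R^f = u *m M^f by rewrite eM !map_mxM !mulmxA.
by rewrite eu -map_mxM -row_mul mulmxV // rowE mulmx1 map_delta_mx.
Qed.

Lemma map_diag : (diag a b d)^f = diag a b (map intr d).
Proof.
apply/matrixP => i j; rewrite !mxE; case: (ltnP i (size d)) => [lt|ge].
  by rewrite (nth_map 0) // rmorphMn.
by rewrite !nth_default ?size_map // !mul0rn.
Qed.

Lemma nth_intr i : (map intr d)`_i = (d`_i)%:~R :> K.
Proof.
case: (ltnP i (size d)) => [lt|ge]; first by rewrite (nth_map 0).
by rewrite !nth_default ?size_map ?mulr0z.
Qed.

(** In the basis given by R, the coefficient of index j of this row is 1, while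
    every boundary has a multiple of the divisor there. *)
Lemma smith_coef_neq0 (u : 'rV[K]_a) (i : 'I_a) (j : 'I_b) : i = j :> nat ->
  u *m M^f = (row j R)^f -> (d`_i)%:~R != 0 :> K.
Proof.
move=> eij /smith_coef/rowP/(_ j) e; apply/eqP => z.
rewrite map_diag (mul_diagE _ _ eij) [RHS]mxE !eqxx nth_intr in e.
by move/eqP: e; rewrite z mulr0 eq_sym oner_eq0.
Qed.

End SmithData.

(** Exactness over F_p shows that p divides no nonzero elementary divisor,
    since the corresponding row of R is a cycle; so these are units. Exactness
    over Q gives the rest. *)
Lemma exact_mx_int a b c (M : 'M[int]_(a, b)) (N : 'M[int]_(b, c)) : M *m N = 0 ->
  (forall K : fieldType, exact_mx (map_mx (intr : int -> K) M) (map_mx intr N)) ->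
  exact_mx M N.
Proof.
move=> MN0 EX v vN; have [L uL [R uR [d _ eM]]] := int_Smith_normal_form M.
have dunit (i : 'I_a) (j : 'I_b) : i = j :> nat -> d`_i != 0 -> d`_i \in GRing.unit.
  move=> eij dn0; apply: contraT => nu.
  have dn1 : absz d`_i != 1%N by apply: contraNneq nu; case: (d`_i) => [[|[|n]]|[|n]].
  (* A non-unit divisor has a prime factor p, and row i would not be a boundary
     modulo p. *)
  have pp : prime (pdiv (absz d`_i)).
    by apply: pdiv_prime; rewrite ltn_neqAle eq_sym dn1 absz_gt0.
  set p := pdiv _ in pp.
  have rN := smith_row_ker MN0 uL eM eij dn0.
  have [|u eu] := EX 'F_p (map_mx intr (row j R)); first by rewrite -map_mxM rN map_mx0.
  have /eqP[] := smith_coef_neq0 uR eM eij eu.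
  apply/eqP; have := pdiv_dvd (absz d`_i); rewrite -/p.
  rewrite -(dvdzE p%:Z) => /dvdzP[q ->]; rewrite rmorphM /=.
  by rewrite -[p%:~R]/(p%:R) pchar_Fp_0 // mulr0.
pose w := v *m invmx R.
have [|u eu] := EX rat (map_mx intr v); first by rewrite -map_mxM vN map_mx0.
have ew : map_mx intr w = u *m map_mx intr L *m (diag a b (map intr d)).
  rewrite -map_diag /w map_mxM -eu {1}eM !map_mxM -!mulmxA -map_mxM mulmxV //.
  by rewrite map_mx1 mulmx1.
pose z : 'rV[int]_a := \row_i (if [pick j : 'I_b | j == i :> nat] is Some j then w 0 j * (d`_i)^-1 else 0).
suff ez : z *m diag a b d = w.
  exists (z *m invmx L); rewrite eM !mulmxA -(mulmxA z) mulVmx // mulmx1 ez.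
  by rewrite /w -mulmxA mulVmx // mulmx1.
apply/rowP => j; have wj := congr1 (fun A : 'rV[rat]__ => A 0 j) ew.
rewrite mxE in wj; case: (ltnP j a) => [ja|aj].
  have eij : Ordinal ja = j :> nat by [].
  rewrite (mul_diagE _ _ eij) in wj; rewrite (mul_diagE _ _ eij) [z _ _]mxE.
  case: pickP => [k /eqP ek|/(_ j)]; last by rewrite /= eqxx.
  have {k ek}-> : k = j by apply: val_inj.
  have [d0|dn0] := eqVneq d`_(Ordinal ja) 0; last by rewrite divrK // (dunit _ _ eij).
  rewrite nth_intr d0 mulr0 in wj; rewrite d0 mulr0; apply/esym/eqP.
  by rewrite -(intr_eq0 rat) wj.
have col0 (S : pzRingType) (e : seq S) (y : 'rV_a) : (y *m diag a b e) 0 j = 0.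
  rewrite mxE big1 // => i _; rewrite mxE; case: eqP => [e'|_]; rewrite ?mulr0 //.
  by have := ltn_ord i; rewrite e' ltnNge aj.
by rewrite col0 in wj; rewrite col0; apply/esym/eqP; rewrite -(intr_eq0 rat) wj.
Qed.

(** Exactness at the next place makes the nonzero elementary divisors of N
    invertible in K, so that the kernel of N over K comes from the integral
    kernel. *)
Lemma exact_mx_field (K : fieldType) a b c e
    (M : 'M[int]_(a, b)) (N : 'M[int]_(b, c)) (P : 'M[int]_(c, e)) : N *m P = 0 ->
  exact_mx M N -> exact_mx N P -> exact_mx (map_mx (intr : int -> K) M) (map_mx intr N).
Proof.
move=> NP0 EX1 EX2 v vN; have [L uL [R uR [d _ eN]]] := int_Smith_normal_form N.
have dunit (i : 'I_b) (j : 'I_c) : i = j :> nat -> d`_i != 0 -> (d`_i)%:~R != 0 :> K.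
  move=> eij dn0; have rP := smith_row_ker NP0 uL eN eij dn0.
  have [u eu] := EX2 _ rP.
  by apply: (smith_coef_neq0 uR eN eij (u := map_mx intr u)); rewrite -map_mxM eu.
pose y := v *m map_mx intr L.
have RV : map_mx (intr : int -> K) R *m map_mx intr (invmx R) = 1%:M.
  by rewrite -map_mxM mulmxV // map_mx1.
have yD : y *m diag b c (map intr d) = 0.
  rewrite -map_diag -[LHS]mulmx1 -RV mulmxA /y.
  rewrite (_ : _ *m map_mx intr R = 0) ?mul0mx //.
  by apply: etrans vN; rewrite eN !map_mxM !mulmxA.
have good (i : 'I_b) : exists u : 'rV[K]_a,
    u *m map_mx intr M = y 0 i *: map_mx intr (row i (invmx L)).
  have [y0|yn0] := eqVneq (y 0 i) 0; first by exists 0; rewrite mul0mx y0 scale0r.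
  have rN : row i (invmx L) *m N = 0.
    rewrite (smith_row_mul uL eN); case: (ltnP i c) => [ic|ci]; last first.
      by rewrite row_diag0 // mul0mx.
    have eij : i = Ordinal ic :> nat by [].
    have := congr1 (fun A : 'rV[K]__ => A 0 (Ordinal ic)) yD.
    rewrite (mul_diagE _ _ eij) [RHS]mxE nth_intr => /eqP.
    rewrite mulf_eq0 (negbTE yn0) /= => d0.
    rewrite (row_diagE _ eij); have [->|dn0] := eqVneq d`_i 0.
      by rewrite scale0r mul0mx.
    by rewrite (negbTE (dunit _ _ eij dn0)) in d0.
  have [u eu] := EX1 _ rN; exists (y 0 i *: map_mx intr u).
  by rewrite -scalemxAl -map_mxM eu.
have /choice[u eu] := good.
exists (\sum_i u i); rewrite mulmx_suml; under eq_bigr => i _ do rewrite eu map_row.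
have LV : map_mx (intr : int -> K) L *m map_mx intr (invmx L) = 1%:M.
  by rewrite -map_mxM mulmxV // map_mx1.
by rewrite -mulmx_sum_row /y -mulmxA LV mulmx1.
Qed.

End SmithExactness.

(** * Magnitude homology with integer coefficients *)

Section Magnitude.
Variable G : digraph.
Local Notation dG := (@dist G).
Local Notation nvalid := (norm_valid dG).
Implicit Types (s : seq G).

Lemma valid_leq n l s : nvalid n l s -> (n <= l)%N.
Proof.
case/and3P=> /eqP; elim: s n l => // x [|y s] IHs n l [ss] srt en.
  by rewrite -ss.
case: n ss => // n ss; rewrite -[norm_along _ _]/(oaddn (dG x y) (norm_along dG (y :: s))) in en.
case/andP: srt => nxy srt; case exy: (dG x y) en => [[|a]|//].
  by move/dist_eq0: exy nxy => ->; rewrite eqxx.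
case en: (norm_along dG (y :: s)) => [b|//] /eqP[<-].
by rewrite addSn ltnS (leq_trans (IHs n b ss srt _)) ?en ?leq_addl.
Qed.

Lemma valid0 l s : nvalid 0 l s -> l = 0%N.
Proof. by case/and3P; case: s => [|x [|y s]] // _ _ /eqP[]. Qed.

Lemma mtuple_valid n l (t : mtuple G n l) : nvalid n l (val (val t)).
Proof. by have := valP t; rewrite /= /norm_valid size_tuple eqxx. Qed.

Lemma valid_mtuple n l s : nvalid n l s -> exists t : mtuple G n l, val (val t) = s.
Proof.
case/and3P=> ss srt es.
have pt : (fun t : n.+1.-tuple G => sorted (fun x y => x != y) t && (mnorm t == Some l))
    (Tuple ss) by rewrite /= srt.
by exists (exist _ (Tuple ss) pt).
Qed.

(** The coefficients of the magnitude differential in the basis of tuples. *)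
Definition incidence n l (t : mtuple G n.+1 l) (s : mtuple G n l) : int :=
  \sum_(i < n.+2) (-1) ^+ i * (mdelete i (val t) == val s)%:R.

Definition incidence_mx n l : 'M[int]_(#|{: mtuple G n.+1 l}|, #|{: mtuple G n l}|) :=
  \matrix_(t, s) incidence (enum_val t) (enum_val s).

Lemma mdiffE n l (f : MC G n.+1 l) (s : mtuple G n l) :
  mdiff f s = \sum_t f t * incidence t s.
Proof.
rewrite /mdiff sum_ffunE; apply: eq_bigr => t _.
rewrite sum_ffunE /incidence mulr_sumr; apply: eq_bigr => i _.
rewrite ffunMzE /mface mulrA -mulrzr intz mulrC [f t * _]mulrC; congr (_ * _).
case: insubP => [u _ eu|]; rewrite ffunE; first by rewrite -eu val_eqE eq_sym.
by case: (mdelete i (val t) =P val s) => // ->; rewrite (valP s).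
Qed.

(** Magnitude homology is defined as a quotient of the group of cycles. *)
Lemma diagonalP : diagonal G <-> forall n l, (n <> l)%N ->
  forall f : MC G n l, f \in @mcycle G n l -> exists g, mdiff g = f.
Proof.
have piE n l (z : MZ G n l) : (\pi_(MH G n l)%qT z == \pi_(MH G n l)%qT 0) =
    `[< exists g : MC G n.+1 l, mdiff g = val z >].
  by rewrite -[LHS]Quotient.idealrBE subr0.
split=> [H n l nl f fc|H n l nl h].
  pose z : MZ G n l := exist _ f fc.
  have /asboolP// : `[< exists g : MC G n.+1 l, mdiff g = val z >].
  by rewrite -piE !(H n l (fun e => nl (esym e)) (\pi_(MH G n l)%qT _)).
have /eqP : \pi_(MH G n l)%qT (repr h) == \pi_(MH G n l)%qT 0.
  by rewrite piE; apply/asboolP/H; [exact: nesym | exact: valP].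
by rewrite reprK => ->; rewrite raddf0.
Qed.

Definition insert_at i (v : G) s := take i s ++ v :: drop i s.

Lemma mdelete_seq n (i : 'I_n.+2) (t : n.+2.-tuple G) :
  tval (mdelete i t) = take i t ++ drop i.+1 t.
Proof.
have st := size_tuple t; have [x0 _] : exists x : G, True.
  by case: (tval t) st => // x; exists x.
have ltin := ltn_ord i; apply: (@eq_from_nth _ x0) => [|j].
  rewrite size_tuple size_cat size_take size_drop st ltn_ord; lia.
rewrite size_tuple => lt; rewrite -[j]/(val (Ordinal lt)) -tnth_nth tnth_mktuple.
rewrite (tnth_nth x0) /= nth_cat size_take st ltn_ord /bump.
case: (leqP i j) => ij; first by rewrite nth_drop add1n addSn subnKC.
by rewrite add0n nth_take.
Qed.

Lemma mdelete_eqE n (i : 'I_n.+2) (t : n.+2.-tuple G) (s : n.+1.-tuple G) :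
  mdelete i t = s <-> exists v, tval t = insert_at i v s.
Proof.
have ltin := ltn_ord i; split=> [e|[v ev]].
  have [x0 _] : exists x : G, True.
    by case: (tval t) (size_tuple t) => // x; exists x.
  exists (nth x0 t i); rewrite -e /insert_at mdelete_seq.
  have st : size (take i t) = i by rewrite size_take size_tuple ltn_ord.
  by rewrite take_size_cat // drop_size_cat // -drop_nth ?size_tuple // cat_take_drop.
apply: val_inj; rewrite /= mdelete_seq ev /insert_at.
have st : size (take i s) = i by rewrite size_takel // size_tuple -ltnS.
rewrite take_size_cat // -cat_rcons drop_size_cat ?size_rcons ?st //.
by rewrite cat_take_drop.
Qed.

Section FieldChains.
Variable K : fieldType.
Implicit Type c : seq G -> K.

Lemma sum_mdelete n l c (i : 'I_n.+2) (s : mtuple G n l) : chain dG n.+1 l c ->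
  \sum_(t : mtuple G n.+1 l) (mdelete i (val t) == val s)%:R * c (val (val t)) =
  \sum_v c (insert_at i v (val (val s))).
Proof.
move=> cc; transitivity (\sum_(t : mtuple G n.+1 l) \sum_v
    (tval (val t) == insert_at i v (val (val s)))%:R * c (insert_at i v (val (val s)))).
  apply: eq_bigr => t _; case: eqP => [/mdelete_eqE[v ev]|ne].
    rewrite (bigD1 v) //= ev eqxx big1 ?addr0 // => w nw.
    have/negPf-> : insert_at i v (val (val s)) != insert_at i w (val (val s)).
      apply: contraNneq nw => /(congr1 (fun q => drop i q)).
      have st : size (take i (val (val s))) = i.
        by rewrite size_takel // size_tuple -ltnS ltn_ord.
      by rewrite /insert_at !drop_size_cat // => -[->].
    by rewrite mul0r.
  rewrite mul0r big1 // => v _; case: eqP => [e|_]; last by rewrite mul0r.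
  by case: ne; apply/mdelete_eqE; exists v.
rewrite exchange_big; apply: eq_bigr => v _ /=.
have [->|nz] := eqVneq (c (insert_at i v (val (val s)))) 0.
  by rewrite big1 // => t _; rewrite mulr0.
have [t et] := valid_mtuple (cc _ nz).
rewrite (bigD1 t) //= et eqxx mul1r big1 ?addr0 // => t' nt'.
case: eqP => [e|_]; last by rewrite mul0r.
by case/eqP: nt'; do 2!apply: val_inj; rewrite et.
Qed.

(** Adding a vertex at an end of a tuple strictly increases the norm. *)
Lemma insert_end_invalid n l v (s : mtuple G n l) :
  nvalid n.+1 l (v :: val (val s)) = false /\ nvalid n.+1 l (rcons (val (val s)) v) = false.
Proof.
have /and3P[_ _ /eqP es] := mtuple_valid s.
have pos x y (a : option nat) : x != y -> oaddn (dG x y) a = a -> a = None.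
  case exy: (dG x y) => [[|m]|] // nxy; last by case: a => //= a [e]; lia.
  by move/dist_eq0: exy nxy => ->; rewrite eqxx.
have sz : size (val (val s)) = n.+1 by rewrite size_tuple.
split; apply/negbTE/negP => /and3P[ss srt /eqP en].
  case: (val (val s)) sz es srt en => // x q _ es /andP[nvx _] en.
  have := pos v x (Some l) nvx; rewrite -[norm_along _ _]/(oaddn (dG v x) (norm_along dG (x :: q))) in en.
  by rewrite -es en es => /(_ erefl).
case/lastP: (val (val s)) sz es srt en => // p x _ es; rewrite -[rcons (rcons _ _) _]cats1 cat_rcons.
move=> /sorted_cat_cons/andP[nxv _]; rewrite nrm_cat es.
rewrite (_ : norm_along dG [:: x; v] = dG x v); last by rewrite /= oaddn0.
by rewrite oaddnC => /(pos _ _ _ nxv).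
Qed.

(** The sign comes from the numbering: gap i corresponds to the deletion of
    entry i+1. *)
Lemma boundary_incidence n l c (s : mtuple G n l) : chain dG n.+1 l c ->
  boundary dG c (val (val s)) = - \sum_t (incidence t s)%:~R * c (val (val t)).
Proof.
move=> cc; have vs := mtuple_valid s.
transitivity (- \sum_(i < n.+2) (-1) ^+ i * \sum_v c (insert_at i v (val (val s)))); last first.
  congr (- _); under [RHS]eq_bigr => t _ do rewrite rmorph_sum mulr_suml.
  rewrite exchange_big /=; apply: eq_bigr => i _; rewrite -sum_mdelete // mulr_sumr.
  by apply: eq_bigr => t _; rewrite rmorphM rmorphXn rmorphN1 rmorph_nat mulrA.
have inv t : nvalid n.+1 l t = false -> c t = 0.
  by move=> nv; apply/eqP; apply: contraFT nv => /cc.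
have ss : size (val (val s)) = n.+1 by rewrite size_tuple.
rewrite big_ord_recl big_ord_recr /= ?lift0 [X in _ * X + _]big1 => [|v _]; last first.
  by rewrite /insert_at take0 drop0 inv //; case: (insert_end_invalid v s).
rewrite [X in _ + (_ + _ * X)]big1 => [|v _]; last first.
  rewrite /insert_at /bump /= add1n take_oversize ?ss // drop_oversize ?ss // cats1.
  by rewrite inv //; case: (insert_end_invalid v s).
rewrite !mulr0 add0r addr0 boundary_narrow ss /= -sumrN; apply: eq_bigr => i _.
rewrite /bump /= add1n exprS mulN1r mulNr opprK; congr (_ * _).
have [|p [x [y [q [es ep]]]]] := @gap_split G i (val (val s)).
  by rewrite ss; have := ltn_ord i.
rewrite es -{1}ep face_cat; apply: eq_bigr => v _; rewrite /insert_at -ep.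
rewrite -(cat_rcons x p (y :: q)) take_size_cat ?size_rcons // drop_size_cat ?size_rcons //.
rewrite cat_rcons.
case bt: between; first by rewrite mul1r.
rewrite mul0r inv //; apply: contraFF bt => vclass.
rewrite es in vs; case/and3P: vs => _ srt /eqP en; case/and3P: vclass => _ srt' /eqP en'.
case/andP: (sorted_cat_cons srt') => nxv srt''.
have nvy : v != y by case/andP: srt''.
rewrite /between nxv nvy /=; rewrite !nrm_cat in en en'.
have eN z w r : norm_along dG [:: z, w & r] = oaddn (dG z w) (norm_along dG (w :: r)) by [].
rewrite !eN in en en'; move: (norm_along dG (y :: q)) (norm_along dG (rcons p x)) en en'.
case: (dG x y) => [b|]; case: (dG x v) => [b1|]; case: (dG v y) => [b2|] [e|] [a|] //= [e1] [e2].
by apply/eqP; congr Some; lia.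
Qed.

Definition chain_of n l (v : 'rV[K]_#|{: mtuple G n l}|) s : K :=
  \sum_(t : mtuple G n l) (val (val t) == s)%:R * v 0 (enum_rank t).

Lemma chain_ofE n l (v : 'rV[K]_#|{: mtuple G n l}|) t :
  chain_of v (val (val t)) = v 0 (enum_rank t).
Proof.
rewrite /chain_of (bigD1 t) //= eqxx mul1r big1 ?addr0 // => t' nt.
by case: eqP => [e|]; [case/eqP: nt; do 2!apply: val_inj | rewrite mul0r].
Qed.

Lemma chain_of_chain n l (v : 'rV[K]_#|{: mtuple G n l}|) : chain dG n l (chain_of v).
Proof.
move=> s; apply: contraNT => nv; apply/eqP/big1 => t _; case: eqP => [e|_].
  by move: nv; rewrite -e mtuple_valid.
by rewrite mul0r.
Qed.

Lemma chain_ext n l c c' : chain dG n l c -> chain dG n l c' ->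
  (forall t : mtuple G n l, c (val (val t)) = c' (val (val t))) -> forall s, c s = c' s.
Proof.
move=> cc cc' h s; have [/valid_mtuple[t <-]//|nv] := boolP (nvalid n l s).
transitivity (0 : K); last apply/esym; apply/eqP; apply: contraNT nv; [exact: cc|exact: cc'].
Qed.

Lemma boundary_chain_of n l (v : 'rV[K]_#|{: mtuple G n.+1 l}|) s :
  boundary dG (chain_of v) s = - chain_of (v *m map_mx intr (incidence_mx n l)) s.
Proof.
move: s; apply: (@chain_ext n l) => [|s|t].
- exact: (boundary_chain (@dist_metric G) (@chain_of_chain _ _ v)).
- by rewrite oppr_eq0; apply: chain_of_chain.
rewrite (boundary_incidence t (@chain_of_chain _ _ v)) chain_ofE mxE -sum_enum_val.
congr (- _); apply: eq_bigr => i _; rewrite chain_ofE enum_valK !mxE enum_rankK.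
by rewrite mulrC.
Qed.

(** In degree zero there are no chains of positive norm, hence the shift of
    n. *)
Lemma off_diagonal_exact_mx : @off_diagonal_exact K G dG <->
  forall n l, (n.+1 < l)%N ->
    exact_mx (map_mx (intr : int -> K) (incidence_mx n.+1 l)) (map_mx intr (incidence_mx n l)).
Proof.
split=> [OD n l nl v vN|EX [|n] l nl c cc Dc].
- have [|b [bc Db]] := OD n.+1 l nl _ (@chain_of_chain _ _ v).
    move=> s; rewrite boundary_chain_of vN; apply/eqP; rewrite oppr_eq0; apply/eqP.
    by apply: big1 => t _; rewrite mxE mulr0.
  pose u : 'rV[K]_#|{: mtuple G n.+2 l}| := \row_i - b (val (val (enum_val i))).
  exists u; apply/rowP => j; rewrite -[j]enum_valK -!chain_ofE -[LHS]opprK -boundary_chain_of.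
  rewrite -Db; apply: canLR (@opprK K) _; rewrite -[RHS]mulN1r.
  have eu s : chain_of u s = -1 * b s + (fun=> 0) s.
    rewrite addr0 mulN1r; move: s; apply: (@chain_ext n.+2 l) => [|s|t].
    - exact: chain_of_chain.
    - by rewrite oppr_eq0; apply: bc.
    by rewrite chain_ofE mxE enum_rankK.
  have -> : chain_of u = fun s => -1 * b s + (fun=> 0) s by apply/funext.
  rewrite boundary_linear [X in _ + X]big1 ?addr0 // => i _.
  by rewrite face0 mulr0.
- exists (fun=> 0); split=> [s|s]; first by rewrite eqxx.
  have -> : c s = 0.
    apply/eqP; apply: contraT => /cc/valid0 l0.
    by rewrite l0 in nl.
  by apply: big1 => i _; rewrite face0 mulr0.
pose v : 'rV[K]_#|{: mtuple G n.+1 l}| := \row_i c (val (val (enum_val i))).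
have ev : chain_of v = c.
  apply/funext; apply: (@chain_ext n.+1 l) => // [|t]; first exact: chain_of_chain.
  by rewrite chain_ofE mxE enum_rankK.
have [|u eu] := EX n l nl v.
  apply/rowP => j; rewrite -[j]enum_valK -chain_ofE -[LHS]opprK -boundary_chain_of ev Dc mxE.
  by rewrite oppr0.
exists (chain_of (- u)); split=> [|s]; first exact: chain_of_chain.
rewrite boundary_chain_of mulNmx eu -ev /chain_of -sumrN; apply: eq_bigr => t _.
by rewrite mxE mulrN opprK.
Qed.

End FieldChains.

Lemma incidence_mxM n l : incidence_mx n.+1 l *m incidence_mx n l = 0.
Proof.
suff e0 : map_mx (intr : int -> rat) (incidence_mx n.+1 l *m incidence_mx n l) = 0.
  apply/matrixP => i j; have /matrixP/(_ i j) e := e0.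
  rewrite [LHS]mxE [RHS]mxE in e; rewrite [RHS]mxE; apply/eqP.
  by rewrite -(intr_eq0 rat) e.
rewrite map_mxM.
apply/row_matrixP => i; rewrite row0 rowE mulmxA; set v := delta_mx 0 i.
apply/rowP => j; rewrite -[j]enum_valK -chain_ofE -[LHS]opprK -boundary_chain_of.
have -> : chain_of (v *m map_mx intr (incidence_mx n.+1 l)) = fun s => - boundary dG (chain_of v) s.
  by apply/funext => s; rewrite boundary_chain_of opprK.
rewrite mxE; apply/eqP; rewrite oppr_eq0; apply/eqP.
have -> : (fun s => - boundary dG (chain_of v) s) = fun s => -1 * boundary dG (chain_of v) s + (fun=> 0) s.
  by apply/funext => s; rewrite mulN1r addr0.
rewrite boundary_linear (boundary_boundary (@dist_metric G)) mulr0 add0r.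
by apply: big1 => k _; rewrite face0 mulr0.
Qed.

Lemma diagonal_exact_mx : diagonal G <->
  forall n l, (n.+1 < l)%N -> exact_mx (incidence_mx n.+1 l) (incidence_mx n l).
Proof.
have rowK n l (v : 'rV[int]_#|{: mtuple G n l}|) :
    \row_i [ffun t => v 0 (enum_rank t)] (enum_val i) = v.
  by apply/rowP => i; rewrite mxE ffunE enum_valK.
have mdiff_row n l (f : MC G n.+1 l) :
    \row_i mdiff f (enum_val i) = (\row_i f (enum_val i)) *m incidence_mx n l.
  apply/rowP => j; rewrite !mxE mdiffE -sum_enum_val.
  by apply: eq_bigr => i _; rewrite !mxE.
have rowI n l (f g : MC G n l) : \row_(i < #|{: mtuple G n l}|) f (enum_val i) =
    \row_i g (enum_val i) -> f = g.
  move=> /rowP e; apply/ffunP => t; have := e (enum_rank t).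
  by rewrite !mxE enum_rankK.
rewrite diagonalP; split=> [H n l nl v vN|EX n l nl f fc].
  have [||g eg] := H n.+1 l _ [ffun t => v 0 (enum_rank t)]; first by lia.
    rewrite unfold_in /=; apply/eqP/rowI; rewrite mdiff_row rowK vN.
    by apply/rowP => j; rewrite !mxE ffunE.
  by exists (\row_i g (enum_val i)); rewrite -mdiff_row eg rowK.
have [ln|le] := ltnP l n.
  exists 0; apply/ffunP => t; have := valid_leq (mtuple_valid t).
  by rewrite leqNgt ln.
have nl' : (n < l)%N by lia.
case: n f fc nl' {nl le} => [|n] f fc nl.
  exists 0; apply/ffunP => t; have l0 := valid0 (mtuple_valid t).
  by rewrite l0 in nl.
move: fc; rewrite unfold_in /= => /eqP fc.
have [|u eu] := EX n l nl (\row_i f (enum_val i)).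
  by rewrite -mdiff_row fc; apply/rowP => j; rewrite !mxE ffunE.
exists [ffun t => u 0 (enum_rank t)]; apply: rowI.
by rewrite mdiff_row rowK eu.
Qed.

(** The reduction to fields needs exactness over Z at two consecutive places,
    both of which lie off the diagonal; in degree zero the second matrix is
    replaced by an empty one. *)
Theorem diagonal_off_diagonal_exact :
  diagonal G <-> forall K : fieldType, @off_diagonal_exact K G dG.
Proof.
rewrite diagonal_exact_mx; split=> [EX K|OD n l nl].
  apply/off_diagonal_exact_mx => -[|n] l nl; last first.
    by apply: exact_mx_field (incidence_mxM n l) (EX _ _ nl) (EX _ _ (ltnW nl)).
  (* There are no vertices of positive norm: the next place is trivially
     exact. *)
  have EX0 : exact_mx (incidence_mx 0 l) (0 : 'M[int]_(#|{: mtuple G 0 l}|, 0)).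
    move=> v _; exists 0; apply/rowP => j; have l0 := valid0 (mtuple_valid (enum_val j)).
    by rewrite l0 in nl.
  exact: exact_mx_field (mulmx0 _ _) (EX _ _ nl) EX0.
apply: exact_mx_int (incidence_mxM n l) _ => K.
exact: (proj1 (off_diagonal_exact_mx K) (OD K)).
Qed.

End Magnitude.

Import Order.TTheory Num.Theory.

(** * Linear complexes over a Koszul ring *)

Section GradedModules.
Variable A : gradedRing.
Implicit Types M N P Q : gradedModule A.

Notation "x \in_deg i" := (x \in homog (@gm_pr A _) i) (at level 70).

Lemma linear_exists (U V : lmodType A) (f : U -> V) :
  (forall a u v, f (a *: u + v) = a *: f u + f v) -> exists g : {linear U -> V}, g =1 f.
Proof.
move=> linf; pose m := GRing.isLinear.Build A U V *:%R f linf.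
by exists (HB.pack_for {linear U -> V} f m).
Qed.

Lemma gm_pr_scale M (i : nat) (j : int) (a : A) (x : M) :
  a \in homog (@gr_pr A) i -> gm_pr (i%:Z + j) (a *: x) = a *: gm_pr j x.
Proof.
move=> ha; have gM := gm_grading M; have [s us es] := grad_sum gM x.
rewrite [in LHS]es [in RHS]es scaler_sumr !(grad_bigsum gM) scaler_sumr.
apply: eq_bigr => k _; rewrite (gradK gM).
have hk := homogE (gm_scale ha (homogP gM k x)).
have [->|njk] := eqVneq j k; first exact: hk.
by rewrite scaler0 -hk (gradK gM) (inj_eq (addrI _)) (negbTE njk).
Qed.

(** A graded module generated in degree n over a ring graded by natural numbers
    starts in degree n. *)
Lemma gm_pr_low M n (m : int) (x : M) : generated_in_degree M n ->
  (m < n)%R -> gm_pr m x = 0.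
Proof.
have gM := gm_grading M; move=> gen lt; have [k [a [y [hy ->]]]] := gen x.
rewrite (grad_bigsum gM) big1 // => r _.
have [s us ->] := grad_sum (gr_grading A) (a r).
rewrite scaler_suml (grad_bigsum gM) big1 // => i _.
have := homogE (gm_scale (homogP (gr_grading A) i (a r)) (hy r)) => <-.
rewrite (gradK gM); case: eqP => // e; move: lt; rewrite e; lia.
Qed.

(** A dual basis in degree n, which is all that is used of a graded projective
    module generated in this degree. *)
Definition has_graded_basis Q (n : nat) :=
  exists (I : finType) (b : I -> Q) (c : I -> Q -> A),
  [/\ forall i, b i \in homog (@gm_pr A Q) n%:Z,
      forall i a u v, c i (a *: u + v) = a * c i u + c i v,
      forall i j f, f \in homog (@gm_pr A Q) (n + j)%:Z -> c i f \in homog (@gr_pr A) j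
    & forall f, f = \sum_i c i f *: b i].

Lemma graded_basis_projective Q n : has_graded_basis Q n -> projective Q.
Proof.
case=> I [b [c [_ linc _ bc]]] M N g f gsurj.
have /choice[m em] : forall i, exists x, g x = f (b i) by move=> i; apply: gsurj.
have [|h eh] := @linear_exists Q M (fun q => \sum_i c i q *: m i).
  move=> a u v; rewrite scaler_sumr -big_split; apply: eq_bigr => i _ /=.
  by rewrite linc scalerDl scalerA.
exists h => q; rewrite eh [in RHS](bc q) !linear_sum; apply: eq_bigr => i _.
by rewrite !linearZ em.
Qed.

Lemma graded_basis_generated Q n : has_graded_basis Q n ->
  generated_in_degree Q n%:Z.
Proof.
case=> I [b [c [hb _ _ bc]]] q; exists #|I|.
exists (fun i => c (enum_val i) q), (fun i => b (enum_val i)); split=> //.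
by rewrite [LHS](bc q) -sum_enum_val.
Qed.

Lemma graded_hom_homog M N (f : {linear M -> N}) i (x : M) : graded_hom f ->
  x \in homog (@gm_pr A M) i -> f x \in homog (@gm_pr A N) i.
Proof. by move=> hf hx; rewrite unfold_in /homog -hf (homogE hx). Qed.

Lemma homog_graded_hom M N (f : {linear M -> N}) :
  (forall i x, x \in homog (@gm_pr A M) i -> f x \in homog (@gm_pr A N) i) ->
  graded_hom f.
Proof.
move=> hf i x; have [gM gN] := (gm_grading M, gm_grading N).
have [s us es] := grad_sum gM x.
rewrite [in LHS]es [in RHS]es linear_sum !(grad_bigsum gM) !(grad_bigsum gN) linear_sum.
apply: eq_bigr => k _; rewrite (gradK gM).
have hk := homogE (hf _ _ (homogP gM k x)).
have [->|nik] := eqVneq i k; first by rewrite hk.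
by rewrite linear0 -hk (gradK gN) (negbTE nik).
Qed.

Lemma homog_eq0 M (x : M) : (forall i, gm_pr i x = 0) -> x = 0.
Proof.
by move=> h; have [s _ ->] := grad_sum (gm_grading M) x; rewrite big1.
Qed.

(** The comparison map exists since Q1 is projective, and it is onto because P1
    is generated in degree n, where both differentials are injective. It
    therefore splits, as P1 is projective. For an element q of its kernel, the
    coefficients of q in the dual basis multiply the elements b i - psi (phi1
    (b i)), where psi is a section; their parts of degree n vanish because the
    map is injective there, so q is zero. *)
Lemma comparison_step (P1 P0 Q1 Q0 : gradedModule A) (n : nat)
    (dP : {linear P1 -> P0}) (dQ : {linear Q1 -> Q0}) (phi : {linear Q0 -> P0}) :
  graded_hom dP -> graded_hom dQ -> graded_hom phi -> injective phi ->
  projective P1 -> generated_in_degree P1 n%:Z ->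
  (forall p, p \in homog (@gm_pr A P1) n%:Z -> dP p = 0 -> p = 0) ->
  has_graded_basis Q1 n ->
  (forall q, q \in homog (@gm_pr A Q1) n%:Z -> dQ q = 0 -> q = 0) ->
  (forall q, exists p, dP p = phi (dQ q)) ->
  (forall p, p \in homog (@gm_pr A P1) n%:Z ->
     exists2 q, q \in homog (@gm_pr A Q1) n%:Z & dP p = phi (dQ q)) ->
  exists phi1 : {linear Q1 -> P1},
    [/\ graded_hom phi1, injective phi1, forall p, exists q, phi1 q = p
      & forall q, dP (phi1 q) = phi (dQ q)].
Proof.
move=> hdP hdQ hphi iphi projP genP dP0 basQ dQ0 im1 im2.
have genQ := graded_basis_generated basQ.
have [[gP1 gP0] gQ1] := (gm_grading P1, gm_grading P0, gm_grading Q1).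
case: basQ => I [b [c [hb linc hc bc]]].
have /choice[p hp] : forall i, exists p, p \in homog (@gm_pr A P1) n%:Z /\
    dP p = phi (dQ (b i)).
  move=> i; have [p ep] := im1 (b i); exists (gm_pr n%:Z p); split.
    exact: homogP.
  by rewrite hdP ep -hphi -hdQ (homogE (hb i)).
have [|phi1 ephi] := @linear_exists Q1 P1 (fun q => \sum_i c i q *: p i).
  move=> a u v; rewrite scaler_sumr -big_split; apply: eq_bigr => i _ /=.
  by rewrite linc scalerDl scalerA.
have comm q : dP (phi1 q) = phi (dQ q).
  rewrite ephi [in RHS](bc q) !linear_sum; apply: eq_bigr => i _.
  by rewrite !linearZ (hp i).2.
have hphi1 : graded_hom phi1.
  apply: homog_graded_hom => i q hq; case: (ltP i n%:Z) => [lt|le].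
    by rewrite -(homogE hq) (gm_pr_low _ genQ lt) linear0 unfold_in /homog grad0 ?eqxx.
  have [j ei] : exists j : nat, i = (n + j)%:Z by exists (absz (i - n%:Z)); lia.
  rewrite ei in hq *; rewrite unfold_in /homog ephi (grad_bigsum gP1); apply/eqP.
  apply: eq_bigr => k _; rewrite addnC PoszD.
  by rewrite (gm_pr_scale _ _ (hc k j q hq)) (homogE (hp k).1).
have surj p0 : exists q, phi1 q = p0.
  have [k [a [x [hx ->]]]] := genP p0.
  have /choice[q hq] : forall r, exists q, phi1 q = x r.
    move=> r; have [q hq eq] := im2 _ (hx r); exists q; apply/eqP; rewrite -subr_eq0.
    apply/eqP/dP0; last by rewrite linearB comm eq subrr.
    by rewrite unfold_in /homog (gradB gP1) (homogE (hx r)) (homogE (graded_hom_homog hphi1 hq)).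
  exists (\sum_(r < k) a r *: q r); rewrite linear_sum; apply: eq_bigr => r _.
  by rewrite linearZ hq.
(* A section of phi1, which turns the kernel into a sum of multiples of b i -
   psi (phi1 (b i)). *)
have [psi epsi] := projP Q1 P1 phi1 idfun surj.
have ker_n q : phi1 q = 0 -> gm_pr n%:Z q = 0.
  move=> q0; apply: dQ0; first exact: homogP.
  by apply: iphi; rewrite -comm hphi1 q0 !linear0 grad0 ?linear0.
have ker0 q : phi1 q = 0 -> q = 0.
  move=> q0; apply: homog_eq0 => m; case: (ltP m n%:Z) => [lt|le].
    exact: gm_pr_low genQ lt.
  have [j em] : exists j : nat, m = (n + j)%:Z by exists (absz (m - n%:Z)); lia.
  set k := gm_pr m q; have hk : k \in homog (@gm_pr A Q1) (n + j)%:Z.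
    by rewrite -em; apply: homogP.
  have k0 : phi1 k = 0 by rewrite hphi1 q0 grad0.
  pose u i := b i - psi (phi1 (b i)).
  have ku : k = \sum_i c i k *: u i.
    have e1 : psi (phi1 k) = \sum_i c i k *: psi (phi1 (b i)).
      rewrite {1}[k]bc !linear_sum; apply: eq_bigr => i _.
      by rewrite !linearZ.
    under eq_bigr => i _ do rewrite scalerBr.
    by rewrite sumrB -e1 k0 linear0 subr0 -bc.
  rewrite -(homogE hk) ku (grad_bigsum gQ1) big1 // => i _.
  rewrite addnC PoszD (gm_pr_scale _ _ (hc i j k hk)) ker_n ?scaler0 //.
  by rewrite /u linearB epsi subrr.
exists phi1; split=> // x y e; apply/eqP; rewrite -subr_eq0; apply/eqP/ker0.
by rewrite linearB e subrr.
Qed.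

End GradedModules.

Section LinearComplex.
Variables (A : gradedRing) (Q : nat -> gradedModule A).
Variables (dQ : forall n, {linear Q n.+1 -> Q n}) (eQ : {linear Q 0%N -> deg0_gmod A}).

(** The shape shared by the two complexes below: linear in the sense that the
    n-th module has a dual basis in degree n. *)
Record linear_complex : Prop := LinearComplex {
  lc_basis : forall n, has_graded_basis (Q n) n;
  lc_hd : forall n, graded_hom (dQ n);
  lc_he : graded_hom eQ;
  lc_dd : forall n q, dQ n (dQ n.+1 q) = 0;
  lc_ed : forall q, eQ (dQ 0%N q) = 0;
  lc_esurj : forall s, exists2 q, q \in homog (@gm_pr A (Q 0)) 0 & eQ q = s
}.

Hypothesis lc : linear_complex.

Lemma exact_koszul : semisimple_ring (deg0 A) ->
  (forall q, eQ q = 0 -> exists q', dQ 0%N q' = q) ->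
  (forall n q, dQ n q = 0 -> exists q', dQ n.+1 q' = q) -> koszul A.
Proof.
case: lc => bas hd he dd eclass es ss ex0 ex; split=> //; exists Q, dQ, eQ; split=> //.
- by move=> n; apply: graded_basis_projective (bas n).
- by move=> n; apply: graded_basis_generated.
- by move=> s; have [q _ <-] := es s; exists q.
by split=> [p|n p]; split=> [|[q <-]]; [exact: ex0 | exact: eclass | exact: ex | exact: dd].
Qed.

(** The isomorphism with the resolution is built degree by degree with
    comparison_step; the hypotheses are the exactness of the given complex in
    the degrees where a linear resolution is determined, namely injectivity in
    degree n and exactness in degree n+1 of the n-th module. *)
Lemma koszul_exact : koszul A ->
  (forall q, q \in homog (@gm_pr A (Q 0)) 0 -> eQ q = 0 -> q = 0) ->
  (forall n q, q \in homog (@gm_pr A (Q n.+1)) n.+1%:Z -> dQ n q = 0 -> q = 0) ->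
  (forall q, q \in homog (@gm_pr A (Q 0)) 1 -> eQ q = 0 ->
     exists2 q', q' \in homog (@gm_pr A (Q 1)) 1 & dQ 0%N q' = q) ->
  (forall n q, q \in homog (@gm_pr A (Q n.+1)) n.+2%:Z -> dQ n q = 0 ->
     exists2 q', q' \in homog (@gm_pr A (Q n.+2)) n.+2%:Z & dQ n.+1 q' = q) ->
  forall n q, dQ n q = 0 -> exists q', dQ n.+1 q' = q.
Proof.
case: lc => bas hd he dd eclass es [_ [P [dP [eP [projP genP [heP hdP] esP [exP0 exP]]]]]].
move=> inj0 inj ker0 ker.
have dPinj n p : p \in homog (@gm_pr A (P n.+1)) n.+1%:Z -> dP n p = 0 -> p = 0.
  move=> hp /exP[p' ep]; rewrite -(homogE hp) -ep -hdP (gm_pr_low _ (genP n.+2)) ?linear0 ?ltz_nat //.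
have ePinj p : p \in homog (@gm_pr A (P 0)) 0 -> eP p = 0 -> p = 0.
  move=> hp /exP0[p' ep]; rewrite -(homogE hp) -ep -hdP (gm_pr_low _ (genP 1)) ?linear0 ?ltz_nat //.
have [q|p _|phi0 [h0 i0 s0 c0]] := @comparison_step A (P 0) (deg0_gmod A) (Q 0)
    (deg0_gmod A) 0 eP eQ idfun heP he (fun _ _ => erefl) (fun _ _ => id)
    (projP 0) (genP 0) ePinj (bas 0) inj0.
- exact: esP.
- by have [q hq eq] := es (eP p); exists q.
pose compat n (phi : {linear Q n -> P n}) (phi' : {linear Q n.+1 -> P n.+1}) :=
  [/\ injective phi, graded_hom phi', injective phi', forall p, exists q, phi' q = p
    & forall q, dP n (phi' q) = phi (dQ n q)].
have next n phi phi' : compat n phi phi' -> exists phi'', compat n.+1 phi' phi''.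
  case=> ip hp' ip' sp' cp.
  have [||phi1 [h1 i1 s1 c1]] := @comparison_step A (P n.+2) (P n.+1) (Q n.+2) (Q n.+1) n.+2
    (dP n.+1) (dQ n.+1) phi' (hdP n.+1) (hd n.+1) hp' ip' (projP n.+2) (genP n.+2)
    (dPinj n.+1) (bas n.+2) (inj n.+1).
  - by move=> q; apply/exP; rewrite cp dd linear0.
  - move=> p hpd; have [q eq] := sp' (dP n.+1 p).
    have hq : q \in homog (@gm_pr A (Q n.+1)) n.+2%:Z.
      by rewrite unfold_in /homog; apply/eqP/ip'; rewrite hp' eq -hdP (homogE hpd).
    have [|q' hq' eq'] := ker n q hq; last by exists q'; rewrite // eq' eq.
    by apply: ip; rewrite -cp eq linear0; apply/exP; exists p.
  by exists phi1.
have iso n : exists phi phi', compat n phi phi'.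
  elim: n => [|n [phi [phi' /next[phi'' c']]]]; last by exists phi', phi''.
  have [||phi1 [h1 i1 s1 c1]] := @comparison_step A (P 1) (P 0) (Q 1) (Q 0) 1
    (dP 0) (dQ 0) phi0 (hdP 0) (hd 0) h0 i0 (projP 1) (genP 1) (dPinj 0) (bas 1) (inj 0).
  - by move=> q; apply/exP0; rewrite c0 /= eclass.
  - move=> p hpd; have [q eq] := s0 (dP 0 p).
    have hq : q \in homog (@gm_pr A (Q 0)) 1.
      by rewrite unfold_in /homog; apply/eqP/i0; rewrite h0 eq -hdP (homogE hpd).
    have [|q' hq' eq'] := ker0 q hq; last by exists q'; rewrite // eq' eq.
    by have := c0 q; rewrite /= => <-; rewrite eq; apply/exP0; exists p.
  by exists phi0, phi1.
move=> n q dq; have [phi [phi' cphi]] := iso n.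
have [phi'' [_ _ _ s2 c2]] := next n phi phi' cphi.
case: cphi => ip _ ip' _ cp.
have /exP[p ep] : dP n (phi' q) = 0 by rewrite cp dq linear0.
by have [q' eq'] := s2 p; exists q'; apply: ip'; rewrite -c2 eq'.
Qed.

End LinearComplex.

(** * Relatively free graded modules *)

(** Such a ring is a finite product of division rings, and a submodule is the
    sum of the blocks it contains. *)
Lemma semisimple_of_idempotents (R : pzRingType) (V : finType) (e : V -> R) :
  (forall x y, e x * e y = if x == y then e x else 0) -> \sum_x e x = 1 ->
  (forall s x, s * e x = e x * s) ->
  (forall s x, s * e x != 0 -> exists t, t * (s * e x) = e x) -> semisimple_ring R.
Proof.
move=> eM e1 ec einv N [N0 Nlin].
have NZ a u : N u -> N (a * u) by move=> Nu; have := Nlin a u 0 Nu N0; rewrite addr0.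
have ND u v : N u -> N v -> N (u + v).
  by move=> Nu Nv; have := Nlin 1 u v Nu Nv; rewrite scale1r.
have sumE m : m = \sum_x m * e x by rewrite -mulr_sumr e1 mulr1.
exists (fun m : R^o => forall x, N (e x) -> (m : R) * e x = 0); split.
- split=> [x _|a u v hu hv x Nx]; first by rewrite mul0r.
  by rewrite mulrDl hv // addr0 -mulrA hu // mulr0.
- move=> m; exists (\sum_(x | `[< N (e x) >]) (m : R) * e x).
  exists (\sum_(x | ~~ `[< N (e x) >]) (m : R) * e x); split.
  + by apply: (big_ind N) => // x /asboolP Nx; apply: NZ.
  + move=> x Nx; rewrite mulr_suml big1 // => y nNy; rewrite -mulrA eM.
    by case: eqP => [eyx|_]; rewrite ?mulr0 //; case/asboolP: nNy; rewrite eyx.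
  + by rewrite {1}[m]sumE (bigID (fun x => `[< N (e x) >])).
move=> m Nm hm; rewrite [m]sumE big1 // => x _; apply/eqP; apply: contraT => nz.
have [t et] := einv _ _ nz; case/eqP: nz; apply: hm.
by rewrite -et ec; apply: (NZ t); apply: (NZ (e x)).
Qed.

Section GradedRingFacts.
Variable A : gradedRing.
Local Notation gA := (gr_grading A).

Lemma gr_pr_mulr0 j (a b : A) : b \in homog (@gr_pr A) 0 ->
  gr_pr j (a * b) = gr_pr j a * b.
Proof.
move=> hb; have [s us es] := grad_sum gA a.
rewrite [in LHS]es [in RHS]es !(grad_bigsum gA) !mulr_suml (grad_bigsum gA).
apply: eq_bigr => i _; rewrite -[in LHS](homogE hb) gr_prM addn0 (gradK gA) (homogE hb).
by case: eqP => // _; rewrite mul0r.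
Qed.

Lemma gr_sum_over (a : A) (s S : seq nat) : uniq s -> a = \sum_(i <- s) gr_pr i a ->
  uniq S -> {subset s <= S} -> a = \sum_(i <- S) gr_pr i a.
Proof.
move=> us es uS sS; rewrite {1}es [RHS](bigID (fun i => i \in s)) /= [X in _ = _ + X]big1 => [|i ni].
  rewrite addr0 -[RHS]big_filter; apply: perm_big; apply: uniq_perm; rewrite ?filter_uniq //.
  by move=> i; rewrite mem_filter; case: (boolP (i \in s)) => // /sS ->.
rewrite es (grad_bigsum gA) big_seq big1 // => k ks; rewrite (gradK gA).
by case: eqP => // eik; rewrite eik ks in ni.
Qed.

End GradedRingFacts.

Section RelativelyFree.
Variables (A : gradedRing) (I : finType) (E : I -> I -> A) (n : nat).
Hypothesis E0 : forall i j, E i j \in homog (@gr_pr A) 0.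
Local Notation gA := (gr_grading A).

(** The left A-module of the row vectors f with f = f E. When E is idempotent
    this is a projective module. *)
Definition rf_pred : {pred {ffun I -> A^o}} :=
  fun f => f == [ffun k => \sum_i (f i : A) * E i k].

Fact rf_submod : submod_closed rf_pred.
Proof.
split=> [|a u v]; rewrite !unfold_in.
  by apply/eqP/ffunP => k; rewrite !ffunE big1 // => i _; rewrite ffunE mul0r.
move=> /eqP hu /eqP hv; apply/eqP/ffunP => k; rewrite {1}hu {1}hv !ffunE scaler_sumr.
by rewrite -big_split; apply: eq_bigr => i _; rewrite !ffunE mulrDl /= -mulrA.
Qed.

Definition rf := {f : {ffun I -> A^o} | f \in rf_pred}.
HB.instance Definition _ := SubChoice.on rf.
HB.instance Definition _ :=
  GRing.SubChoice_isSubLmodule.Build A _ rf_pred rf rf_submod.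

Definition rfv (f : rf) (i : I) : A := val f i.

Lemma rfE (f : rf) k : rfv f k = \sum_i rfv f i * E i k.
Proof. by rewrite {1}/rfv (eqP (valP f)) ffunE. Qed.

Lemma rf_inj (f g : rf) : rfv f =1 rfv g -> f = g.
Proof. by move=> h; apply/val_inj/ffunP. Qed.

Lemma rf_exists (h : I -> A) : (forall k, h k = \sum_i h i * E i k) ->
  exists f : rf, rfv f =1 h.
Proof.
move=> hh; have hf : [ffun i => h i : A^o] \in rf_pred.
  rewrite unfold_in; apply/eqP/ffunP => k; rewrite !ffunE hh.
  by apply: eq_bigr => i _; rewrite ffunE.
by pose f : rf := exist (fun f => f \in rf_pred) _ hf; exists f => i; rewrite /rfv ffunE.
Qed.

(** The component of degree m, for generators placed in degree n: below n there
    is nothing, and otherwise the entries have degree m - n. *)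
Definition rf_prv (m : int) (f : rf) (k : I) : A :=
  if (n%:Z <= m)%R then gr_pr (absz (m - n%:Z)) (rfv f k) else 0.

Fact rf_pr_subproof m f : [ffun k => rf_prv m f k : A^o] \in rf_pred.
Proof.
rewrite unfold_in; apply/eqP/ffunP => k; rewrite !ffunE /rf_prv.
under eq_bigr => i _ do rewrite ffunE.
case: ifP => _; last by rewrite big1 // => i _; rewrite mul0r.
rewrite {1}rfE (grad_bigsum gA); apply: eq_bigr => i _.
by rewrite gr_pr_mulr0.
Qed.

Definition rf_pr m f : rf := exist (fun f => f \in rf_pred) _ (rf_pr_subproof m f).

Lemma rf_prE m f k : rfv (rf_pr m f) k = rf_prv m f k.
Proof. by rewrite /rfv ffunE. Qed.

Lemma rfvB f g k : rfv (f - g) k = rfv f k - rfv g k.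
Proof. by rewrite /rfv raddfB !ffunE. Qed.

Lemma rfvD f g k : rfv (f + g) k = rfv f k + rfv g k.
Proof. by rewrite /rfv raddfD !ffunE. Qed.

Lemma rfv0 k : rfv 0 k = 0.
Proof. by rewrite /rfv raddf0 ffunE. Qed.

Lemma rfvZ a f k : rfv (a *: f) k = a * rfv f k.
Proof. by rewrite /rfv linearZ ffunE. Qed.

Lemma rfv_sum (J : Type) (r : seq J) (P : pred J) (F : J -> rf) k :
  rfv (\sum_(j <- r | P j) F j) k = \sum_(j <- r | P j) rfv (F j) k.
Proof. by rewrite (big_morph (rfv^~ k) (fun f g => rfvD f g k) (rfv0 k)). Qed.

Fact rf_grading : is_grading rf_pr.
Proof.
split=> [m u v|i j v|v].
- apply: rf_inj => k; rewrite rfvB !rf_prE /rf_prv; case: ifP => _.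
    by rewrite rfvB (gradB gA).
  by rewrite subrr.
- apply: rf_inj => k; rewrite (fun_if (rfv^~ k)) !rf_prE rfv0 /rf_prv !rf_prE /rf_prv.
  case: (leP n%:Z i) => ni; case: (leP n%:Z j) => nj; rewrite ?(grad0 gA) ?if_same //.
    rewrite (gradK gA); congr (if _ then _ else _).
    by lia.
  by have [e|//] := eqVneq i j; lia.
have hS k : exists s : seq nat, uniq s /\ rfv v k = \sum_(i <- s) gr_pr i (rfv v k).
  by have [s us es] := grad_sum gA (rfv v k); exists s.
have /choice[S HS] := hS; pose T := undup (flatten [seq S k | k <- enum I]).
have uT : uniq T by apply: undup_uniq.
exists [seq (n%:Z + j%:Z)%R | j <- T].
  by rewrite map_inj_uniq // => a b; lia.
apply: rf_inj => k; rewrite rfv_sum big_map.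
rewrite {1}(gr_sum_over (HS k).1 (HS k).2 uT) => [|i ik].
  apply: eq_bigr => j _; rewrite rf_prE /rf_prv ifT; last lia.
  by congr gr_pr; lia.
by rewrite mem_undup; apply/flattenP; exists (S k); rewrite ?map_f ?mem_enum.
Qed.

Lemma rf_homog_lowP m f : (m < n%:Z)%R -> f \in homog rf_pr m -> f = 0.
Proof.
move=> lt /homogE <-; apply: rf_inj => k; rewrite rf_prE rfv0 /rf_prv.
by rewrite leNgt lt.
Qed.

Lemma rf_homogP (j : nat) f : f \in homog rf_pr (n + j)%:Z <->
  forall k, rfv f k \in homog (@gr_pr A) j.
Proof.
have e k : rfv (rf_pr (n + j)%:Z f) k = gr_pr j (rfv f k).
  by rewrite rf_prE /rf_prv ifT; [congr gr_pr; lia | lia].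
rewrite [f \in _]unfold_in /homog; split=> [/eqP h k|h].
  by rewrite unfold_in -e h.
by apply/eqP/rf_inj => k; rewrite e (homogE (h k)).
Qed.

Lemma int_shift (m : int) : (n%:Z <= m)%R -> exists j : nat, m = (n + j)%:Z.
Proof. by move=> le; exists (absz (m - n%:Z)); lia. Qed.

Fact rf_scale (i : nat) (m : int) (a : A) (f : rf) :
  a \in homog (@gr_pr A) i -> f \in homog rf_pr m -> a *: f \in homog rf_pr (i%:Z + m).
Proof.
move=> ha hf; case: (ltP m n%:Z) => [lt|/int_shift[j em]].
  by rewrite (rf_homog_lowP lt hf) scaler0 unfold_in /homog (grad0 rf_grading).
rewrite em in hf *; have -> : (i%:Z + (n + j)%:Z = (n + (i + j))%:Z)%R by lia.
move/rf_homogP: hf => hf; apply/rf_homogP => k; rewrite rfvZ; exact: gr_mul.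
Qed.

Definition rf_gmod : gradedModule A := GradedModule rf_grading rf_scale.

Hypothesis Eid : forall i k, \sum_j E i j * E j k = E i k.

(** The rows of an idempotent matrix generate, and the coordinates are the dual
    basis. *)
Lemma rf_graded_basis : has_graded_basis rf_gmod n.
Proof.
have /choice[b hb] : forall i, exists f : rf, rfv f =1 E i.
  by move=> i; apply: rf_exists => k; rewrite Eid.
exists I, (b : I -> rf_gmod), (fun i (f : rf_gmod) => rfv (f : rf) i); split.
- by move=> i; rewrite -[n]addn0; apply/rf_homogP => k; rewrite hb.
- by move=> i a u v; rewrite rfvD rfvZ.
- by move=> i j f /rf_homogP.
move=> f; apply: rf_inj => k; rewrite rfv_sum {1}rfE; apply: eq_bigr => i _.
by rewrite rfvZ hb.
Qed.

End RelativelyFree.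

Lemma rf_map_exists (A : gradedRing) (I J : finType) (E : I -> I -> A) (F : J -> J -> A)
    (M : I -> J -> A) :
  (forall f : rf E, forall k, \sum_i rfv f i * M i k =
     \sum_j (\sum_i rfv f i * M i j) * F j k) ->
  exists g : {linear rf E -> rf F}, forall f j, rfv (g f) j = \sum_i rfv f i * M i j.
Proof.
move=> hM; have /choice[g hg] : forall f : rf E, exists g : rf F,
    rfv g =1 fun j => \sum_i rfv f i * M i j.
  by move=> f; apply: rf_exists => k; apply: hM.
have [|h eh] := @linear_exists A (rf E) (rf F) g.
  move=> a u v; apply: rf_inj => k; rewrite rfvD rfvZ !hg mulr_sumr -big_split.
  by apply: eq_bigr => i _; rewrite rfvD rfvZ mulrDl mulrA.
by exists h => f j; rewrite eh hg.
Qed.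

Lemma rf_augmentation_exists (A : gradedRing) (I : finType) (E : I -> I -> A) :
  exists g : {linear rf E -> deg0 A}, forall f, val (g f) = \sum_i gr_pr 0 (rfv f i).
Proof.
have gA := gr_grading A.
have h0 (f : rf E) : \sum_i gr_pr 0 (rfv f i) \in homog (@gr_pr A) 0.
  by rewrite -(grad_bigsum gA); apply: homogP.
have [|h eh] := @linear_exists A (rf E) (deg0 A) (fun f => exist (fun a => a \in deg0_pred (A := A)) _ (h0 f)).
  move=> a u v; apply: val_inj; rewrite /= mulr_sumr -big_split.
  by apply: eq_bigr => i _; rewrite rfvD rfvZ (gradD gA) deg0_prM.
by exists h => f; rewrite eh.
Qed.

Lemma deg0_semisimple (A : gradedRing) (V : finType) (e : V -> A) :
  (forall x, e x \in homog (@gr_pr A) 0) ->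
  (forall x y, e x * e y = if x == y then e x else 0) -> \sum_x e x = 1 ->
  (forall s x, s \in homog (@gr_pr A) 0 -> s * e x = e x * s) ->
  (forall s x, s \in homog (@gr_pr A) 0 -> s * e x != 0 ->
     exists2 t, t \in homog (@gr_pr A) 0 & t * (s * e x) = e x) ->
  semisimple_ring (deg0 A).
Proof.
move=> e0 eM e1 ec einv.
pose e' x : deg0 A := exist (fun a => a \in deg0_pred (A := A)) _ (e0 x).
have valM (s t : deg0 A) : val (s * t) = val s * val t by [].
apply: (@semisimple_of_idempotents (deg0 A) V e').
- move=> x y; apply: val_inj; rewrite valM (fun_if val); exact: eM.
- by apply: val_inj; rewrite raddf_sum; exact: e1.
- move=> s x; apply: val_inj; rewrite !valM; exact: ec (valP s).
move=> s x nz; have [|t ht et] := einv (val s) x (valP s).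
  by apply: contraNneq nz => z; apply/eqP/val_inj; rewrite valM.
exists (exist (fun a => a \in deg0_pred (A := A)) _ ht); apply: val_inj.
by rewrite !valM.
Qed.

(** * Coefficients in a basis algebra, and the lowest degrees of the Koszul complex *)

Section BasisCoefficients.
Variables (K : fieldType) (V : finType) (B : basis V).
Local Notation A := (basis_gradedRing K B).
Implicit Types (f g : balg K B) (a b c : B).

Lemma mcoeff_bgen (o : option B) c : (bgen K o)@_c = (o == Some c)%:R.
Proof.
case: o => [b|] /=; last by rewrite mcoeff0.
by rewrite mcoeffU; congr (_%:R); case: eqP => [->|ne]; rewrite ?eqxx //; case: eqP => // -[].
Qed.

Lemma bmul_coef f g (D : {fset B}) c : (msupp g `<=` D)%fset ->
  (f * g)@_c = \sum_(a <- msupp f) \sum_(b <- D) f@_a * g@_b * (bs_mul a b == Some c)%:R.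
Proof.
move=> le; rewrite [f * g]/(bmul f g) raddf_sum; apply: eq_bigr => a _ /=.
rewrite raddf_sum (big_fset_incl _ le) /= => [|b _ /mcoeff_outdom->].
  by apply: eq_bigr => b _; rewrite mcoeffZ mcoeff_bgen.
by rewrite mulr0 scale0r mcoeff0.
Qed.

Lemma bmul_gen_r f k b c : (f * (k *: << b >>))@_c =
  k * \sum_(a <- msupp f) f@_a * (bs_mul a b == Some c)%:R.
Proof.
rewrite (@bmul_coef _ _ [fset b]%fset); last first.
  apply: fsubset_trans (msuppZ_le _ _) _; exact: msuppU_le.
rewrite mulr_sumr; apply: eq_bigr => a _; rewrite big_seq_fset1 mcoeffZ mcoeffUU mulr1.
by rewrite [_ * k]mulrC -mulrA.
Qed.

Lemma bmul_gen_l g b c : ((<< b >> : balg K B) * g)@_c =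
  \sum_(a <- msupp g) g@_a * (bs_mul b a == Some c)%:R.
Proof.
have eU : (<< b >> : balg K B) = 1 *: << b >> by rewrite scale1r.
rewrite (@bmul_coef _ _ (msupp g)) // (big_fset_incl _ (msuppU_le : msupp << b >> `<=` [fset b])%fset) /=.
  by rewrite big_seq_fset1; apply: eq_bigr => a _; rewrite mcoeffUU mul1r.
by move=> a _ /mcoeff_outdom->; rewrite big1 // => b' _; rewrite !mul0r.
Qed.

Lemma sum_msupp1 f (P : pred B) a0 : P =1 pred1 a0 ->
  \sum_(a <- msupp f) f@_a * (P a)%:R = f@_a0.
Proof.
move=> hP; case: (msuppP f a0) => [ha|ha].
  rewrite (big_fsetD1 _ ha) /= hP /= eqxx mulr1 big1_fset ?addr0 // => b.
  by rewrite in_fsetD1 hP /= => /andP[/negbTE-> _] _; rewrite mulr0.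
rewrite big1_fset // => b hb _; rewrite hP /=; case: eqP => [e|]; last by rewrite mulr0.
by rewrite e (negbTE ha) in hb.
Qed.

Lemma sum_msupp0 f (P : pred B) : P =1 pred0 ->
  \sum_(a <- msupp f) f@_a * (P a)%:R = 0.
Proof. by move=> hP; rewrite big1 // => a _; rewrite hP mulr0. Qed.

Lemma basis_homogP n (f : A) : f \in homog (@gr_pr A) n <->
  forall a, bs_deg a != n -> (f : balg K B)@_a = 0.
Proof.
rewrite unfold_in /homog; split=> [/eqP <- a /negbTE na | h].
  by rewrite [LHS]bprE na.
by apply/eqP/malgP => a; rewrite [LHS]bprE; case: eqP => // /eqP /h ->.
Qed.

End BasisCoefficients.

Section MoreKoszul.
Variables (K : fieldType) (V : finType) (d : V -> V -> option nat).
Hypothesis dM : is_metric d.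
Local Notation kap := (koszul_diff d).
Local Notation koszul_cycle := (koszul_cycle d).
Local Notation fc := (face d).
Implicit Types (g h : seq V -> V -> K).

Lemma kap_neq0 g y z : kap g y z != 0 ->
  exists2 v, koszul_step d y v z & g (rcons y v) z != 0.
Proof.
move=> nz; have [v hv] : exists v, (koszul_step d y v z)%:R * g (rcons y v) z != 0.
  apply/existsP; apply: contraNT nz; rewrite negb_exists => /forallP h.
  by apply/eqP/big1 => v _; apply/eqP; have := h v; rewrite negbK.
by exists v; case: koszul_step hv; rewrite ?mul1r ?mul0r ?eqxx.
Qed.

Lemma kap_cycle k g : koszul_cycle k.+1 g -> koszul_cycle k (kap g).
Proof.
case=> gs g0; split=> [y z /kap_neq0[v st nz]|i y z].
  have [sv us _] := gs _ _ nz; split; first by move: sv; rewrite size_rcons => -[].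
    by have := sorted_take (size y) us; rewrite -cats1 take_size_cat.
  by case/and3P: st.
have [lt|le] := ltnP i.+1 (size y); last exact: face_oversize.
have -> : fc i ((kap g)^~ z) y =
    \sum_v (koszul_step d y v z)%:R * fc i (fun t => g (rcons t v) z) y.
  under [RHS]eq_bigr => v _ do rewrite -faceZ.
  rewrite -face_sum; apply: face_ext => p x w q u ey _ _; apply: eq_bigr => v _ /=.
  have e w' : dist_last d (p ++ [:: x, u, w & q]) w' = dist_last d y w'.
    rewrite ey; apply: dist_last_eq; rewrite ?size_cat ?addnS //.
    by move=> x0; rewrite !last_cat.
  by rewrite /koszul_step !e.
rewrite big1 // => v _; rewrite -(@face_extended _ _ _ _ _ [:: v] (g^~ z)) ?g0 ?mulr0 //.
by move=> t _ _; rewrite cats1.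
Qed.

(** Two successive steps from x to w along a geodesic to z form an insertion
    between x and w, so the composite contains an inner face of g. *)
Lemma kap_kap k g y z : koszul_cycle k.+2 g -> kap (kap g) y z = 0.
Proof.
case=> gs g0; case/lastP: y => [|p x]; first by apply: big1 => v _; rewrite mul0r.
rewrite /koszul_diff; under eq_bigr => v _ do rewrite mulr_sumr.
rewrite exchange_big /= big1 // => w _.
(* For w two steps closer to z than x, all the middle vertices are geodesic
   steps; otherwise there is no term at all. *)
pose far := if d w z is Some m then d x z == Some m.+2 else false.
apply: etrans (_ : far%:R * fc (size p) (g^~ z) (p ++ [:: x; w]) = 0); last first.
  by rewrite g0 mulr0.
rewrite face_cat mulr_sumr.
apply: eq_bigr => v _; rewrite !mulrA.
have -> : rcons (rcons (rcons p x) v) w = p ++ [:: x; v; w] by rewrite -!cats1 -!catA.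
have [->|nz] := eqVneq (g (p ++ [:: x; v; w]) z) 0; first by rewrite !mulr0.
congr (_ * _); rewrite -!natrM !mulnb; congr ((nat_of_bool _)%:R).
have [_ us _] := gs _ _ nz.
have /eqP uxv : unit_step d x v by have /andP[] := sorted_cat_cons us.
have /eqP uvw : unit_step d v w.
  by move: us; rewrite -cat_rcons => /sorted_cat_cons/andP[].
rewrite /koszul_step !dist_last_rcons uxv uvw /= /far.
apply/idP/idP.
  case/and3P=> /andP[nxz /eqP exz] nvz /eqP evz; move: exz; rewrite evz.
  case ewz: (d w z) => [m|] //= exz; last by rewrite exz in nxz.
  rewrite exz eqxx /=; apply/betweenP => //; exists 0%N, 0%N; split=> //.
  have [c exw le] := metric_triangle dM uxv uvw.
  have [c' exz' le'] := metric_triangle dM exw ewz.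
  by rewrite exw; congr Some; move: exz'; rewrite exz => -[]; lia.
case ewz: (d w z) => [m|] //= /andP[/eqP exz bt]; rewrite exz /=.
have [c evz le] := metric_triangle dM uvw ewz.
have [c' exz' le'] := metric_triangle dM uxv evz.
move: exz'; rewrite exz => -[ec]; rewrite evz /=.
have -> : c = m.+1 by lia.
by rewrite !add1n !eqxx.
Qed.

(** When z is one step away, that step is the only geodesic. *)
Lemma kap_degenerate g y z : dist_last d y z = Some 1%N ->
  kap g y z = g (rcons y z) z.
Proof.
move=> e; rewrite /koszul_diff (bigD1 z) //= big1 => [|v nv].
  by rewrite /koszul_step e (proj2 (metric_eq0 dM z z)) //= mul1r addr0.
rewrite /koszul_step e /=; case ev: (d v z) => [[|m]|] /=; rewrite ?andbF ?mul0r //.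
by case/eqP: nv; apply/(metric_eq0 dM).
Qed.

(** Vertices carry no relations, so it suffices to choose one geodesic step for
    each pair. *)
Lemma koszul_exact0 g : koszul_cycle 0 g ->
  (forall y z, g y z != 0 -> dist_last d y z != Some 0%N) ->
  exists h, koszul_cycle 1 h /\ forall y z, kap h y z = g y z.
Proof.
case=> gs g0 nd.
pose pk x z := [pick v | unit_step d x v && (d x z == oaddn (Some 1%N) (d v z))].
pose h y z := if y is [:: x; v] then if pk x z == Some v then g [:: x] z else 0 else 0.
have hs y z : h y z != 0 -> exists x v, [/\ y = [:: x; v], pk x z = Some v & g [:: x] z != 0].
  case: y => [|x [|v [|w y]]]; rewrite /h ?eqxx //.
  by case: ifP => [/eqP e nz|]; [exists x, v | rewrite eqxx].
have pkP x z v : pk x z = Some v -> unit_step d x v /\ d x z = oaddn (Some 1%N) (d v z).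
  by rewrite /pk; case: pickP => // w /andP[u /eqP e] [<-].
exists h; split; first split.
- move=> y z /hs[x [v [-> /pkP[u e] nz]]]; split=> //=; first by rewrite u.
  have [_ _ /=] := gs _ _ nz; rewrite e; by case: (d v z).
- move=> i y z; have [lt|le] := ltnP i.+1 (size y); last exact: face_oversize.
  apply: face_eq0 => p x w q v ey _ _; rewrite ey in lt *.
  by case: p lt {ey} => [|a [|b [|p']]] //=; case: q.
- move=> y z; case: y => [|x [|w y]].
  + rewrite [LHS]big1 => [|v _]; last by rewrite mul0r.
    by apply/esym/eqP; apply: contraT => /gs[].
  + case e: (pk x z) => [v|]; last first.
      rewrite [LHS]big1 => [|v _]; last by rewrite /= e mulr0.
      apply/esym/eqP; apply: contraT => nz; have [_ _ /=] := gs _ _ nz.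
      case exz: (d x z) => [[|m]|//] _; first by have := nd _ _ nz; rewrite /= exz eqxx.
      have [v /eqP u ev] := metric_geodesic dM exz.
      move: e; rewrite /pk; case: pickP => // /(_ v); rewrite /unit_step u exz ev /=.
      by rewrite add1n eqxx.
    have [u exz] := pkP _ _ _ e; rewrite /koszul_diff (bigD1 v) //= big1 => [|v' nv].
      rewrite e eqxx addr0; have [->|nz] := eqVneq (g [:: x] z) 0; first by rewrite mulr0.
      have [_ _ /= nN] := gs _ _ nz.
      suff -> : koszul_step d [:: x] v z by rewrite mul1r.
      by rewrite /koszul_step /dist_last /last (eqP u) -exz !eqxx andbT.
    by rewrite e; case: eqP => [[ev]|]; [rewrite ev eqxx in nv | rewrite mulr0].
  rewrite [LHS]big1 => [|v _].
    by apply/esym/eqP; apply: contraT => /gs[].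
  by rewrite /h /=; case: y => [|? ?]; rewrite mulr0.
Qed.

Lemma koszul_exact_all : (forall k g, koszul_cycle k.+1 g -> (forall y z, kap g y z = 0) ->
    exists h, koszul_cycle k.+2 h /\ forall y z, kap h y z = g y z) ->
  forall L k, @koszul_exact_below K V d L k.
Proof.
move=> EX L [|k] g gK gL kg; last exact: EX.
by apply: koszul_exact0 => // y z /gL[m -> _].
Qed.

End MoreKoszul.

(** * Functions killed by the faces, and the distance algebra *)

Section CycleSpaces.
Variables (K : fieldType) (V : finType) (d : V -> V -> option nat).
Local Notation fc := (face d).
Implicit Types (x y v : V).

Definition lastt n (p : n.+1.-tuple V) : V := tnth p ord_max.

Lemma last_tuple n (p : n.+1.-tuple V) x0 : last x0 p = lastt p.
Proof. by rewrite /lastt (tnth_nth x0) -nth_last size_tuple. Qed.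

(** Functions on tuples of a fixed size, viewed on sequences, where faces are
    defined. *)
Definition extend n (w : n.-tuple V -> K) (s : seq V) : K :=
  if insub s is Some p then w p else 0.

Lemma extendE n (w : n.-tuple V -> K) (p : n.-tuple V) : extend w p = w p.
Proof. by rewrite /extend valK. Qed.

Lemma extend_out n (w : n.-tuple V -> K) s : size s != n -> extend w s = 0.
Proof. by move=> ns; rewrite /extend insubN. Qed.

(** The space N_n: functions supported on paths with n arrows and killed by the
    faces. *)
Definition cyc n (w : n.+1.-tuple V -> K) :=
  (forall p, w p != 0 -> sorted (unit_step d) p) /\ forall i s, fc i (extend w) s = 0.

(** Finitely many linear equations for this space, needed to apply the results
    on finite systems. *)
Definition cyc_condition n (c : n.+1.-tuple V + 'I_n * n.-tuple V) (w : n.+1.-tuple V -> K) : K :=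
  match c with
  | inl p => if sorted (unit_step d) p then 0 else w p
  | inr (i, s) => fc i (extend w) s
  end.

Lemma cyc_condition_linear n (c : n.+1.-tuple V + 'I_n * n.-tuple V) :
  linear_functional (cyc_condition c).
Proof.
move=> a u v; case: c => [p|[i s]] /=; first by case: ifP; rewrite ?mulr0 ?addr0.
rewrite -face_linear; congr face; apply/funext => t.
by rewrite /extend; case: insub => //; rewrite mulr0 addr0.
Qed.

Lemma cycP n (w : n.+1.-tuple V -> K) : cyc w <-> forall c, cyc_condition c w = 0.
Proof.
split=> [[us w0] [p|[i s]]|h] /=; last first.
- split=> [p nz|i s]; first by have := h (inl p); rewrite /=; case: ifP => // _ e; rewrite e eqxx in nz.
  have [es|ns] := eqVneq (size s) n; last first.
    by apply: face_eq0 => p x y q v e _ _; apply: extend_out; move: ns; rewrite e !size_cat /= !addnS.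
  have [lt|ge] := ltnP i n; last by apply: face_oversize; rewrite es ltnW.
  have ss : size s == n by apply/eqP.
  exact: (h (inr (Ordinal lt, Tuple ss))).
- exact: w0.
- by case: ifPn => // nu; apply/eqP; apply: contraNT nu; apply: us.
Qed.

Lemma cyc_filter n (w : n.+1.-tuple V -> K) (P : pred V) : cyc w ->
  cyc (fun p => if P (lastt p) then w p else 0).
Proof.
case=> us w0; split=> [p|i s]; first by case: ifP => _; [apply: us | rewrite eqxx].
case: s => [|y s]; first by rewrite face_oversize.
rewrite -[RHS](mulr0 (P (last y s))%:R) -(w0 i (y :: s)) -faceZ; apply: face_ext => p a b q v es _ _.
rewrite /extend; case: insubP => [t _ et|_]; last by rewrite mulr0.
rewrite -(last_tuple t y) et !last_cat /=.
have -> : last b q = last y s.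
  by have := congr1 (last y) es; rewrite /= last_cat /= => ->.
by case: ifP; rewrite ?mul1r ?mul0r.
Qed.

Lemma cyc_fiber n (w : n.+1.-tuple V -> K) x : cyc w ->
  cyc (fun p => if lastt p == x then w p else 0).
Proof. exact: (@cyc_filter n w (pred1 x)). Qed.

Lemma cyc_sum n (J : finType) (a : J -> K) (w : J -> n.+1.-tuple V -> K) :
  (forall j, cyc (w j)) -> cyc (fun p => \sum_j a j * w j p).
Proof.
move=> hw; apply/cycP => c.
have lin := cyc_condition_linear c.
have aux (r : seq J) : cyc_condition c (fun p => \sum_(j <- r) a j * w j p) = 0.
  elim: r => [|j r IHr].
    rewrite -[RHS](linear_functional0 lin); congr cyc_condition.
    by apply/funext => p; rewrite big_nil.
  rewrite -[RHS](_ : a j * cyc_condition c (w j) + 0 = 0); last first.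
    by rewrite (proj1 (cycP _) (hw j)) mulr0 addr0.
  rewrite -[X in _ + X]IHr -lin; congr cyc_condition.
  by apply/funext => p; rewrite big_cons.
exact: aux.
Qed.

(** Faces do not move the end of a path, so the projection can be taken to
    preserve it. *)
Lemma cycle_projector n : exists e : n.+1.-tuple V -> n.+1.-tuple V -> K,
  [/\ forall p q, lastt p != lastt q -> e p q = 0, forall p, cyc (e p)
    & forall w, cyc w -> forall q, \sum_p w p * e p q = w q].
Proof.
have [e [e0 eP]] := projector_exists (@cyc_condition_linear n).
have ce p : cyc (e p) by apply/cycP => c; apply: e0.
exists (fun p q => if lastt q == lastt p then e p q else 0); split.
- by move=> p q; rewrite eq_sym; case: eqP.
- by move=> p; apply: cyc_fiber.
move=> w cw q; have cw' := cyc_fiber (lastt q) cw.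
have := eP _ (proj1 (cycP _) cw') q; rewrite eqxx => e1; rewrite -[RHS]e1.
by apply: eq_bigr => p _; rewrite eq_sym; case: ifP; rewrite ?mulr0 ?mul0r.
Qed.

Lemma cyc_koszul_cycle n (g : seq V -> V -> K) : koszul_cycle d n g ->
  forall z, cyc (fun p : n.+1.-tuple V => g p z).
Proof.
case=> gs g0 z; split=> [p /gs[]//|i s].
rewrite -(g0 i s z); apply: face_ext => p x y q v es _ _.
have [e|ne] := eqVneq (size (p ++ [:: x, v, y & q])) n.+1.
  have st : size (p ++ [:: x, v, y & q]) == n.+1 by apply/eqP.
  by rewrite -[p ++ _]/(val (Tuple st)) extendE.
by rewrite extend_out //; apply/esym/eqP; apply: contraNT ne => /gs[/eqP].
Qed.

End CycleSpaces.

Section DistanceAlgebra.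
Variables (G : digraph) (K : fieldType).
Local Notation B := (distance_basis G).
Local Notation A := (distance_algebra G K).
Local Notation dT := (transpose (@dist G)).
Implicit Types (f g : A) (x y z v w : G).

(** Coefficients are indexed by all pairs of vertices, with zero at infinite
    distance, which spares the basis elements and their proofs in
    computations. *)
Definition coef f x y : K := if insub (x, y) is Some a then (f : balg K B)@_(a : B) else 0.

Lemma coE f (a : dpair G) : coef f (dsrc a) (dtgt a) = (f : balg K B)@_(a : B).
Proof. by rewrite /coef /dsrc /dtgt -surjective_pairing valK. Qed.

Lemma co_inj f g : (forall x y, coef f x y = coef g x y) -> f = g.
Proof. by move=> h; apply/malgP => a; rewrite -!coE. Qed.

Lemma co_fin f x y : coef f x y != 0 -> dist x y != None.
Proof.
rewrite /coef; case: insubP => [a /= cxy _ _|_]; last by rewrite eqxx.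
by move: cxy; rewrite dist_connect; case: dist.
Qed.

Lemma coP f x y (a : dpair G) : dsrc a = x -> dtgt a = y -> coef f x y = (f : balg K B)@_(a : B).
Proof. by move=> <- <-; rewrite coE. Qed.

Lemma dpair_exists x y : dist x y != None -> exists a : dpair G, dsrc a = x /\ dtgt a = y.
Proof.
move=> fxy; have cxy : connect (@arrow G) x y by rewrite dist_connect; case: dist fxy.
by exists (Sub (x, y) cxy : dpair G).
Qed.

Lemma dpair_eq (a b : dpair G) : dsrc a = dsrc b -> dtgt a = dtgt b -> a = b.
Proof.
move=> e1 e2; apply: val_inj; rewrite [LHS]surjective_pairing [RHS]surjective_pairing.
by congr (_, _).
Qed.

Lemma co_cases x y (P : Prop) : (dist x y = None -> P) ->
  (forall a : dpair G, dsrc a = x -> dtgt a = y -> P) -> P.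
Proof.
move=> h1 h2; have [e|/dpair_exists[a [ea eb]]] := eqVneq (dist x y) None; first exact: h1.
exact: h2 ea eb.
Qed.

Lemma co_inf f x y : dist x y = None -> coef f x y = 0.
Proof. by move=> e; apply/eqP; apply: contraT => /co_fin; rewrite e. Qed.

Lemma coD f g x y : coef (f + g) x y = coef f x y + coef g x y.
Proof. by rewrite /coef; case: insub => [a|]; rewrite ?mcoeffD ?addr0. Qed.

Lemma co0 x y : coef 0 x y = 0.
Proof. by rewrite /coef; case: insub => [a|] //; rewrite mcoeff0. Qed.

Lemma co_sum (J : Type) (r : seq J) (P : pred J) (F : J -> A) x y :
  coef (\sum_(j <- r | P j) F j) x y = \sum_(j <- r | P j) coef (F j) x y.
Proof. exact: (big_morph (fun f => coef f x y) (fun f g => coD f g x y) (co0 x y)). Qed.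

Definition vtx x : A := << bs_id B x >>.
Definition svtx (k : K) x : A := (k *: << bs_id B x >> : balg K B).
Definition edge (k : K) x y : A := (k *: bgen K (insub (x, y) : option B) : balg K B).

Lemma svtx1 x : svtx 1 x = vtx x.
Proof. exact: scale1r. Qed.

Lemma co_edge k u v x y : coef (edge k u v) x y =
  if [&& x == u, y == v & dist x y != None] then k else 0.
Proof.
apply: (@co_cases x y) => [e|a ea eb]; first by rewrite co_inf // e /= !andbF.
rewrite (coP _ ea eb) mcoeffZ mcoeff_bgen.
have -> : dist x y != None by rewrite -ea -eb dpair_dist.
rewrite andbT; case: insubP => [b _ eb'|nc].
  rewrite -[Some b == Some a]/(b == a).
  have -> : (b == a) = (x == u) && (y == v).
    rewrite -val_eqE eb' -ea -eb /dsrc /dtgt eq_sym; case: (val a) => a1 a2.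
    by rewrite -pair_eqE.
  by case: (_ && _); rewrite ?mulr1 ?mulr0.
rewrite mulr0; case: andP => // -[/eqP e1 /eqP e2]; case/negP: nc.
by rewrite -e1 -e2 -ea -eb; apply: (valP a).
Qed.

Lemma co_svtx k v x y : coef (svtx k v) x y = if (x == v) && (y == v) then k else 0.
Proof.
have e : svtx k v = edge k v v.
  by rewrite /edge insubT /=; first exact: connect0; move=> c; congr (_ *: << _ >>); apply: val_inj.
rewrite e co_edge andbA; congr (if _ then _ else _).
have [->|] := eqVneq x v; last by rewrite !andFb.
have [->|] := eqVneq y v; last by rewrite !andbF.
by rewrite dist_xx.
Qed.

Lemma co_mul_svtx f k v x y : coef (f * svtx k v) x y = if y == v then k * coef f x y else 0.
Proof.
apply: (@co_cases x y) => [e|a ea eb].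
  by rewrite !co_inf // mulr0 if_same.
rewrite !(coP _ ea eb) [LHS]bmul_gen_r; case: eqP => [eyv|nyv].
  rewrite (sum_msupp1 _ (P := fun c => bs_mul c (bs_id B v) == Some a) (a0 := a)) //.
  move=> c /=; rewrite dpair_mul1r; case: (dtgt c =P v) => [_|nc].
    by apply/idP/idP => /eqP; [case=> -> | move=> ->]; rewrite eqxx.
  by apply/esym/negbTE/eqP => eca; case: nc; rewrite eca eb eyv.
rewrite (sum_msupp0 _ (P := fun c => bs_mul c (bs_id B v) == Some a)) ?mulr0 // => c /=.
rewrite dpair_mul1r; case: (dtgt c =P v) => // ec; apply/negbTE/eqP => -[eca]; case: nyv.
by rewrite -eb -eca.
Qed.

Lemma co_vtx_mul f v x y : coef (vtx v * f) x y = if x == v then coef f x y else 0.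
Proof.
apply: (@co_cases x y) => [e|a ea eb].
  by rewrite !co_inf // if_same.
rewrite !(coP _ ea eb) [LHS]bmul_gen_l; case: eqP => [exv|nxv].
  rewrite (sum_msupp1 _ (P := fun c => bs_mul (bs_id B v) c == Some a) (a0 := a)) //.
  move=> c /=; rewrite dpair_mul1l; case: (v =P dsrc c) => [_|nc].
    by apply/idP/idP => /eqP; [case=> -> | move=> ->]; rewrite eqxx.
  by apply/esym/negbTE/eqP => eca; case: nc; rewrite eca ea exv.
rewrite (sum_msupp0 _ (P := fun c => bs_mul (bs_id B v) c == Some a)) // => c /=.
rewrite dpair_mul1l; case: (v =P dsrc c) => // ec; apply/negbTE/eqP => -[eca]; case: nxv.
by rewrite -ea -eca.
Qed.

Lemma co_mul_edge f w v x y : dist w v = Some 1%N -> coef (f * edge 1 w v) x y =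
  if (y == v) && (dist x w != None) && (dist x y == oaddn (dist x w) (Some 1%N)) then coef f x w else 0.
Proof.
move=> ewv; apply: (@co_cases x y) => [e|a ea eb].
  rewrite co_inf // e; case: (dist x w) => [m|] /=; rewrite ?andbF //.
have [b [b1 b2]] : exists b : dpair G, dsrc b = w /\ dtgt b = v.
  by apply: dpair_exists; rewrite ewv.
have -> : edge 1 w v = (1 *: << (b : B) >> : balg K B).
  congr (_ *: _); rewrite -[<< _ >>]/(bgen K (Some (b : B))); congr bgen.
  by rewrite -b1 -b2 /dsrc /dtgt -surjective_pairing valK.
rewrite (coP _ ea eb) [LHS]bmul_gen_r mul1r.
have degb : dpair_deg b = 1%N.
  by have := dpair_dist b; rewrite b1 b2 ewv => -[].
have mulE c : (bs_mul (c : B) (b : B) == Some (a : B)) =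
    [&& dtgt c == w, dsrc c == x, y == v & dpair_deg a == (dpair_deg c).+1].
  apply/eqP/and4P => [/dpair_mul_val[e1 e2 e3 e4]|[/eqP e1 /eqP e2 /eqP e3 /eqP e4]].
    by rewrite e1 b1 -ea e2 -eb e3 b2 e4 degb addn1 !eqxx.
  by apply/dpair_mul_val; rewrite b1 ea eb b2 e3 e2 e4 degb addn1.
case: (eqVneq (dist x w) None) => [einf|/dpair_exists[c [c1 c2]]].
  rewrite einf /= andbF /= (sum_msupp0 _ (P := fun c => bs_mul c (b : B) == Some (a : B))) // => c /=.
  rewrite mulE; apply/negbTE/and4P => -[/eqP e1 /eqP e2 _ _].
  by have := dpair_dist c; rewrite e1 e2 einf.
have degE : (dist x y == oaddn (dist x w) (Some 1%N)) = (dpair_deg a == (dpair_deg c).+1).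
  by rewrite -{1}ea -eb dpair_dist -c1 -c2 dpair_dist /= addn1.
rewrite degE andbT; case: andP => [[/eqP e1 /eqP e2]|ne].
  rewrite (sum_msupp1 _ (P := fun c => bs_mul c (b : B) == Some (a : B)) (a0 := c : B)).
    by rewrite (coP f c1 c2).
  move=> c' /=; rewrite mulE e1 eqxx /=.
  apply/and3P/eqP => [[/eqP f1 /eqP f2 _]|->]; last by rewrite c1 c2 e2 !eqxx.
  by apply: dpair_eq; rewrite ?f1 ?f2 ?c1 ?c2.
rewrite (sum_msupp0 _ (P := fun c => bs_mul c (b : B) == Some (a : B))) // => c' /=.
rewrite mulE; apply/negbTE/and4P => -[/eqP f1 /eqP f2 e1 e2]; case: ne; split=> //.
by rewrite (_ : c = c') //; apply: dpair_eq; rewrite ?f1 ?f2 ?c1 ?c2.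
Qed.

Lemma dist_homogP n f : f \in homog (@gr_pr A) n <->
  forall x y, coef f x y != 0 -> dist x y = Some n.
Proof.
rewrite basis_homogP; split=> [h x y|h a na].
  apply: (@co_cases x y) => [e|a ea eb]; first by rewrite co_inf ?eqxx.
  rewrite (coP _ ea eb) => nz; rewrite -ea -eb dpair_dist; congr Some; apply/eqP.
  by apply: contraNT nz => na; rewrite h.
apply/eqP; apply: contraNT na => nz; have := h (dsrc a) (dtgt a).
by rewrite coE => /(_ nz); rewrite dpair_dist => -[/eqP].
Qed.

Lemma co_pr n f x y : coef (gr_pr n f) x y = if dist x y == Some n then coef f x y else 0.
Proof.
apply: (@co_cases x y) => [e|a ea eb]; first by rewrite !co_inf // if_same.
by rewrite !(coP _ ea eb) [LHS]bprE -ea -eb dpair_dist.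
Qed.

Lemma svtx_homog0 k x : svtx k x \in homog (@gr_pr A) 0.
Proof.
apply/dist_homogP => y z; rewrite co_svtx; case: andP => [[/eqP-> /eqP->] _|_].
  exact: dist_xx.
by rewrite eqxx.
Qed.

Lemma vtxM x y : vtx x * vtx y = if x == y then vtx x else 0.
Proof.
rewrite -!svtx1; apply: co_inj => u v; rewrite co_mul_svtx co_svtx mul1r.
have [->|nxy] := eqVneq x y; first by rewrite co_svtx; case: (v == y) (u == y) => [] [].
by rewrite co0; have [->|//] := eqVneq v y; rewrite [y == x]eq_sym (negbTE nxy) andbF.
Qed.

Lemma sum_vtx : \sum_x vtx x = 1.
Proof. by []. Qed.

Lemma co_diag s x y : s \in homog (@gr_pr A) 0 -> x != y -> coef s x y = 0.
Proof.
move=> s0 nxy; apply/eqP; apply: contraNT nxy => nz.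
by have /dist_eq0-> := proj1 (dist_homogP 0 s) s0 x y nz.
Qed.

Lemma mul_vtx_scalar s x : s \in homog (@gr_pr A) 0 -> s * vtx x = svtx (coef s x x) x.
Proof.
move=> s0; rewrite -svtx1; apply: co_inj => u v; rewrite co_mul_svtx co_svtx mul1r.
case: (eqVneq v x) => [->|_]; last by rewrite andbF.
by have [->|nuv] := eqVneq u x; rewrite ?eqxx // co_diag.
Qed.

Lemma distance_algebra_semisimple : semisimple_ring (deg0 A).
Proof.
apply: (@deg0_semisimple A G vtx).
- by move=> x; rewrite -svtx1; apply: svtx_homog0.
- exact: vtxM.
- exact: sum_vtx.
- move=> s x s0; rewrite mul_vtx_scalar //; apply: co_inj => u v.
  rewrite co_vtx_mul co_svtx; have [->|nuv] := eqVneq u x; last by [].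
  by have [->|nvx] := eqVneq v x; rewrite //= co_diag // eq_sym.
move=> s x s0; rewrite mul_vtx_scalar // => nz.
have cs : coef s x x != 0.
  by apply: contraNneq nz => ->; apply/eqP/co_inj => u v; rewrite co_svtx co0 if_same.
exists (svtx (coef s x x)^-1 x); first exact: svtx_homog0.
move: (coef s x x) cs => {nz} k k0; have := mulfV k0; move: k^-1 => k' kk'.
rewrite -[RHS]svtx1; apply: co_inj => u v; rewrite [LHS]co_mul_svtx [RHS]co_svtx co_svtx.
case: (v == x); last by rewrite !andbF.
by case: (u == x); rewrite /= ?mulr0.
Qed.

End DistanceAlgebra.

(** * The linear complex of the distance algebra *)

Section GradedRelativelyFree.
Variable A : gradedRing.

(** A matrix with entries of degree one compensates the shift between the
    generators. *)
Lemma rf_map_graded (I J : finType) (E : I -> I -> A) (F : J -> J -> A)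
    (E0 : forall i j, E i j \in homog (@gr_pr A) 0)
    (F0 : forall i j, F i j \in homog (@gr_pr A) 0) n (M : I -> J -> A)
    (g : {linear rf_gmod n.+1 E0 -> rf_gmod n F0}) :
  (forall i j, M i j \in homog (@gr_pr A) 1) ->
  (forall (f : rf E) j, rfv (g f : rf F) j = \sum_i rfv f i * M i j) -> graded_hom g.
Proof.
move=> M1 hg; apply: homog_graded_hom => m f hf; case: (ltP m n.+1%:Z) => [lt|le].
  by rewrite (rf_homog_lowP lt hf) linear0 unfold_in /homog (grad0 (gm_grading (rf_gmod n F0))).
have [j em] := int_shift le; rewrite em in hf *; move/rf_homogP: hf => hf.
rewrite addSnnS; apply/rf_homogP => k; rewrite hg unfold_in /homog.
rewrite (grad_bigsum (gr_grading A)); apply/eqP/eq_bigr => i _.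
by have := gr_mul (hf i) (M1 i k); rewrite addn1 => /homogE.
Qed.

Lemma rf_augmentation_graded (I : finType) (E : I -> I -> A)
    (E0 : forall i j, E i j \in homog (@gr_pr A) 0)
    (g : {linear rf_gmod 0 E0 -> deg0_gmod A}) :
  (forall f : rf E, val (g f : deg0 A) = \sum_i gr_pr 0 (rfv f i)) -> graded_hom g.
Proof.
move=> hg; apply: homog_graded_hom => m f hf; case: (ltP m 0) => [lt|le].
  by rewrite (rf_homog_lowP lt hf) linear0 unfold_in /homog (grad0 (gm_grading (deg0_gmod A))).
have [j em] := @int_shift 0 m le; rewrite em in hf *; move/rf_homogP: hf => hf.
rewrite unfold_in /homog /= /deg0_pr; case: j hf {em} => [|j] hf; first by rewrite eqxx.
rewrite (_ : g f = 0) ?if_same //; apply/val_inj; rewrite hg big1 // => i _.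
by rewrite -(homogE (hf i)) (gradK (gr_grading A)).
Qed.

End GradedRelativelyFree.

Lemma sum_take (R : nmodType) (V : finType) n (q : n.-tuple V) (F : n.+1.-tuple V -> R) :
  \sum_(p : n.+1.-tuple V) (if take n p == q :> seq V then F p else 0) = \sum_v F [tuple of rcons q v].
Proof.
transitivity (\sum_(p : n.+1.-tuple V) \sum_v if p == [tuple of rcons q v] then F p else 0).
  apply: eq_bigr => p _; case: eqP => [e|ne].
    rewrite (bigD1 (lastt p)) //= big1 => [|v nv].
      rewrite addr0 ifT //; apply/eqP/val_inj => /=.
      rewrite -e /lastt (tnth_nth (lastt p)) /= -take_nth ?size_tuple //.
      by rewrite take_oversize ?size_tuple.
    case: eqP => // ep; case/eqP: nv; rewrite -(last_tuple p v) ep /=.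
    by rewrite last_rcons.
  rewrite big1 // => v _; case: eqP => // ep; case: ne.
  by rewrite ep /= -cats1 take_size_cat ?size_tuple.
rewrite exchange_big; apply: eq_bigr => v _.
by rewrite (bigD1 [tuple of rcons q v]) //= eqxx big1 ?addr0 // => p /negbTE->.
Qed.

Lemma lastt_rcons (V : finType) n (q : n.-tuple V) (v : V) :
  lastt [tuple of rcons q v] = v.
Proof. by rewrite -(last_tuple _ v) /= last_rcons. Qed.

Lemma dist_last_tuple (V : finType) (d : V -> V -> option nat) n (p : n.+1.-tuple V) z :
  dist_last d p z = d (lastt p) z.
Proof. by rewrite -(last_tuple p z); case: p => -[|x p]. Qed.

Section DistanceComplex.
Variables (G : digraph) (K : fieldType).
Local Notation A := (distance_algebra G K).
Local Notation dT := (transpose (@dist G)).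
Implicit Types (x y z v w : G) (s : seq G) (g : seq G -> G -> K).

Let dTM := dist_transpose_metric G.

Definition cproj n : n.+1.-tuple G -> n.+1.-tuple G -> K :=
  projT1 (cid (@cycle_projector K G dT n)).

Lemma cproj_fiber n (p q : n.+1.-tuple G) : lastt p != lastt q -> cproj p q = 0.
Proof. by rewrite /cproj; case: cid => e [h _ _] /=; apply: h. Qed.

Lemma cproj_cyc n (p : n.+1.-tuple G) : cyc dT (cproj p).
Proof. by rewrite /cproj; case: cid => e [_ h _] /=; apply: h. Qed.

Lemma cprojE n (w : n.+1.-tuple G -> K) q : cyc dT w -> \sum_p w p * cproj p q = w q.
Proof. by rewrite /cproj; case: cid => e [_ _ h] /= cw; apply: h. Qed.

(** The projection onto N_n, with scalars placed at the end of the path: row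
    vectors fixed by it are the elements of N_n with coefficients in the
    distance algebra, as rf_of_cycle and cycle_of_cycle show. *)
Definition cmat n (p q : n.+1.-tuple G) : A := svtx (cproj p q) (lastt p).

Lemma cmat0 n (p q : n.+1.-tuple G) : cmat p q \in homog (@gr_pr A) 0.
Proof. exact: svtx_homog0. Qed.

Lemma cmat_idem n (p q : n.+1.-tuple G) : \sum_r cmat p r * cmat r q = cmat p q.
Proof.
apply: co_inj => x y; rewrite co_sum /cmat.
under eq_bigr => r _ do rewrite co_mul_svtx co_svtx.
rewrite co_svtx -[in RHS](cprojE q (cproj_cyc p)).
case: (x == lastt p) => /=; last by rewrite big1 // => r _; rewrite mulr0 if_same.
case: (y =P lastt p) => [->|_]; last by rewrite big1 // => r _; rewrite mulr0 if_same.
apply: eq_bigr => r _; rewrite mulrC; case: eqP => // /eqP npr.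
by rewrite cproj_fiber ?mul0r.
Qed.

Section Transport.
Variable n : nat.
Implicit Types (f : rf (@cmat n)) (p q : n.+1.-tuple G).

(** The coefficient of f at the path s is a combination of the pairs (z, end of
    s): this is a Koszul cycle for the opposite distance. *)
Definition cycle_of f s z : K := extend (fun p => coef (rfv f p) z (lastt p)) s.

Lemma rfv_coE f q z y : coef (rfv f q) z y =
  \sum_p if y == lastt p then cproj p q * coef (rfv f p) z y else 0.
Proof.
rewrite {1}rfE co_sum; apply: eq_bigr => p _.
by rewrite co_mul_svtx.
Qed.

Lemma rfv_cycle_of f q z y : coef (rfv f q) z y = if y == lastt q then cycle_of f q z else 0.
Proof.
case: eqP => [->|/eqP ny]; first by rewrite /cycle_of extendE.
rewrite rfv_coE big1 // => p _; case: eqP => // e.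
by rewrite cproj_fiber ?mul0r // -e.
Qed.

Lemma cycle_of_inj f f' : (forall s z, cycle_of f s z = cycle_of f' s z) -> f = f'.
Proof. by move=> h; apply: rf_inj => q; apply: co_inj => z y; rewrite !rfv_cycle_of h. Qed.

Lemma cycle_of_cycle f : koszul_cycle dT n (cycle_of f).
Proof.
have cf z : cyc dT (fun p => coef (rfv f p) z (lastt p)).
  rewrite (_ : (fun p => _) = fun q => \sum_p coef (rfv f p) z (lastt p) * cproj p q).
    by apply: cyc_sum => p; apply: cproj_cyc.
  apply/funext => q; rewrite rfv_coE; apply: eq_bigr => p _.
  have [e|ne] := eqVneq (lastt q) (lastt p); first by rewrite e mulrC.
  by rewrite cproj_fiber ?mulr0 // eq_sym.
split=> [s z|i s z]; last exact: (cf z).2.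
rewrite /cycle_of /extend; case: insubP => [p _ ep nz|_]; last by rewrite eqxx.
rewrite -ep; split; first by rewrite size_tuple.
  exact: (cf z).1.
by rewrite dist_last_tuple /transpose; apply: co_fin nz.
Qed.

Lemma rf_of_cycle g : koszul_cycle dT n g -> exists f, forall s z, cycle_of f s z = g s z.
Proof.
move=> gK; pose h q : A := \sum_z edge (g q z) z (lastt q).
have coh q z y : coef (h q) z y =
    if (y == lastt q) && (dist z y != None) then g q z else 0.
  rewrite /h co_sum; under eq_bigr => z' _ do rewrite co_edge.
  rewrite (bigD1 z) //= eqxx big1 ?addr0 // => z' /negbTE nz.
  by rewrite eq_sym nz.
have [|f ef] := @rf_exists A _ (@cmat n) h.
  move=> q; apply: co_inj => z y; rewrite coh co_sum.
  under eq_bigr => p _ do rewrite co_mul_svtx coh.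
  case fin: (dist z y != None); last first.
    by rewrite andbF big1 // => p _; rewrite andbF mulr0 if_same.
  case: eqP => [->|/eqP ny] /=.
    rewrite -(cprojE q (cyc_koszul_cycle gK z)); apply: eq_bigr => p _.
    have [e|ne] := eqVneq (lastt q) (lastt p); first by rewrite mulrC.
    by rewrite cproj_fiber ?mulr0 // eq_sym.
  rewrite big1 // => p _; case: eqP => // e.
  by rewrite cproj_fiber ?mul0r // -e.
exists f => s z; rewrite /cycle_of /extend; case: insubP => [p _ ep|ns].
  rewrite ef coh eqxx -ep; case: eqP => // fin; apply/esym/eqP; apply: contraT.
  by case/gK.1 => _ _; rewrite dist_last_tuple /transpose fin.
by apply/esym/eqP; apply: contraNT ns => /gK.1[/eqP].
Qed.

Lemma cycle_of_homogP j f : f \in homog (rf_pr n (@cmat0 n)) (n + j)%:Z <->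
  forall s z, cycle_of f s z != 0 -> dist_last dT s z = Some j.
Proof.
rewrite rf_homogP; split=> h => [s z|q].
  rewrite /cycle_of /extend; case: insubP => [p _ <- nz|_]; last by rewrite eqxx.
  by rewrite dist_last_tuple; apply: (proj1 (dist_homogP j _) (h p)).
apply/dist_homogP => x y; rewrite rfv_cycle_of; case: ifP => [/eqP->|_]; last by rewrite eqxx.
by move/h; rewrite dist_last_tuple.
Qed.

End Transport.

(** The last arrow of the path is removed and multiplied into the
    coefficient. *)
Definition cdiff_mat n (p : n.+2.-tuple G) (q : n.+1.-tuple G) : A :=
  if (take n.+1 p == q :> seq G) && (dist (lastt p) (lastt q) == Some 1%N)
  then edge 1 (lastt p) (lastt q) else 0.

Lemma cdiff_mat1 n p q : @cdiff_mat n p q \in homog (@gr_pr A) 1.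
Proof.
rewrite /cdiff_mat; case: ifP => [/andP[_ /eqP e]|_].
  apply/dist_homogP => x y; rewrite co_edge.
  by case: and3P => [[/eqP-> /eqP-> _]|]; rewrite ?eqxx.
by rewrite unfold_in /homog (grad0 (gr_grading A)).
Qed.

Lemma cdiff_co n (f : rf (@cmat n.+1)) q z y :
  coef (\sum_p rfv f p * cdiff_mat p q) z y =
  if y == lastt q then koszul_diff dT (cycle_of f) q z else 0.
Proof.
rewrite co_sum; transitivity (\sum_(p : n.+2.-tuple G) if take n.+1 p == q :> seq G then
    (if [&& y == lastt q & koszul_step dT q (lastt p) z] then cycle_of f p z else 0) else 0).
  apply: eq_bigr => p _; rewrite /cdiff_mat; case: eqP => [e|ne] /=; last by rewrite mulr0 co0.
  rewrite /koszul_step !dist_last_tuple /transpose; case: eqP => [e1|]; last first.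
    by rewrite mulr0 co0 andbF.
  rewrite co_mul_edge // rfv_cycle_of eqxx oaddnC.
  have [->|ny] := eqVneq y (lastt q); rewrite ?andbF //=.
  by case: (dist z (lastt p)) => [m|] /=; case: (dist z (lastt q)) => [m'|] //=; rewrite ?andbF.
rewrite sum_take /koszul_diff; case: (y == lastt q); last by rewrite big1.
apply: eq_bigr => v _; rewrite lastt_rcons andTb.
by case: koszul_step; rewrite ?mul1r ?mul0r.
Qed.

Lemma cdiff_exists n : exists D : {linear rf (@cmat n.+1) -> rf (@cmat n)},
  forall f q, rfv (D f) q = \sum_p rfv f p * cdiff_mat p q.
Proof.
apply: rf_map_exists => f q.
have [f' ef'] := rf_of_cycle (kap_cycle (cycle_of_cycle f)).
have e r : \sum_p rfv f p * cdiff_mat p r = rfv f' r.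
  by apply: co_inj => z y; rewrite cdiff_co rfv_cycle_of ef'.
transitivity (rfv f' q); first exact: e.
rewrite [LHS]rfE; apply: eq_bigr => r _; congr (_ * _).
exact: esym (e r).
Qed.

Definition cgmod n : gradedModule A := rf_gmod n (@cmat0 n).

Definition cdiff n : {linear cgmod n.+1 -> cgmod n} := projT1 (cid (cdiff_exists n)).

(** A product in the distance algebra is nonzero exactly when the distances add
    up, which is the condition of a geodesic step. *)
Lemma cdiff_cycle_of n (f : rf (@cmat n.+1)) s z :
  cycle_of (cdiff n f : rf (@cmat n)) s z = koszul_diff dT (cycle_of f) s z.
Proof.
have E q : rfv (cdiff n f : rf (@cmat n)) q = \sum_p rfv f p * cdiff_mat p q.
  by rewrite /cdiff; case: cid.
rewrite {1}/cycle_of /extend; case: insubP => [q _ <-|ns].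
  by rewrite E cdiff_co eqxx.
apply/esym/eqP; apply: contraNT ns => /(kap_cycle (cycle_of_cycle f)).1[/eqP].
by [].
Qed.

Definition caug : {linear cgmod 0 -> deg0_gmod A} :=
  projT1 (cid (rf_augmentation_exists (@cmat 0))).

Lemma caugE (f : rf (@cmat 0)) : val (caug f : deg0 A) = \sum_p gr_pr 0 (rfv f p).
Proof. by rewrite /caug; case: cid. Qed.

Lemma caug_co (f : rf (@cmat 0)) x y :
  coef (val (caug f : deg0 A)) x y = if x == y then cycle_of f [:: y] y else 0.
Proof.
rewrite caugE co_sum; under eq_bigr => p _ do rewrite co_pr rfv_cycle_of.
case: (x =P y) => [->|nxy]; last first.
  rewrite big1 // => p _; case: eqP => // /dist_eq0 e; by rewrite e in nxy.
rewrite dist_xx eqxx (bigD1 [tuple y]) //= big1 => [|p np].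
  by rewrite addr0 -(last_tuple _ y) /= eqxx.
case: eqP => // e; case/eqP: np; apply: val_inj; rewrite /= e.
by case: p {e} => -[|a [|b p]] //= sp; rewrite /lastt (tnth_nth a).
Qed.

Lemma caug_eq0 (f : rf (@cmat 0)) : caug f = 0 <-> forall y, cycle_of f [:: y] y = 0.
Proof.
split=> [e y|h].
  by have := caug_co f y y; rewrite e eqxx co0.
by apply/val_inj/co_inj => x y; rewrite caug_co h if_same co0.
Qed.

Lemma size1_cycle g s z : koszul_cycle dT 0 g -> g s z != 0 -> exists x, s = [:: x].
Proof. by move=> gK /gK.1[]; case: s => [|x [|y s]] // _ _ _; exists x. Qed.

Lemma distance_linear_complex : linear_complex cdiff caug.
Proof.
split.
- by move=> n; apply: rf_graded_basis => i k; apply: cmat_idem.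
- move=> n; apply: (@rf_map_graded A _ _ _ _ (@cmat0 n.+1) (@cmat0 n) n (@cdiff_mat n)).
    exact: cdiff_mat1.
  by move=> f q; rewrite /cdiff; case: cid.
- by apply: rf_augmentation_graded => f; apply: caugE.
- move=> n f; apply: cycle_of_inj => s z; rewrite !cdiff_cycle_of.
  have -> : cycle_of (0 : rf (@cmat n)) s z = 0.
    by rewrite /cycle_of /extend; case: insub => // p; rewrite rfv0 co0.
  rewrite -(kap_kap dTM s z (cycle_of_cycle f)); apply: eq_bigr => v _.
  by rewrite cdiff_cycle_of.
- move=> f; apply/caug_eq0 => y; rewrite cdiff_cycle_of; apply: big1 => v _.
  rewrite /koszul_step /= /transpose dist_xx.
  by case: (dist y v) => [m|] /=; rewrite ?andbF ?mul0r.
move=> s; pose g q z : K := if q is [:: x] then if x == z then coef (val s) x x else 0 else 0.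
have gK : koszul_cycle dT 0 g.
  split=> [q z|i q z].
    case: q => [|x [|w q]]; rewrite /g ?eqxx //; case: ifP => [/eqP->|_]; last by rewrite eqxx.
    by move=> _; split=> //=; rewrite /transpose dist_xx.
  have [lt|le] := ltnP i.+1 (size q); last exact: face_oversize.
  apply: face_eq0 => p x w r v eq _ _; rewrite /g.
  by case: p {eq} => [|a [|b p]].
have [f ef] := rf_of_cycle gK; exists f.
  rewrite -[0]/((0 + 0)%N%:Z); apply/cycle_of_homogP => q z; rewrite ef => nz.
  have [x eq] := size1_cycle gK nz; move: nz; rewrite eq /g; case: ifP => [/eqP-> _|_].
    by rewrite /= /transpose dist_xx.
  by rewrite eqxx.
apply/val_inj/co_inj => x y; rewrite caug_co ef /g eqxx.
by have [->//|nxy] := eqVneq x y; rewrite (co_diag (valP s)).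
Qed.

Let lc := distance_linear_complex.

(** Exactness in the lowest degrees is unconditional here: elements at distance
    zero or one from z are handled by kap_degenerate and koszul_step_bottom. *)
Theorem koszul_distance_exact : koszul A -> forall k g, koszul_cycle dT k.+1 g ->
  (forall s z, koszul_diff dT g s z = 0) ->
  exists h, koszul_cycle dT k.+2 h /\ forall s z, koszul_diff dT h s z = g s z.
Proof.
move=> kos.
have bottom n (q : cgmod n) : q \in homog (@gm_pr A (cgmod n)) n.+1%:Z ->
    (forall s z, koszul_diff dT (cycle_of (q : rf (@cmat n))) s z = 0) ->
    exists2 q', q' \in homog (@gm_pr A (cgmod n.+1)) n.+1%:Z & cdiff n q' = q.
  move=> hq kq.
  have /cycle_of_homogP g1 : (q : rf (@cmat n)) \in homog (rf_pr n (@cmat0 n)) (n + 1)%:Z.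
    by rewrite addn1.
  have [h [hK hE]] := koszul_step_bottom dTM (cycle_of_cycle q) kq g1.
  have [q' eq'] := rf_of_cycle hK.
  exists (gm_pr n.+1%:Z (q' : cgmod n.+1)); first exact: homogP (gm_grading (cgmod n.+1)) _ _.
  rewrite (lc_hd lc) (_ : cdiff n q' = q) ?(homogE hq) //.
  apply: cycle_of_inj => s z; rewrite cdiff_cycle_of -hE; apply: eq_bigr => v _.
  by rewrite eq'.
have zeroE n : forall s z, cycle_of (0 : rf (@cmat n)) s z = 0.
  by move=> s z; rewrite /cycle_of /extend; case: insub => // p; rewrite rfv0 co0.
have ex := @koszul_exact A cgmod cdiff caug lc kos.
have EX : forall n q, cdiff n q = 0 -> exists q', cdiff n.+1 q' = q.
  apply: ex.
  - move=> f hf /caug_eq0 e0.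
    have /cycle_of_homogP h0 : (f : rf (@cmat 0)) \in homog (rf_pr 0 (@cmat0 0)) (0 + 0)%:Z by [].
    apply: cycle_of_inj => s z; rewrite zeroE; apply/eqP; apply: contraT => nz.
    have [x es] := size1_cycle (cycle_of_cycle f) nz; have := h0 _ _ nz.
    by rewrite es /= => /dist_eq0 exz; move: nz; rewrite es exz e0 eqxx.
  - move=> n f hf df.
    have /cycle_of_homogP h0 : (f : rf (@cmat n.+1)) \in homog (rf_pr n.+1 (@cmat0 n.+1)) (n.+1 + 0)%:Z.
      by rewrite addn0.
    apply: cycle_of_inj => s z; rewrite zeroE; apply/eqP; apply: contraT => nz.
    have [ss us _] := (cycle_of_cycle f).1 _ _ nz; have := h0 _ _ nz.
    case/lastP: s ss us nz => // s v; case/lastP: s => // s x _ us nz.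
    rewrite dist_last_rcons => /(metric_eq0 dTM) evz.
    have := kap_degenerate dTM (cycle_of f) (y := rcons s x) (z := z).
    rewrite dist_last_rcons -evz (eqP (sorted_rcons2 us)) => /(_ erefl).
    by rewrite -cdiff_cycle_of df zeroE => /esym e0; move: nz; rewrite -evz e0 eqxx.
  - move=> f hf _; apply: bottom => // s z; apply/eqP; apply: contraT => nz.
    have [v _] := kap_neq0 nz; move/(cycle_of_cycle f).1 => [+ _ _].
    rewrite size_rcons => -[/size0nil es]; move: nz; rewrite es /koszul_diff big1 ?eqxx // => w _.
    by rewrite mul0r.
  - move=> n f hf df; apply: bottom => // s z.
    by rewrite -cdiff_cycle_of df zeroE.
move=> k g gK kg; have [f ef] := rf_of_cycle gK.
have [|f' ef'] := EX k f.
  apply: cycle_of_inj => s z; rewrite zeroE cdiff_cycle_of -(kg s z); apply: eq_bigr => v _.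
  by rewrite ef.
exists (cycle_of (f' : rf (@cmat k.+2))); split; first exact: cycle_of_cycle.
by move=> s z; rewrite -cdiff_cycle_of ef' ef.
Qed.

Theorem exact_koszul_distance : (forall k g, koszul_cycle dT k.+1 g ->
    (forall s z, koszul_diff dT g s z = 0) ->
    exists h, koszul_cycle dT k.+2 h /\ forall s z, koszul_diff dT h s z = g s z) ->
  koszul A.
Proof.
move=> EX.
have zeroE n : forall s z, cycle_of (0 : rf (@cmat n)) s z = 0.
  by move=> s z; rewrite /cycle_of /extend; case: insub => // p; rewrite rfv0 co0.
have lift n (q : rf (@cmat n)) h : koszul_cycle dT n.+1 h ->
    (forall s z, koszul_diff dT h s z = cycle_of q s z) -> exists q', cdiff n q' = q.
  move=> hK hE; have [q' eq'] := rf_of_cycle hK; exists q'.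
  apply: cycle_of_inj => s z; rewrite cdiff_cycle_of -hE; apply: eq_bigr => v _.
  by rewrite eq'.
apply: (exact_koszul lc (@distance_algebra_semisimple G K)).
  move=> f /caug_eq0 e0; have [|h [hK hE]] := koszul_exact0 dTM (cycle_of_cycle f).
    move=> s z nz; have [x es] := size1_cycle (cycle_of_cycle f) nz.
    by apply: contraNneq nz; rewrite es /= => /dist_eq0->; rewrite e0.
  exact: lift hK hE.
move=> n f df; have [|h [hK hE]] := EX n (cycle_of f) (cycle_of_cycle f).
  by move=> s z; rewrite -cdiff_cycle_of df zeroE.
exact: lift hK hE.
Qed.

End DistanceComplex.

(** * The relations of the path cochain algebra as an annihilator *)

Section BasisPairing.
Variables (K : fieldType) (V : finType) (B : basis V).
Implicit Types (f g : balg K B) (a b c : B) (h : B -> K).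

Definition pairing h f : K := \sum_(a <- msupp f) f@_a * h a.

Lemma pairing_wide h f (D : {fset B}) : (msupp f `<=` D)%fset ->
  pairing h f = \sum_(a <- D) f@_a * h a.
Proof.
by move=> le; rewrite /pairing (big_fset_incl _ le) // => a _ /mcoeff_outdom->; rewrite mul0r.
Qed.

Lemma pairingD h f g : pairing h (f + g) = pairing h f + pairing h g.
Proof.
rewrite (pairing_wide h (msuppD_le f g)).
rewrite (pairing_wide h (fsubsetUl (msupp f) (msupp g))).
rewrite (pairing_wide h (fsubsetUr (msupp f) (msupp g))) -big_split /=.
by apply: eq_bigr => a _; rewrite mcoeffD mulrDl.
Qed.

Lemma pairingZ h k f : pairing h (k *: f) = k * pairing h f.
Proof.
rewrite (pairing_wide h (msuppZ_le k f)) mulr_sumr.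
by apply: eq_bigr => a _; rewrite mcoeffZ mulrA.
Qed.

Lemma pairing0 h : pairing h 0 = 0.
Proof. by have := pairingZ h 0 0; rewrite scale0r mul0r. Qed.

Lemma pairingB h f g : pairing h (f - g) = pairing h f - pairing h g.
Proof. by rewrite pairingD -scaleN1r pairingZ mulN1r. Qed.

Lemma pairing_sum h (J : Type) (r : seq J) (P : pred J) F :
  pairing h (\sum_(j <- r | P j) F j) = \sum_(j <- r | P j) pairing h (F j).
Proof. exact: (big_morph (pairing h) (pairingD h) (pairing0 h)). Qed.

Lemma pairingU h a : pairing h << a >> = h a.
Proof.
by rewrite (pairing_wide h msuppU_le) big_seq_fset1 mcoeffUU mul1r.
Qed.

Lemma pairing_linear h h' k f :
  pairing (fun a => k * h a + h' a) f = k * pairing h f + pairing h' f.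
Proof.
rewrite /pairing mulr_sumr -big_split; apply: eq_bigr => a _ /=.
by rewrite mulrDr mulrCA.
Qed.

Lemma mcoeff_mul f g c : (f * g)@_c =
  pairing (fun a => pairing (fun b => (bs_mul a b == Some c)%:R) g) f.
Proof.
rewrite [f * g]/(bmul f g) raddf_sum; apply: eq_bigr => a _ /=.
rewrite raddf_sum mulr_sumr; apply: eq_bigr => b _ /=.
by rewrite mcoeffZ mcoeff_bgen mulrA.
Qed.

Lemma balg_scaleAl k f g : (k *: f : balg K B) * g = (k *: (f * g : balg K B) : balg K B).
Proof. by apply/malgP => c; rewrite [RHS]mcoeffZ !mcoeff_mul pairingZ. Qed.

Lemma balg_scaleAr k f g : f * (k *: g : balg K B) = (k *: (f * g : balg K B) : balg K B).
Proof.
apply/malgP => c; rewrite [RHS]mcoeffZ !mcoeff_mul.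
have e h : pairing (fun a => k * h a) f = k * pairing h f.
  by rewrite /pairing mulr_sumr; apply: eq_bigr => a _; rewrite mulrCA.
by rewrite -e; apply: eq_bigr => a _; rewrite pairingZ.
Qed.

Lemma balg_mulUU a b : (<< a >> : balg K B) * << b >> = bgen K (bs_mul a b).
Proof. by apply/malgP => c; rewrite mcoeff_mul !pairingU mcoeff_bgen. Qed.

Lemma balg_sumE f : f = \sum_(a <- msupp f) (f@_a *: << a >> : balg K B).
Proof.
rewrite {1}[f]monalgE; apply: eq_bigr => a _.
by apply/malgP => b; rewrite mcoeffZ !mcoeffU mulr_natr.
Qed.

End BasisPairing.

Section PathAlgebra.
Variables (G : digraph) (K : fieldType).
Local Notation B := (path_basis G).
Local Notation A := (path_algebra G K).
Local Notation e := (@arrow G).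
Implicit Types (f g : A) (x y z v w : G) (s p q : seq G).

(** The path with the given vertices, or zero when they do not form a path;
    this totality makes products and relations uniform. *)
Definition pgen s : A :=
  if s is x :: s' then bgen K (insub (x, s') : option B) else 0.

Lemma pgen_path (p : gpath G) : pgen (pverts p) = << (p : B) >>.
Proof. by rewrite /pgen /pverts -surjective_pairing valK. Qed.

Lemma pverts_inj : injective (@pverts G).
Proof.
move=> p q; rewrite /pverts => -[e1 e2]; apply/val_inj.
by rewrite [LHS]surjective_pairing [RHS]surjective_pairing e1 e2.
Qed.

Lemma gpath_exists x s : path e x s -> exists p : gpath G, pverts p = x :: s.
Proof. by move=> h; exists (Sub (x, s) h : gpath G). Qed.

Lemma pgen_out s : ~~ sorted e s -> pgen s = 0.
Proof. by case: s => // x s /= h; rewrite /pgen insubN. Qed.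

Lemma pgen_nil : pgen [::] = 0. Proof. by []. Qed.

Lemma sorted_cat_join p x q : sorted e (p ++ x :: q) = sorted e (rcons p x) && path e x q.
Proof. by case: p => //= a p; rewrite cat_path rcons_path /= andbA. Qed.

Lemma pgenM p x q : pgen (rcons p x) * pgen (x :: q) = pgen (p ++ x :: q).
Proof.
have [sp|nsp] := boolP (sorted e (rcons p x)); last first.
  by rewrite pgen_out // mul0r pgen_out // sorted_cat_join (negbTE nsp).
have [sq|nsq] := boolP (path e x q); last first.
  by rewrite [pgen (x :: q)]pgen_out // mulr0 pgen_out // sorted_cat_join (negbTE nsq) andbF.
have [u eu] : exists u : gpath G, pverts u = rcons p x.
  by case: p sp => [|a p] h; apply: gpath_exists.
have [v ev] := gpath_exists sq.
have [r er] : exists r : gpath G, pverts r = p ++ x :: q.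
  case: p sp {eu} => [|a p] h; first exact: gpath_exists.
  by apply: gpath_exists; have := sorted_cat_join (a :: p) x q; rewrite h sq.
rewrite -er -eu -ev !pgen_path [LHS]balg_mulUU.
suff -> : bs_mul (u : B) (v : B) = Some (r : B) by [].
apply/pcat_val; move: eu ev er; rewrite /pverts /ptgt /psrc.
case: (val u) (val v) (val r) => [u1 u2] [v1 v2] [r1 r2] /= eu [-> ->] er.
split; first by rewrite -[last u1 u2]/(last u1 (u1 :: u2)) eu last_rcons.
by case: p eu er {sp} => [|a p] [-> ->] [-> ->]; rewrite //= cat_rcons.
Qed.

Lemma pgenM0 p x y q : x != y -> pgen (rcons p x) * pgen (y :: q) = 0.
Proof.
move=> nxy; have [sp|nsp] := boolP (sorted e (rcons p x)); last by rewrite pgen_out // mul0r.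
have [sq|nsq] := boolP (path e y q); last by rewrite [pgen (y :: q)]pgen_out // mulr0.
have [u eu] : exists u : gpath G, pverts u = rcons p x.
  by case: p sp => [|a p] h; apply: gpath_exists.
have [v ev] := gpath_exists sq.
rewrite -eu -ev !pgen_path [LHS]balg_mulUU.
suff -> : bs_mul (u : B) (v : B) = None by [].
apply/pcatN; move: eu ev; rewrite /pverts /ptgt /psrc.
case: (val u) (val v) => [u1 u2] [v1 v2] /= eu [-> _].
rewrite -[last u1 u2]/(last u1 (u1 :: u2)) eu last_rcons.
by apply/eqP.
Qed.

Definition ppair (h : seq G -> K) f : K := pairing (fun p : B => h (pverts p)) f.

Lemma ppair_pgen h s : (h s != 0 -> sorted e s) -> s != [::] -> ppair h (pgen s) = h s.
Proof.
case: s => // x s hs _; have [ps|nps] := boolP (path e x s).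
  by have [u <-] := gpath_exists ps; rewrite pgen_path /ppair pairingU.
rewrite pgen_out // /ppair pairing0; apply/esym/eqP.
by apply: contraNT nps => /hs.
Qed.

Lemma t_eltE x y : t_elt K x y = \sum_v pgen [:: x; v; y].
Proof. by []. Qed.

(** Functions on paths of any length, killed by all the faces; they are the
    linear forms that vanish on T. *)
Definition cocycle (h : seq G -> K) :=
  (forall s, h s != 0 -> sorted e s) /\ forall i s, face (@dist G) i h s = 0.

(** At distance two the vertices in between are the middles of the paths of two
    arrows. *)
Lemma between_two x v y : dist x y = Some 2%N -> between (@dist G) x v y = e x v && e v y.
Proof.
move=> exy; apply/(betweenP (dist_metric G))/andP => [[a [b [e1 e2]]]|[]].
  rewrite exy => -[] ab; have [a0 b0] : a = 0%N /\ b = 0%N by lia.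
  by rewrite -!dist_eq1 e1 e2 a0 b0.
by rewrite -!dist_eq1 => /eqP e1 /eqP e2; exists 0%N, 0%N.
Qed.

Lemma sum_triple_pgen p x y q : dist x y = Some 2%N ->
  pgen (rcons p x) * t_elt K x y * pgen (y :: q) =
  \sum_v pgen (p ++ [:: x, v, y & q]).
Proof.
move=> exy; rewrite t_eltE mulr_sumr mulr_suml; apply: eq_bigr => v _.
rewrite pgenM -[p ++ _](_ : rcons (p ++ [:: x; v]) y = _); last by rewrite -cats1 -catA.
by rewrite pgenM -catA.
Qed.

Lemma balg_mul_sum (u f v : A) h : (forall p q : gpath G,
    ppair h ((<< (p : B) >> : A) * f * (<< (q : B) >> : A)) = 0) -> ppair h (u * f * v) = 0.
Proof.
move=> hpq.
have e1 : u * f = \sum_(p <- msupp (u : balg K B)) (u@_p *: ((<< (p : B) >> : A) * f : balg K B) : balg K B).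
  by rewrite {1}[u]balg_sumE mulr_suml; apply: eq_bigr => p _; apply: balg_scaleAl.
have e2 (w : A) : w * v = \sum_(q <- msupp (v : balg K B)) (v@_q *: (w * (<< (q : B) >> : A) : balg K B) : balg K B).
  by rewrite {1}[v]balg_sumE mulr_sumr; apply: eq_bigr => q _; apply: balg_scaleAr.
rewrite e1 mulr_suml /ppair [LHS]pairing_sum big1 // => p _.
rewrite balg_scaleAl pairingZ e2 [pairing _ _]pairing_sum big1 ?mulr0 // => q _.
by rewrite pairingZ [pairing _ _]hpq mulr0.
Qed.

(** The elements that pair to zero with h after multiplication on both sides
    form an ideal, and between two paths the relation t_(x,y) evaluates to a
    face of h. *)
Lemma ideal_ppair f h : ideal_gen (@t_rel G K) f -> cocycle h -> ppair h f = 0.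
Proof.
move=> If ch; pose J (f : A) := forall u v : A, ppair h (u * f * v) = 0.
suff Jf : J f by have := Jf 1 1; rewrite mul1r mulr1.
apply: If => [|_ [x [y [exy ->]]] u v].
- split.
  + by move=> u v; rewrite mulr0 mul0r /ppair pairing0.
  + by move=> a b ha hb u v; rewrite mulrBr mulrBl; apply: etrans (pairingB _ _ _) _; rewrite [X in X - _](ha u v) [X in _ - X](hb u v) subrr.
  + by move=> a b hb u v; rewrite mulrA; apply: hb.
  + by move=> a b hb u v; rewrite mulrA -mulrA; apply: hb.
apply: balg_mul_sum => p q; rewrite -!pgen_path.
case/lastP: (pverts p) => [|p' x']; first by rewrite pgen_nil !mul0r /ppair pairing0.
case: (pverts q) => [|y' q']; first by rewrite pgen_nil mulr0 /ppair pairing0.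
have [->|nx] := eqVneq x' x; last first.
  rewrite t_eltE mulr_sumr mulr_suml big1 ?/ppair ?pairing0 // => v' _.
  by rewrite pgenM0 // mul0r.
have [->|ny] := eqVneq y' y; last first.
  rewrite t_eltE -mulrA mulr_suml mulr_sumr big1 ?/ppair ?pairing0 // => v' _.
  by rewrite -[[:: x; v'; y]]/(rcons [:: x; v'] y) pgenM0 ?mulr0 // eq_sym.
rewrite sum_triple_pgen // /ppair [LHS]pairing_sum.
rewrite -[RHS](ch.2 (size p') (p' ++ [:: x, y & q'])) face_cat; apply: eq_bigr => w _.
rewrite -/(ppair h _) ppair_pgen; [|exact: ch.1|by case: (p')].
rewrite between_two //; have [->|nz] := eqVneq (h (p' ++ [:: x, w, y & q'])) 0; first by rewrite mulr0.
have := ch.1 _ nz => /sorted_cat_cons/andP[-> /=/andP[-> _]].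
by rewrite mul1r.
Qed.

Lemma homog_pgen_sum n f : f \in homog (@gr_pr A) n ->
  f = \sum_(s : n.+1.-tuple G) (ppair (unit_fun K (s : seq G)) f *: pgen s : balg K B).
Proof.
move=> /basis_homogP hf; apply/malgP => a.
have sumE : (\sum_(s : n.+1.-tuple G) (ppair (unit_fun K (s : seq G)) f *: pgen s : balg K B))@_a =
    \sum_(s : n.+1.-tuple G) ppair (unit_fun K (s : seq G)) f * (pverts a == s)%:R.
  rewrite raddf_sum; apply: eq_bigr => s _ /=; rewrite mcoeffZ; congr (_ * _).
  have [ps|nps] := boolP (sorted e s); last first.
    rewrite pgen_out // mcoeff0; case: eqP => // ea; case/negP: nps.
    by rewrite -ea; apply: (valP a).
  case es : (tval s) ps => [|x s'] ps; first by have := size_tuple s; rewrite es.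
  have [u eu] := gpath_exists ps; rewrite -eu pgen_path mcoeffU.
  by congr ((nat_of_bool _)%:R); rewrite (inj_eq pverts_inj) eq_sym.
rewrite sumE; have [da|na] := eqVneq (plen a) n; last first.
  rewrite hf // big1 // => s _; case: eqP => [ea|]; last by rewrite mulr0.
  by case/eqP: na; have := size_tuple s; rewrite -ea /pverts /= => -[].
have sa : size (pverts a) == n.+1 by rewrite /= -da.
rewrite (bigD1 (Tuple sa)) //= eqxx mulr1 big1 ?addr0 => [|s ns]; last first.
  by case: eqP => [ea|]; [case/eqP: ns; apply: val_inj; rewrite /= ea | rewrite mulr0].
rewrite /ppair /pairing; apply/esym; apply: etrans (sum_msupp1 f (P := pred1 a) _) => //.
Qed.

Lemma dist_unit_step : unit_step (@dist G) =2 e.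
Proof. by move=> x y; rewrite /unit_step dist_eq1. Qed.

Lemma cyc_cocycle n (w : n.+1.-tuple G -> K) : cyc (@dist G) w -> cocycle (extend w).
Proof.
case=> us w0; split=> // s; rewrite /extend; case: insubP => [p _ <-|_]; last by rewrite eqxx.
by move/us; rewrite (eq_sorted dist_unit_step).
Qed.

(** The functions killed by f contain N_n, so f is a combination of the
    equations that define N_n. The equation of a face is a multiple of a
    relation t_(x,y) if the two sides of the gap are at distance two; otherwise
    no insertion there is a path. *)
Lemma ppair_ideal n f : f \in homog (@gr_pr A) n ->
  (forall w : n.+1.-tuple G -> K, cyc (@dist G) w -> ppair (extend w) f = 0) ->
  ideal_gen (@t_rel G K) f.
Proof.
move=> hf h0; have hI := ideal_gen_ideal (@t_rel G K).
have IZ k a : ideal_gen (@t_rel G K) a -> ideal_gen (@t_rel G K) (k *: (a : balg K B) : balg K B).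
  move=> Ia; have -> : (k *: (a : balg K B) : balg K B) = (k *: (1 : balg K B) : balg K B) * a.
    by rewrite [RHS]balg_scaleAl mul1r.
  exact: (idealMl hI).
have lin : linear_functional (fun w : n.+1.-tuple G -> K => ppair (extend w) f).
  move=> a u v; rewrite /ppair -pairing_linear; apply: eq_bigr => p _; congr (_ * _).
  by rewrite /extend; case: insub => //; rewrite mulr0 addr0.
have [|a ea] := fredholm (@cyc_condition_linear K G (@dist G) n) lin.
  by move=> w cw; apply: h0; apply/cycP.
have -> : f = \sum_c (a c *: (\sum_(s : n.+1.-tuple G)
    (cyc_condition (@dist G) c (unit_fun K s) *: pgen s : balg K B)) : balg K B).
  rewrite [LHS](homog_pgen_sum hf); under [RHS]eq_bigr => c _ do rewrite scaler_sumr.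
  rewrite [RHS]exchange_big; apply: eq_bigr => s _ /=.
  have e1 : ppair (unit_fun K (s : seq G)) f = \sum_c a c * cyc_condition (@dist G) c (unit_fun K s).
    rewrite -ea; congr ppair; apply/funext => t; rewrite /extend /unit_fun.
    case: insubP => [u _ <-|nt]; first by rewrite val_eqE.
    by case: eqP => // et; move: nt; rewrite et size_tuple eqxx.
  rewrite e1; apply: etrans (scaler_suml _ _ _ _) _; apply: eq_bigr => c _.
  by rewrite scalerA.
apply: (ideal_sum hI) => c _; apply: IZ; case: c => [p|[i s]] /=.
  rewrite big1; first exact: ideal0.
  move=> s _; case: ifPn => nu; first by rewrite scale0r.
  rewrite /unit_fun; have [<-|_] := eqVneq p s; last by rewrite scale0r.
  by rewrite pgen_out ?scaler0 // -(eq_sorted dist_unit_step).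
have [lt|ge] := ltnP i.+1 (size (tval s)); last first.
  by rewrite big1; [exact: ideal0 | move=> t _; rewrite face_oversize // scale0r].
have [p [x [y [q [es ep]]]]] := gap_split lt.
have sz v : size (p ++ [:: x, v, y & q]) == n.+1.
  by have := size_tuple s; rewrite es !size_cat /= !addnS => ->.
have -> : \sum_(t : n.+1.-tuple G) (face (@dist G) i (extend (unit_fun K t)) (tval s) *: pgen t : balg K B) =
    \sum_v ((between (@dist G) x v y)%:R *: pgen (p ++ [:: x, v, y & q]) : balg K B).
  under eq_bigr => t _ do rewrite es -ep face_cat scaler_suml.
  rewrite exchange_big; apply: eq_bigr => v _ /=.
  rewrite (bigD1 (Tuple (sz v))) //= big1 ?addr0 => [|t nt].
    by rewrite -[p ++ _]/(tval (Tuple (sz v))) extendE /unit_fun eqxx mulr1.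
  by rewrite -[p ++ _]/(tval (Tuple (sz v))) extendE /unit_fun eq_sym (negbTE nt) mulr0 scale0r.
have [exy|nxy] := eqVneq (dist x y) (Some 2%N).
  have It : ideal_gen (@t_rel G K) (t_elt K x y) by move=> J hJ; apply; exists x, y.
  have := Defs.idealMr hI (pgen (y :: q)) (Defs.idealMl hI (pgen (rcons p x)) It).
  congr ideal_gen; apply/esym.
  rewrite sum_triple_pgen //; apply: eq_bigr => v _; rewrite between_two //.
  case: (boolP (e x v && e v y)) => [_|nb]; first by rewrite scale1r.
  rewrite scale0r pgen_out //; apply: contraNN nb => /sorted_cat_cons/andP[-> /= /andP[-> _]].
  by [].
rewrite big1; first exact: ideal0.
move=> v _; case bt: between; last by rewrite scale0r.
rewrite pgen_out ?scaler0 //; apply: contraNN nxy => /sorted_cat_cons/andP[exv /= /andP[evy _]].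
case/(betweenP (dist_metric G)): bt => m1 [m2 [e1 e2 ->]].
move: exv evy; rewrite -!dist_eq1 e1 e2 => /eqP[->] /eqP[->].
by [].
Qed.

End PathAlgebra.

(** * The Koszul complex at a fixed vertex and level *)

Section Levels.
Variables (K : fieldType) (V : finType) (d : V -> V -> option nat).
Hypothesis dM : is_metric d.
Local Notation kap := (koszul_diff d).
Local Notation koszul_cycle := (koszul_cycle d).
Local Notation fc := (face d).
Implicit Types (g h : seq V -> V -> K) (x z v : V) (s : seq V).

(** The differential at one target z, where an element is a single function. *)
Definition kapz k z (w : k.+1.-tuple V -> K) s : K := kap (fun t _ => extend w t) s z.

(** The elements of N_k supported on the paths whose end is at distance n from
    z; the differential raises this distance by one. *)
Definition level k n z (w : k.+1.-tuple V -> K) :=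
  cyc d w /\ forall p, w p != 0 -> d (lastt p) z = Some n.

(** Exactness at the functions on paths with k+1 arrows, one target and one
    level at a time. *)
Definition level_exact k := forall n z (w : k.+2.-tuple V -> K), level n.+1 z w ->
  (forall s, kapz z w s = 0) ->
  exists w' : k.+3.-tuple V -> K, level n z w' /\ forall s, kapz z w' s = extend w s.

Lemma extend_neq0 n (w : n.-tuple V -> K) s : extend w s != 0 ->
  exists2 p : n.-tuple V, tval p = s & w p != 0.
Proof. by rewrite /extend; case: insubP => [p _ <- nz|]; [exists p | rewrite eqxx]. Qed.

Lemma level_extend k n z (w : k.+1.-tuple V -> K) s : level n z w ->
  extend w s != 0 -> dist_last d s z = Some n.
Proof. by case=> _ hw /extend_neq0[p <- /hw]; rewrite dist_last_tuple. Qed.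

Lemma kapz_neq0 k z (w : k.+1.-tuple V -> K) s : kapz z w s != 0 ->
  exists2 v, koszul_step d s v z & extend w (rcons s v) != 0.
Proof. exact: kap_neq0. Qed.

Lemma kapz_level k n z (w : k.+1.-tuple V -> K) s : level n z w -> kapz z w s != 0 ->
  dist_last d s z = Some n.+1.
Proof.
move=> lw /kapz_neq0[v /and3P[_ _ /eqP ->]] /(level_extend lw).
by rewrite dist_last_rcons => ->.
Qed.

Lemma kapz_linear k z s : linear_functional (fun w : k.+1.-tuple V -> K => kapz z w s).
Proof.
move=> a u v; rewrite /kapz /koszul_diff mulr_sumr -big_split; apply: eq_bigr => x _ /=.
rewrite /extend; case: insub => [p|]; last by rewrite !mulr0 addr0.
by rewrite mulrDr mulrCA.
Qed.

Lemma level_cycle k n z (w : k.+1.-tuple V -> K) : level n z w ->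
  koszul_cycle k (fun s z' => if z' == z then extend w s else 0).
Proof.
move=> lw; split=> [s z'|i s z']; last first.
  by case: (z' == z); [exact: lw.1.2 | exact: face_eq0].
have [->|_] := eqVneq z' z; last by rewrite eqxx.
move=> nz; rewrite (level_extend lw nz); have [p <- nw] := extend_neq0 nz.
by split=> //; [rewrite size_tuple | exact: lw.1.1].
Qed.

Lemma cycle_level k n z g : koszul_cycle k g ->
  level n z (fun p : k.+1.-tuple V => if d (lastt p) z == Some n then g p z else 0).
Proof.
move=> gK; split; last by move=> p; case: ifP => [/eqP//|_]; rewrite eqxx.
exact: (cyc_filter (fun x => d x z == Some n) (cyc_koszul_cycle gK z)).
Qed.

Lemma extend_cycle k n z g s : koszul_cycle k g ->
  extend (fun p : k.+1.-tuple V => if d (lastt p) z == Some n then g p z else 0) s =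
  if dist_last d s z == Some n then g s z else 0.
Proof.
move=> gK; rewrite /extend; case: insubP => [p _ <-|ns]; first by rewrite dist_last_tuple.
by case: ifP => // _; apply/esym/eqP; apply: contraNT ns => /gK.1[/eqP].
Qed.

Lemma kapz_cycle k n z g s : koszul_cycle k g ->
  kapz z (fun p : k.+1.-tuple V => if d (lastt p) z == Some n then g p z else 0) s =
  if dist_last d s z == Some n.+1 then kap g s z else 0.
Proof.
move=> gK; have [e|ne] := eqVneq (dist_last d s z) (Some n.+1); last first.
  by apply/eqP; apply: contraNT ne => /(kapz_level (cycle_level n z gK))->.
apply: eq_bigr => v _; rewrite extend_cycle // dist_last_rcons.
rewrite /koszul_step e /=; case: (d v z) => [m|] /=; rewrite ?andbF ?mul0r //.
have [->|ne] := eqVneq m n; first by rewrite eqxx.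
have -> : (Some n.+1 == Some (1 + m)%N) = false by apply/eqP => -[em]; case/eqP: ne; lia.
by rewrite andbF !mul0r.
Qed.

Lemma exact_level_exact k : (forall g, koszul_cycle k.+1 g -> (forall y z, kap g y z = 0) ->
    exists h, koszul_cycle k.+2 h /\ forall y z, kap h y z = g y z) -> level_exact k.
Proof.
move=> EX n z w lw kw; have [|h [hK hE]] := EX _ (level_cycle lw).
  move=> y z'; have [->|nz] := eqVneq z' z; last by apply: big1 => v _; rewrite (negbTE nz) mulr0.
  rewrite -[RHS](kw y); apply: eq_bigr => v _.
  by rewrite eqxx.
exists (fun p => if d (lastt p) z == Some n then h p z else 0); split; first exact: cycle_level.
move=> s; rewrite kapz_cycle // hE eqxx; case: eqP => // ne.
by apply/esym/eqP; apply: contraT => /(level_extend lw).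
Qed.

(** Elements at different levels are independent; the primitives are glued
    along the distance of the end of the path to z. *)
Lemma level_exact_exact k : level_exact k -> forall g, koszul_cycle k.+1 g ->
  (forall y z, kap g y z = 0) ->
  exists h, koszul_cycle k.+2 h /\ forall y z, kap h y z = g y z.
Proof.
move=> EX g gK kg.
have /choice[W HW] : forall zn : V * nat, exists w' : k.+3.-tuple V -> K,
    level zn.2 zn.1 w' /\ forall s, kapz zn.1 w' s =
    if dist_last d s zn.1 == Some zn.2.+1 then g s zn.1 else 0.
  case=> z n; have [|w' [lw' ew']] := EX n z _ (cycle_level n.+1 z gK).
    by move=> s; rewrite kapz_cycle // kg if_same.
  by exists w'; split=> // s; rewrite ew' extend_cycle.
pose h s z := if dist_last d s z is Some n then extend (W (z, n)) s else 0.
have hs s z : h s z != 0 -> exists2 n, dist_last d s z = Some n & extend (W (z, n)) s != 0.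
  by rewrite /h; case: dist_last => [n|]; [exists n | rewrite eqxx].
exists h; split; first split.
- move=> s z /hs[n e nz]; rewrite e; have [p ep nw] := extend_neq0 nz.
  by rewrite -ep size_tuple; split=> //; apply: (HW (z, n)).1.1.1 nw.
- move=> i s z; case e: (dist_last d s z) => [n|]; last first.
    apply: face_eq0 => p x y q v es _ _; rewrite /h.
    suff -> : dist_last d (p ++ [:: x, v, y & q]) z = None by [].
    by rewrite -e es; apply: dist_last_eq; rewrite ?size_cat ?addnS // => x0; rewrite !last_cat.
  rewrite -[RHS]((HW (z, n)).1.1.2 i s); apply: face_ext => p x y q v es _ _; rewrite /h.
  suff -> : dist_last d (p ++ [:: x, v, y & q]) z = Some n by [].
  by rewrite -e es; apply: dist_last_eq; rewrite ?size_cat ?addnS // => x0; rewrite !last_cat.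
move=> s z; case e: (dist_last d s z) => [[|n]|].
- rewrite [LHS]big1 => [|v _]; last first.
    by rewrite /koszul_step e; case: (d v z) => [m|]; rewrite ?andbF ?mul0r.
  apply/esym/eqP; apply: contraT => nz.
  have [ss us _] := gK.1 _ _ nz.
  case/lastP: s ss us nz e => // s x; case/lastP: s => // s v _ us nz.
  rewrite dist_last_rcons => /(metric_eq0 dM) exz.
  have := kap_degenerate dM g (y := rcons s v) (z := z).
  rewrite dist_last_rcons -exz (eqP (sorted_rcons2 us)) => /(_ erefl).
  by rewrite kg => /esym e0; move: nz; rewrite -exz e0 eqxx.
- have := (HW (z, n)).2 s; rewrite /= e eqxx => <-; apply: eq_bigr => v _.
  rewrite /koszul_step e /=; case ev: (d v z) => [m|]; rewrite ?andbF ?mul0r //=.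
  have [em|ne] := eqVneq m n; first by rewrite /h dist_last_rcons ev em.
  have -> : (Some n.+1 == Some (1 + m)%N) = false by apply/eqP => -[em]; case/eqP: ne; lia.
  by rewrite andbF !mul0r.
rewrite [LHS]big1 => [|v _]; last by rewrite /koszul_step e andbF mul0r.
by apply/esym/eqP; apply: contraT => /gK.1[_ _]; rewrite e.
Qed.

(** A path that ends at z is recovered by removing its last arrow. *)
Lemma level0_kapz k z (w : k.+2.-tuple V -> K) : level 0 z w ->
  (forall s, kapz z w s = 0) -> forall p, w p = 0.
Proof.
move=> lw kw s; apply/eqP; apply: contraT => nz.
have us := lw.1.1 _ nz; have := lw.2 _ nz => /(metric_eq0 dM) ez.
have nz' : extend w s != 0 by rewrite extendE.
case: s us nz {ez} nz' (level_extend lw nz') => s ss /= us nz.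
case/lastP: s ss us nz => // s x ss; case/lastP: s ss => // s v _ us _ nz.
rewrite dist_last_rcons => /(metric_eq0 dM) exz.
have := kap_degenerate dM (fun t _ => extend w t) (y := rcons s v) (z := z).
rewrite dist_last_rcons -exz (eqP (sorted_rcons2 us)) => /(_ erefl).
by rewrite exz [koszul_diff _ _ _ _]kw => /esym e0; move: nz; rewrite exz e0 eqxx.
Qed.

Lemma level_surjective n z (w : 1.-tuple V -> K) : level n.+1 z w ->
  exists w' : 2.-tuple V -> K, level n z w' /\ forall s, kapz z w' s = extend w s.
Proof.
move=> lw; have [|h [hK hE]] := koszul_exact0 dM (level_cycle lw).
  move=> y z'; have [->|_] := eqVneq z' z; last by rewrite eqxx.
  by move/(level_extend lw)->.
exists (fun p => if d (lastt p) z == Some n then h p z else 0); split; first exact: cycle_level.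
move=> s; rewrite kapz_cycle // hE eqxx; case: eqP => // ne.
by apply/esym/eqP; apply: contraT => /(level_extend lw).
Qed.

Lemma kapz_extend k z (w : k.+2.-tuple V -> K) s :
  extend (fun p : k.+1.-tuple V => kapz z w p) s = kapz z w s.
Proof.
rewrite /extend; case: insubP => [p _ <- //|ns]; apply/esym/eqP; apply: contraNT ns.
case/kapz_neq0 => v _ /extend_neq0[p ep _].
by have := size_tuple p; rewrite ep size_rcons => -[->].
Qed.

Lemma level_kapz k n z (w : k.+2.-tuple V -> K) : level n z w ->
  level n.+1 z (fun p : k.+1.-tuple V => kapz z w p).
Proof.
move=> lw; split=> [|p nz]; last first.
  by rewrite -dist_last_tuple; apply: kapz_level lw nz.
have := cyc_koszul_cycle (kap_cycle (level_cycle lw)) z.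
congr cyc; apply/funext => p; apply: eq_bigr => v _.
by rewrite eqxx.
Qed.

(** Solvability of the equation kapz w' = g inside a level, by the Fredholm
    alternative; only functionals killed by the image have to be tested. *)
Lemma level_solve k n z (g : k.+2.-tuple V -> K) :
  (forall a : k.+2.-tuple V -> K,
    (forall w', level n z w' -> \sum_p a p * kapz (k := k.+2) z w' p = 0) -> \sum_p a p * g p = 0) ->
  exists w' : k.+3.-tuple V -> K, level n z w' /\ forall s, kapz z w' s = extend g s.
Proof.
move=> hg; pose C := ((k.+3.-tuple V + 'I_k.+2 * k.+2.-tuple V) + k.+3.-tuple V + k.+2.-tuple V)%type.
pose F (c : C) (w : k.+3.-tuple V -> K) : K := match c with
  | inl (inl c') => cyc_condition d c' w
  | inl (inr p) => if d (lastt p) z == Some n then 0 else w p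
  | inr p => kapz z w p end.
pose rhs (c : C) : K := if c is inr p then g p else 0.
have linF c : linear_functional (F c).
  case: c => [[c|p]|p]; [exact: cyc_condition_linear | | exact: kapz_linear].
  by move=> b u v /=; case: ifP; rewrite ?mulr0 ?addr0.
have [|w' hw'] := @fredholm_solve K _ C F rhs linF; last first.
  exists w'; split; first split.
  - by apply/cycP => c; apply: (hw' (inl (inl c))).
  - move=> p nz; have := hw' (inl (inr p)); rewrite /F /=; case: eqP => // _ e0.
    by rewrite e0 eqxx in nz.
  move=> s; rewrite -kapz_extend; congr extend; apply/funext => p; exact: (hw' (inr p)).
move=> a ha; rewrite big_sumType /= big1 ?add0r => [|c _]; last by rewrite mulr0.
apply: hg => w' lw'; have := ha w'; rewrite big_sumType /= big1 ?add0r // => c _.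
case: c => [c|p] /=; first by rewrite (proj1 (cycP d w') lw'.1) mulr0.
case: ifP; first by rewrite mulr0.
by have [->|/lw'.2->] := eqVneq (w' p) 0; rewrite ?mulr0 ?eqxx.
Qed.

End Levels.

(** * Pairing with the path cochain algebra *)

Lemma exact_of_homog (A : gradedRing) (M' M N : gradedModule A)
    (g : {linear M' -> M}) (f : {linear M -> N}) : graded_hom f ->
  (forall i x, x \in homog (@gm_pr A M) i -> f x = 0 -> exists x', g x' = x) ->
  forall x, f x = 0 -> exists x', g x' = x.
Proof.
move=> hf ex x fx; have gM := gm_grading M; have [s _ ->] := grad_sum gM x.
apply: (big_ind (fun y => exists x', g x' = y)).
- by exists 0; rewrite linear0.
- by move=> _ _ [u <-] [v <-]; exists (u + v); rewrite linearD.
by move=> i _; apply: (ex i); [apply: homogP | rewrite hf fx (grad0 (gm_grading N))].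
Qed.

Lemma pairing_mulr (K : fieldType) (V : finType) (B : basis V) (h : B -> K) (f g : balg K B) :
  pairing h (f * g) = pairing (fun a => pairing h ((<< a >> : balg K B) * g)) f.
Proof.
rewrite {1}[f]balg_sumE mulr_suml pairing_sum; apply: eq_bigr => a _.
by rewrite balg_scaleAl pairingZ.
Qed.

Section QuotientPairing.
Variables (G : digraph) (K : fieldType).
Local Notation B := (path_basis G).
Local Notation A := (path_algebra G K).
Local Notation W := (path_cochain_algebra G K).
Local Notation e := (@arrow G).
Local Notation d := (@dist G).
Implicit Types (x y z v w : G) (s p q : seq G) (h : seq G -> K).

Definition pclass (a : A) : W := qclass (@t_rel G K) a.
Definition vclass x : W := pclass (pgen K [:: x]).
Definition eclass x v : W := pclass (pgen K [:: x; v]).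
(** Defined through representatives; for cocycles the choice does not
    matter. *)
Definition qpair h (q : W) : K := ppair h (qrepr q).

Lemma pclass_repr (q : W) : pclass (qrepr q) = q.
Proof. exact: qreprK. Qed.

Lemma pclassM a b : pclass a * pclass b = pclass (a * b).
Proof. by rewrite /pclass qclassM. Qed.

Lemma qpair_class h a : cocycle h -> qpair h (pclass a) = ppair h a.
Proof.
move=> hh; apply/eqP; rewrite -subr_eq0; apply/eqP.
rewrite -[RHS](ideal_ppair (f := qrepr (pclass a) - a) _ hh).
  by rewrite /ppair [RHS]pairingB.
by apply/qclassP; rewrite qreprK.
Qed.

Lemma qpair_linear k h h' (q : W) :
  qpair (fun s => k * h s + h' s) q = k * qpair h q + qpair h' q.
Proof. exact: pairing_linear. Qed.

Lemma qpairB h (p q : W) : cocycle h -> qpair h (p - q) = qpair h p - qpair h q.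
Proof.
move=> hh; have -> : p - q = pclass (qrepr p - qrepr q).
  by rewrite /pclass raddfB !qreprK.
by rewrite qpair_class //; exact: pairingB.
Qed.

Lemma qpair0 h : cocycle h -> qpair h 0 = 0.
Proof. by move=> hh; have := qpairB 0 0 hh; rewrite !subrr. Qed.

Lemma qpairD h (p q : W) : cocycle h -> qpair h (p + q) = qpair h p + qpair h q.
Proof.
move=> hh; have := qpairB p (- q) hh; rewrite opprK => ->.
by rewrite -[- q]sub0r qpairB // qpair0 // sub0r opprK.
Qed.

Lemma qpair_sum h (J : Type) (r : seq J) (P : pred J) (F : J -> W) : cocycle h ->
  qpair h (\sum_(j <- r | P j) F j) = \sum_(j <- r | P j) qpair h (F j).
Proof.
move=> hh; apply: (big_morph (qpair h)) => [p q|]; first exact: qpairD.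
exact: qpair0.
Qed.

Lemma pclass_homog n a : a \in homog (@gr_pr A) n -> pclass a \in homog (@gr_pr W) n.
Proof.
move=> ha; rewrite unfold_in /homog; apply/eqP; rewrite [LHS](qprE (@t_rel_homog G K)).
by rewrite (homogE ha).
Qed.

Lemma pclass_homogE n (q : W) : q \in homog (@gr_pr W) n ->
  exists2 a, a \in homog (@gr_pr A) n & q = pclass a.
Proof.
move=> hq; exists (gr_pr n (qrepr q)); first exact: (homogP (gr_grading A)).
by rewrite -{1}(homogE hq).
Qed.

(** Degree n of the quotient embeds in the dual of N_n. *)
Lemma qpair_inj n (q : W) : q \in homog (@gr_pr W) n ->
  (forall w : n.+1.-tuple G -> K, cyc d w -> qpair (extend w) q = 0) -> q = 0.
Proof.
case/pclass_homogE=> a ha -> h0; rewrite -[0](raddf0 (qclass (@t_rel G K))).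
apply/qclassP; rewrite subr0; apply: (ppair_ideal ha) => w cw.
by rewrite -(qpair_class _ (cyc_cocycle cw)) h0.
Qed.

Lemma pgen_homog s n : size s = n.+1 -> pgen K s \in homog (@gr_pr A) n.
Proof.
case: s => // x s [ss]; apply/basis_homogP => p np; rewrite /pgen mcoeff_bgen.
case: insubP => [u _ eu|] //=; case: eqP => // -[eup]; case/eqP: np.
by rewrite /= /plen -eup eu.
Qed.

Lemma vt0 x : vclass x \in homog (@gr_pr W) 0.
Proof. exact/pclass_homog/pgen_homog. Qed.

Lemma ed1 x v : eclass x v \in homog (@gr_pr W) 1.
Proof. exact/pclass_homog/pgen_homog. Qed.

Lemma vt_mul x y : vclass x * vclass y = if x == y then vclass x else 0.
Proof.
rewrite pclassM; have [<-|ne] := eqVneq x y; first by rewrite (pgenM K [::]).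
by rewrite (pgenM0 K [::]) // /pclass raddf0.
Qed.

Lemma vt_sum : \sum_x vclass x = 1.
Proof.
rewrite -[LHS](raddf_sum (qclass (@t_rel G K))); congr (qclass _ _).
apply: eq_bigr => x _; rewrite /pgen; case: insubP => [u _ eu|//] /=.
by congr (<< _ >>); apply: val_inj; rewrite eu.
Qed.

Lemma ed_mul_vt x v y : eclass x v * vclass y = if v == y then eclass x v else 0.
Proof.
rewrite pclassM; have [<-|ne] := eqVneq v y; first by rewrite (pgenM K [:: x]).
by rewrite (pgenM0 K [:: x]) // /pclass raddf0.
Qed.

Lemma ed_mul_ed x v w : eclass x v * eclass v w = pclass (pgen K [:: x; v; w]).
Proof. by rewrite pclassM (pgenM K [:: x]). Qed.

(** Multiplication on the right by a vertex or by an arrow, transposed to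
    functions on paths. *)
Definition restrict_last x h s : K := if last x s == x then h s else 0.
Definition extend_right x v h s : K := if last x s == x then h (rcons s v) else 0.

Lemma face_last h x i s : face d i (restrict_last x h) s = restrict_last x (face d i h) s.
Proof.
rewrite /restrict_last; case: ifP => ls.
  by apply: face_ext => p a b q u es _ _; move: ls; rewrite es !last_cat /= => ->.
by apply: face_eq0 => p a b q u es _ _; move: ls; rewrite es !last_cat /= => ->.
Qed.

Lemma restrict_last_cocycle h x : cocycle h -> cocycle (restrict_last x h).
Proof.
case=> hs h0; split=> [s|i s]; first by rewrite /restrict_last; case: ifP => _; [apply: hs | rewrite eqxx].
by rewrite face_last /restrict_last h0 if_same.
Qed.

Lemma extend_right_cocycle h x v : cocycle h -> cocycle (extend_right x v h).
Proof.
case=> hs h0; split=> [s|i s].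
  rewrite /extend_right; case: ifP => _; last by rewrite eqxx.
  by move/hs/(sorted_take (size s)); rewrite -cats1 take_size_cat.
rewrite [LHS](face_last (fun t => h (rcons t v))) /restrict_last; case: ifP => // _.
have [lt|le] := ltnP i.+1 (size s); last exact: face_oversize.
rewrite -(@face_extended _ _ _ _ _ [:: v] h) ?h0 // => t _ _.
by rewrite cats1.
Qed.

Lemma ppair_mul_vt h a x : cocycle h -> ppair h (a * pgen K [:: x]) = ppair (restrict_last x h) a.
Proof.
move=> hh; rewrite /ppair pairing_mulr; congr pairing; apply/funext => u.
rewrite -pgen_path -/(ppair h _); have : pverts u != [::] by [].
case/lastP: (pverts u) => // p y _; rewrite /restrict_last last_rcons.
have [<-|ne] := eqVneq y x; last by rewrite pgenM0 // /ppair pairing0.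
by rewrite pgenM cats1 ppair_pgen //; [apply: hh.1 | case: p].
Qed.

Lemma ppair_mul_ed h a x v : cocycle h ->
  ppair h (a * pgen K [:: x; v]) = ppair (extend_right x v h) a.
Proof.
move=> hh; rewrite /ppair pairing_mulr; congr pairing; apply/funext => u.
rewrite -pgen_path -/(ppair h _); have : pverts u != [::] by [].
case/lastP: (pverts u) => // p y _; rewrite /extend_right last_rcons.
have [<-|ne] := eqVneq y x; last by rewrite pgenM0 // /ppair pairing0.
rewrite pgenM -[p ++ _](_ : rcons (rcons p y) v = _); last by rewrite -!cats1 -catA.
by rewrite ppair_pgen //; [apply: hh.1 | case: (p)].
Qed.

Lemma qpair_vt h (q : W) x : cocycle h -> qpair h (q * vclass x) = qpair (restrict_last x h) q.
Proof.
move=> hh; rewrite -[q]pclass_repr pclassM qpair_class // ppair_mul_vt //.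
by rewrite [RHS]qpair_class //; apply: restrict_last_cocycle.
Qed.

Lemma qpair_ed h (q : W) x v : cocycle h -> qpair h (q * eclass x v) = qpair (extend_right x v h) q.
Proof.
move=> hh; rewrite -[q]pclass_repr pclassM qpair_class // ppair_mul_ed //.
by rewrite [RHS]qpair_class //; apply: extend_right_cocycle.
Qed.

End QuotientPairing.

(** * The linear complex of the path cochain algebra *)

Section CochainComplex.
Variables (G : digraph) (K : fieldType).
Local Notation W := (path_cochain_algebra G K).
Local Notation e := (@arrow G).
Local Notation d := (@dist G).
Local Notation I := (G * G)%type.
Implicit Types (x y z v w : G) (i j : I).

Let dM := dist_metric G.

(** The pair (x, z) carries the summand (K G / T) e_x if z is at distance n
    from x, and nothing otherwise. *)
Definition wmat n i j : W :=
  if (i == j) && (d j.1 j.2 == Some n) then vclass K j.1 else 0.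

(** An arrow from x to a vertex at distance n from z, one step closer. *)
Definition wdiff_mat n i j : W :=
  if [&& i.2 == j.2, e i.1 j.1, d i.1 i.2 == Some n.+1 & d j.1 j.2 == Some n]
  then eclass K i.1 j.1 else 0.

Lemma wmat0 n i j : wmat n i j \in homog (@gr_pr W) 0.
Proof.
by rewrite /wmat; case: ifP => _; [exact: vt0 | rewrite unfold_in /homog (grad0 (gr_grading W))].
Qed.

Lemma wdiff_mat1 n i j : wdiff_mat n i j \in homog (@gr_pr W) 1.
Proof.
by rewrite /wdiff_mat; case: ifP => _; [exact: ed1 | rewrite unfold_in /homog (grad0 (gr_grading W))].
Qed.

Lemma sum_wmat n (a : I -> W) j :
  \sum_i a i * wmat n i j = if d j.1 j.2 == Some n then a j * vclass K j.1 else 0.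
Proof.
rewrite (bigD1 j) //= big1 ?addr0 => [|i ni]; last by rewrite /wmat (negbTE ni) mulr0.
by rewrite /wmat eqxx /=; case: ifP; rewrite ?mulr0.
Qed.

Lemma wmat_idem n i k : \sum_j wmat n i j * wmat n j k = wmat n i k.
Proof.
rewrite sum_wmat /wmat; case: (d k.1 k.2 == Some n); last by rewrite andbF.
by rewrite !andbT; case: (i == k); rewrite ?mul0r // vt_mul eqxx.
Qed.

Lemma wdiff_mat_wmat n i k : \sum_j wdiff_mat n i j * wmat n j k = wdiff_mat n i k.
Proof.
rewrite sum_wmat /wdiff_mat; case: (d k.1 k.2 == Some n); last by rewrite !andbF.
by case: ifP; rewrite ?mul0r // ed_mul_vt eqxx.
Qed.

Lemma rfv_vt n (f : rf (wmat n)) j : rfv f j =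
  if d j.1 j.2 == Some n then rfv f j * vclass K j.1 else 0.
Proof. by rewrite {1}rfE sum_wmat. Qed.

Lemma wdiff_exists n : exists D : {linear rf (wmat n.+1) -> rf (wmat n)},
  forall f j, rfv (D f) j = \sum_i rfv f i * wdiff_mat n i j.
Proof.
apply: rf_map_exists => f k; under [RHS]eq_bigr => j _ do rewrite mulr_suml.
rewrite exchange_big; apply: eq_bigr => i _.
by rewrite -[in LHS]wdiff_mat_wmat mulr_sumr; apply: eq_bigr => j _; rewrite mulrA.
Qed.

Definition wgmod n : gradedModule W := rf_gmod n (wmat0 n).
Definition wdiff n : {linear wgmod n.+1 -> wgmod n} := projT1 (cid (wdiff_exists n)).

Lemma wdiffE n (f : rf (wmat n.+1)) j :
  rfv (wdiff n f : rf (wmat n)) j = \sum_i rfv f i * wdiff_mat n i j.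
Proof. by rewrite /wdiff; case: cid. Qed.

Definition waug : {linear wgmod 0 -> deg0_gmod W} :=
  projT1 (cid (rf_augmentation_exists (wmat 0))).

Lemma waugE (f : rf (wmat 0)) : val (waug f : deg0 W) = \sum_i gr_pr 0 (rfv f i).
Proof. by rewrite /waug; case: cid. Qed.

Lemma waug_diag (f : rf (wmat 0)) y : val (waug f : deg0 W) * vclass K y = gr_pr 0 (rfv f (y, y)).
Proof.
have gW := gr_grading W.
have e1 i : gr_pr 0 (rfv f i) * vclass K y = if i == (y, y) then gr_pr 0 (rfv f (y, y)) else 0.
  rewrite -gr_pr_mulr0 ?vt0 // rfv_vt; case: i => x z; rewrite -[(x, z).1]/x -[(x, z).2]/z.
  case: (d x z =P _) => [/dist_eq0<-|ne]; last first.
    rewrite mul0r (grad0 gW); case: ifP => // /eqP[ex ez]; case: ne; rewrite ex ez; exact: dist_xx.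
  rewrite -mulrA vt_mul; case: (x =P y) => [->|ne]; last first.
    by rewrite mulr0 (grad0 gW); case: ifP => // /eqP[ex _]; case: ne.
  by rewrite eqxx [rfv f (y, y) in RHS]rfv_vt dist_xx eqxx.
rewrite waugE mulr_suml; under eq_bigr => i _ do rewrite e1.
by rewrite -big_mkcond big_pred1_eq.
Qed.

Lemma waug_sum (f : rf (wmat 0)) : val (waug f : deg0 W) = \sum_y gr_pr 0 (rfv f (y, y)).
Proof.
rewrite -[LHS]mulr1 -(vt_sum G K) mulr_sumr; apply: eq_bigr => y _; exact: waug_diag.
Qed.

(** The middle vertices of the paths of two arrows from x to w all lie on a
    geodesic to z, so the sum is the whole relation t_(x,w). *)
Lemma two_step_sum n x w z : d x z = Some n.+2 -> d w z = Some n ->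
  \sum_v (if [&& e x v, e v w & d v z == Some n.+1] then eclass K x v * eclass K v w else 0) = 0.
Proof.
move=> exz ewz; have [exw|nxw] := eqVneq (d x w) (Some 2%N).
  transitivity (\sum_v eclass K x v * eclass K v w).
    apply: eq_bigr => v _; case: ifPn => // nb; rewrite ed_mul_ed pgen_out ?/pclass ?raddf0 //.
    apply: contraNN nb => /and3P[exv evw _]; rewrite exv evw /=.
    move: exv evw; rewrite -!dist_eq1 => /eqP exv /eqP evw.
    have [m evz le] := metric_triangle dM evw ewz.
    have [m' exz' le'] := metric_triangle dM exv evz.
    move: exz'; rewrite exz => -[em]; rewrite evz; apply/eqP; congr Some; lia.
  under eq_bigr => v _ do rewrite ed_mul_ed.
  rewrite -[LHS](raddf_sum (qclass (@t_rel G K))) -[RHS](raddf0 (qclass (@t_rel G K))).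
  by apply/qclassP; rewrite subr0 => J _; apply; exists x, w.
rewrite big1 // => v _; case: ifP => // /and3P[].
rewrite -!dist_eq1 => /eqP exv /eqP evw _; case/eqP: nxw.
have [m exw le] := metric_triangle dM exv evw.
have [m' exz' le'] := metric_triangle dM exw ewz.
move: exz'; rewrite exz => -[em]; rewrite exw; congr Some; lia.
Qed.

Lemma wdiff_wdiff n q : wdiff n (wdiff n.+1 q) = 0.
Proof.
apply: rf_inj => -[w z]; rewrite rfv0 wdiffE.
under eq_bigr => i _ do rewrite wdiffE mulr_suml.
rewrite exchange_big big1 // => -[x z'] _ /=.
transitivity (rfv (q : rf (wmat n.+2)) (x, z') * \sum_i wdiff_mat n.+1 (x, z') i * wdiff_mat n i (w, z)).
  by rewrite mulr_sumr; apply: eq_bigr => i _; rewrite mulrA.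
case/boolP: [&& z' == z, d x z == Some n.+2 & d w z == Some n] => [/and3P[/eqP-> /eqP exz /eqP ewz]|nb].
  suff -> : \sum_i wdiff_mat n.+1 (x, z) i * wdiff_mat n i (w, z) = 0 by rewrite mulr0.
  apply: etrans _ (two_step_sum exz ewz); apply: esym.
  transitivity (\sum_v \sum_(z' : G) wdiff_mat n.+1 (x, z) (v, z') * wdiff_mat n (v, z') (w, z)); last first.
    apply: etrans (pair_bigA _ (fun v z' => wdiff_mat n.+1 (x, z) (v, z') * wdiff_mat n (v, z') (w, z))) _.
    by apply: eq_bigr => -[].
  apply: eq_bigr => v _; rewrite [RHS](bigD1 z) //= big1 ?addr0 => [|z1 nz1]; last first.
    by rewrite /wdiff_mat /= eq_sym (negbTE nz1) mul0r.
  rewrite /wdiff_mat /= exz ewz !eqxx /=.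
  move: (eclass K x v) (eclass K v w) => a b.
  by case: (e x v); case: (e v w); case: (d v z == Some n.+1) => //=;
     first [exact: (esym (mul0r _)) | exact: (esym (mulr0 _))].
rewrite big1 ?mulr0 // => -[v z1] _; rewrite /wdiff_mat /=.
case: ifP => [/and4P[/eqP<- _ exz _]|_]; last by rewrite mul0r.
case: ifP => [/and4P[/eqP ez _ _ ewz]|_]; last by rewrite mulr0.
by move: nb; rewrite ewz -ez exz eqxx.
Qed.

Lemma cochain_linear_complex : linear_complex wdiff waug.
Proof.
have gW := gr_grading W.
split.
- by move=> n; apply: rf_graded_basis => i k; apply: wmat_idem.
- move=> n; apply: (@rf_map_graded W _ _ _ _ (wmat0 n.+1) (wmat0 n) n (wdiff_mat n)).
    exact: wdiff_mat1.
  exact: wdiffE.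
- by apply: rf_augmentation_graded => f; apply: waugE.
- exact: wdiff_wdiff.
- move=> f; apply: val_inj; rewrite waugE big1 // => j _.
  rewrite wdiffE (grad_bigsum gW) big1 // => i _.
  by rewrite deg0_prM -(homogE (wdiff_mat1 0 i j)) (gradK gW) mulr0.
move=> s; have [|f ef] := @rf_exists W I (wmat 0) (fun i => if i.1 == i.2 then val s * vclass K i.1 else 0).
  move=> j; rewrite sum_wmat; case: (j.1 =P j.2) => [<-|ne].
    by rewrite dist_xx eqxx -mulrA vt_mul eqxx.
  by rewrite mul0r if_same.
have hs : val s \in homog (@gr_pr W) 0 := valP s.
exists f.
  rewrite -[0]/((0 + 0)%N%:Z); apply/rf_homogP => i; rewrite ef.
  by case: ifP => _; [exact: (gr_mul hs (vt0 K i.1)) | rewrite unfold_in /homog (grad0 gW)].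
apply: val_inj; rewrite waug_sum -[RHS]mulr1 -(vt_sum G K) mulr_sumr.
apply: eq_bigr => y _; rewrite ef eqxx; exact: homogE (gr_mul hs (vt0 K y)).
Qed.

(** The relations start in degree two, so the part of degree zero is the
    algebra of functions on the vertices. *)
Lemma cochain_algebra_semisimple : semisimple_ring (deg0 W).
Proof.
have deg0E (s : W) : s \in homog (@gr_pr W) 0 ->
    exists c : G -> K, s = pclass (\sum_x (c x *: pgen K [:: x] : balg K (path_basis G))).
  case/pclass_homogE => a /homog_pgen_sum ha ->.
  exists (fun x => ppair (unit_fun K [:: x]) a); rewrite {1}ha; congr pclass.
  rewrite (reindex (fun x => [tuple x])) //=.
  exists (@lastt G 0) => [x _|t _]; first by rewrite -(last_tuple _ x).
  by apply: val_inj; case: t => -[|a0 [|b0 t]] //= st; rewrite /lastt (tnth_nth a0).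
have mulr_vt c x : pclass (\sum_y (c y *: pgen K [:: y] : balg K (path_basis G))) * vclass K x =
    pclass (c x *: pgen K [:: x] : balg K (path_basis G)).
  rewrite pclassM mulr_suml (bigD1 x) //= big1 ?addr0 => [|y ny].
    by congr pclass; rewrite balg_scaleAl (pgenM K [::]).
  by rewrite balg_scaleAl (pgenM0 K [::]) // scaler0.
have mull_vt c x : vclass K x * pclass (\sum_y (c y *: pgen K [:: y] : balg K (path_basis G))) =
    pclass (c x *: pgen K [:: x] : balg K (path_basis G)).
  rewrite pclassM mulr_sumr (bigD1 x) //= big1 ?addr0 => [|y ny].
    by congr pclass; rewrite balg_scaleAr (pgenM K [::]).
  by rewrite balg_scaleAr (pgenM0 K [::]) ?scaler0 // eq_sym.
apply: (deg0_semisimple (vt0 K)).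
- exact: vt_mul.
- exact: vt_sum.
- by move=> s x /deg0E[c ->]; rewrite mulr_vt mull_vt.
move=> s x /deg0E[c ->]; rewrite mulr_vt => nz.
have cn : c x != 0 by apply: contraNneq nz => ->; rewrite scale0r /pclass raddf0.
exists (pclass ((c x)^-1 *: pgen K [:: x] : balg K (path_basis G))).
  apply: pclass_homog; apply/basis_homogP => p np; rewrite mcoeffZ.
  by have /basis_homogP -> := @pgen_homog G K [:: x] 0 erefl; rewrite ?mulr0.
rewrite pclassM; congr pclass; rewrite balg_scaleAl balg_scaleAr (pgenM K [::]).
by rewrite scalerA mulVf // scale1r.
Qed.

End CochainComplex.

(** * Exactness by duality *)

Section CochainExactness.
Variables (G : digraph) (K : fieldType).
Local Notation W := (path_cochain_algebra G K).
Local Notation e := (@arrow G).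
Local Notation d := (@dist G).
Local Notation I := (G * G)%type.
Local Notation wgmod := (@wgmod G K).
Local Notation wdiff := (@wdiff G K).
Local Notation waug := (@waug G K).
Implicit Types (x y z v w : G) (i j : I).

Let dM := dist_metric G.
Let gW := gr_grading W.
Let lc := cochain_linear_complex G K.

(** An element of degree n + k defines for each z a functional on the level n
    of N_k. *)
Definition level_pairing n k (f : rf (wmat K n)) z (w : k.+1.-tuple G -> K) : K :=
  \sum_x qpair (extend w) (rfv f (x, z)).

Lemma level_pairing_linear n k (f : rf (wmat K n)) z : linear_functional (@level_pairing n k f z).
Proof.
move=> a u v; rewrite /level_pairing mulr_sumr -big_split; apply: eq_bigr => x _ /=.
rewrite -qpair_linear; congr qpair; apply/funext => s.
by rewrite /extend; case: insub => //; rewrite mulr0 addr0.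
Qed.

Lemma level_pairingB n k (f f' : rf (wmat K n)) z (w : k.+1.-tuple G -> K) : cyc d w ->
  level_pairing (f - f') z w = level_pairing f z w - level_pairing f' z w.
Proof.
move=> cw; rewrite /level_pairing -sumrB; apply: eq_bigr => x _.
by rewrite rfvB qpairB //; exact: cyc_cocycle.
Qed.

Lemma qpair_rfv n k (f : rf (wmat K n)) x z (w : k.+1.-tuple G -> K) : cyc d w ->
  qpair (extend w) (rfv f (x, z)) = if d x z == Some n
  then qpair (restrict_last x (extend w)) (rfv f (x, z)) else 0.
Proof.
move=> /cyc_cocycle cw; rewrite {1}rfv_vt -[(x, z).1]/x -[(x, z).2]/z.
by case: ifP => _; [exact: qpair_vt | exact: qpair0].
Qed.

Lemma extend_filter k (w : k.+1.-tuple G -> K) (P : pred G) x s :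
  extend (fun p => if P (lastt p) then w p else 0) s = if P (last x s) then extend w s else 0.
Proof.
rewrite /extend; case: insubP => [p _ <-|_]; last by rewrite if_same.
by rewrite last_tuple.
Qed.

Lemma level_pairing_inj n k (f : rf (wmat K n)) : (f : wgmod n) \in homog (@gm_pr W (wgmod n)) (n + k)%:Z ->
  (forall z (w : k.+1.-tuple G -> K), level d n z w -> level_pairing f z w = 0) -> f = 0.
Proof.
move/rf_homogP => hf f0; apply: rf_inj => -[x z]; rewrite rfv0.
have [exz|nxz] := eqVneq (d x z) (Some n); last by rewrite rfv_vt /= (negbTE nxz).
apply: (qpair_inj (hf _)) => w cw; pose wx p := if lastt p == x then w p else 0.
have cwx : cyc d wx := cyc_fiber x cw.
rewrite -[RHS](f0 z wx); last first.
  by split=> // p; rewrite /wx; case: ifP => [/eqP->|_] //; rewrite eqxx.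
rewrite /level_pairing (bigD1 x) //= big1 ?addr0 => [|y ny].
  rewrite !qpair_rfv // exz eqxx; congr qpair; apply/funext => s.
  rewrite /restrict_last (extend_filter w (pred1 x) x) /=.
  by case: (last x s == x).
rewrite qpair_rfv //; case: ifP => // _.
have -> : restrict_last y (extend wx) = fun=> 0.
  apply/funext => s; rewrite /restrict_last (extend_filter w (pred1 x) y) /=.
  by case: eqP => // ->; rewrite (negbTE ny).
rewrite /qpair /ppair /pairing big1 // => a _; exact: mulr0.
Qed.

(** The differential of modules is the transpose of the differential of
    levels. *)
Lemma level_pairing_wdiff n k (f : rf (wmat K n.+1)) z (w : k.+2.-tuple G -> K) : level d n z w ->
  level_pairing (wdiff n f : rf (wmat K n)) z w = level_pairing f z (fun p : k.+1.-tuple G => kapz d z w p).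
Proof.
move=> lw; have cw := cyc_cocycle lw.1; have lk := level_kapz lw.
transitivity (\sum_v \sum_x \sum_z' qpair (extend w) (rfv f (x, z') * wdiff_mat K n (x, z') (v, z))).
  apply: eq_bigr => v _; rewrite wdiffE qpair_sum //.
  rewrite [RHS](pair_bigA _ (fun x z' => qpair (extend w) (rfv f (x, z') * wdiff_mat K n (x, z') (v, z)))).
  by apply: eq_bigr => -[].
rewrite exchange_big; apply: eq_bigr => x _ /=.
rewrite qpair_rfv; last exact: lk.1.
transitivity (\sum_v if [&& e x v, d x z == Some n.+1 & d v z == Some n]
    then qpair (extend_right x v (extend w)) (rfv f (x, z)) else 0).
  apply: eq_bigr => v _; rewrite (bigD1 z) //= big1 ?addr0 => [|z' nz]; last first.
    by rewrite /wdiff_mat /= (negbTE nz) mulr0 qpair0.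
  rewrite /wdiff_mat /= eqxx /=; case: ifP => _; first by rewrite qpair_ed.
  by rewrite mulr0 qpair0.
case exz: (d x z == Some n.+1); last first.
  by apply: big1 => v _; rewrite andbF.
rewrite /qpair /ppair /pairing.
transitivity (\sum_(a <- msupp (qrepr (rfv f (x, z)) : balg K (path_basis G)))
    \sum_v ((qrepr (rfv f (x, z)) : balg K (path_basis G))@_a *
      if e x v && (d v z == Some n) then extend_right x v (extend w) (pverts a) else 0)).
  rewrite [RHS]exchange_big; apply: eq_bigr => v _ /=.
  by case: ifP => _ //; rewrite big1 // => a _; rewrite mulr0.
apply: eq_bigr => a _; rewrite -mulr_sumr; congr (_ * _).
rewrite /restrict_last /extend_right; have : pverts a != [::] by [].
case/lastP: (pverts a) => // p y _; rewrite last_rcons kapz_extend.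
case: (y =P x) => [->|_]; last by rewrite big1 // => v _; rewrite if_same.
apply: eq_bigr => v _; rewrite /koszul_step !dist_last_rcons (eqP exz) dist_eq1.
have [->|nz] := eqVneq (extend w (rcons (rcons p x) v)) 0; first by rewrite mulr0 if_same.
have := level_extend lw nz; rewrite dist_last_rcons => -> /=.
by rewrite !eqxx !andbT; case: (e x v); rewrite ?mul1r ?mul0r.
Qed.

(** Every functional on a level is represented, since it extends to all
    functions on paths. *)
Lemma level_pairing_exists n k (a : G -> k.+1.-tuple G -> K) : exists2 f : rf (wmat K n),
    (f : wgmod n) \in homog (@gm_pr W (wgmod n)) (n + k)%:Z
  & forall z (w : k.+1.-tuple G -> K), level d n z w -> level_pairing f z w = \sum_p a z p * w p.
Proof.
pose u x z := \sum_(p : k.+1.-tuple G | lastt p == x)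
  (a z p *: pgen K p : balg K (path_basis G)).
have uv x z : (u x z : path_algebra G K) * pgen K [:: x] = u x z.
  rewrite mulr_suml; apply: eq_bigr => p /eqP lp; rewrite balg_scaleAl; congr (_ *: _).
  have := last_tuple p x; case/lastP: (tval p) (size_tuple p) => // q y _.
  by rewrite last_rcons lp => ->; rewrite pgenM cats1.
have [|f ef] := @rf_exists W I (wmat K n) (fun i => if d i.1 i.2 == Some n then pclass (u i.1 i.2) else 0).
  move=> i; rewrite sum_wmat; case: ifP => // _.
  by rewrite pclassM uv.
exists f.
  apply/rf_homogP => i; rewrite ef; case: ifP => _; last by rewrite unfold_in /homog (grad0 gW).
  apply: pclass_homog; apply/basis_homogP => b nb; rewrite raddf_sum big1 // => p _ /=.
  rewrite mcoeffZ; have /basis_homogP -> // := @pgen_homog G K p k (size_tuple p).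
  by rewrite mulr0.
move=> z w lw; have cw := cyc_cocycle lw.1.
transitivity (\sum_x \sum_(p : k.+1.-tuple G | lastt p == x) a z p * w p); last first.
  by rewrite [RHS](partition_big (@lastt G k) predT).
apply: eq_bigr => x _; rewrite ef /=; case: (d x z =P Some n) => [_|ne]; last first.
  rewrite qpair0 // big1 // => p /eqP lp; have [->|nz] := eqVneq (w p) 0; first by rewrite mulr0.
  by case: ne; rewrite -lp; apply: lw.2.
rewrite qpair_class // /ppair pairing_sum; apply: eq_bigr => p _.
rewrite pairingZ [pairing _ _]ppair_pgen ?extendE //; first by move/lw.1.1; rewrite (eq_sorted (@dist_unit_step G)).
by rewrite -size_eq0 size_tuple.
Qed.

(** By the Fredholm alternative a functional that vanishes on the kernel of
    kapz factors through kapz; the factor defines the primitive. *)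
Lemma level_pairing_lift n k (f : rf (wmat K n)) :
  (f : wgmod n) \in homog (@gm_pr W (wgmod n)) (n + k.+1)%:Z ->
  (forall z (w : k.+2.-tuple G -> K), level d n z w -> (forall s, kapz d z w s = 0) ->
     level_pairing f z w = 0) ->
  exists2 f' : rf (wmat K n.+1),
    (f' : wgmod n.+1) \in homog (@gm_pr W (wgmod n.+1)) (n.+1 + k)%:Z & wdiff n f' = f.
Proof.
move=> hf f0.
have /choice[a ha] : forall z, exists a : k.+1.-tuple G -> K,
    forall w : k.+2.-tuple G -> K, level d n z w -> level_pairing f z w = \sum_p a p * kapz d z w p.
  move=> z; pose C := ((k.+2.-tuple G + 'I_k.+1 * k.+1.-tuple G) + k.+2.-tuple G + k.+1.-tuple G)%type.
  pose F (c : C) (w : k.+2.-tuple G -> K) : K := match c with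
    | inl (inl c') => cyc_condition d c' w
    | inl (inr p) => if d (lastt p) z == Some n then 0 else w p
    | inr p => kapz d z w p end.
  have linF c : linear_functional (F c).
    case: c => [[c|p]|p]; [exact: cyc_condition_linear | | exact: kapz_linear].
    by move=> b u v /=; case: ifP; rewrite ?mulr0 ?addr0.
  have [|a ea] := fredholm linF (@level_pairing_linear n k.+1 f z).
    move=> w h; apply: f0 => [|s].
      split=> [|p nz]; first by apply/cycP => c; apply: (h (inl (inl c))).
      have := h (inl (inr p)); rewrite /F; case: eqP => // _ e0.
      by rewrite e0 eqxx in nz.
    rewrite -kapz_extend /extend; case: insubP => // p _ _; exact: (h (inr p)).
  exists (fun p => a (inr p)) => w lw; rewrite ea big_sumType /= big1 ?add0r // => c _.
  case: c => [c|p] /=; first by rewrite (proj1 (cycP d w) lw.1) mulr0.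
  case: ifP; first by rewrite mulr0.
  by have [->|/lw.2->] := eqVneq (w p) 0; rewrite ?mulr0 ?eqxx.
have [f' hf' ef'] := @level_pairing_exists n.+1 k a.
exists f' => //; apply/eqP; rewrite -subr_eq0; apply/eqP.
have hD : wdiff n f' \in homog (@gm_pr W (wgmod n)) (n + k.+1)%:Z.
  by have := @graded_hom_homog _ (wgmod n.+1) (wgmod n) (wdiff n) _ _ (@lc_hd _ _ _ _ lc n) hf'; rewrite addSnnS.
apply: (@level_pairing_inj n k.+1).
  by rewrite unfold_in /homog (gradB (gm_grading (wgmod n))) (homogE hf) (homogE hD).
move=> z w lw; rewrite level_pairingB ?level_pairing_wdiff //; last exact: lw.1.
by rewrite ef' ?ha ?subrr //; apply: (level_kapz).
Qed.

Lemma level_pairing0 n k z (w : k.+1.-tuple G -> K) : cyc d w -> level_pairing (0 : rf (wmat K n)) z w = 0.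
Proof.
move=> cw; apply: big1 => x _; rewrite rfv0 qpair0 //; exact: cyc_cocycle.
Qed.

Lemma level_pairing_eq0 n k (f : rf (wmat K n)) z (w : k.+1.-tuple G -> K) :
  (forall p, w p = 0) -> level_pairing f z w = 0.
Proof.
move=> w0; rewrite -[RHS](linear_functional0 (@level_pairing_linear n k f z)).
by congr level_pairing; apply/funext.
Qed.

Lemma waug_inj (f : wgmod 0) : f \in homog (@gm_pr W (wgmod 0)) 0 -> waug f = 0 -> f = 0.
Proof.
move=> hf f0; have {}hf : f \in homog (rf_pr 0 (@wmat0 G K 0)) (0 + 0)%:Z by [].
move/rf_homogP: hf => hf; apply: rf_inj => -[x z]; rewrite rfv0 rfv_vt /=.
case: ifP => // /eqP/dist_eq0<-; rewrite -(homogE (hf _)) -waug_diag f0.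
by rewrite mul0r mul0r.
Qed.

(** Each function on vertices at level n+1 is in the image of kapz, on which
    the functional of a cycle vanishes. *)
Lemma wdiff_inj n (f : wgmod n.+1) : f \in homog (@gm_pr W (wgmod n.+1)) n.+1%:Z ->
  wdiff n f = 0 -> f = 0.
Proof.
move=> hf f0; apply: (@level_pairing_inj n.+1 0); first by rewrite addn0.
move=> z w lw; have [w' [lw' ew']] := level_surjective dM lw.
have <- : (fun p : 1.-tuple G => kapz d z w' p) = w.
  by apply/funext => p; rewrite ew' extendE.
by rewrite -level_pairing_wdiff // f0 level_pairing0 //; apply: lw'.1.
Qed.

(** The kernel of kapz at level zero is trivial, so every functional lifts. *)
Lemma waug_lift k (f : wgmod 0) : f \in homog (@gm_pr W (wgmod 0)) k.+1%:Z ->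
  exists2 f', f' \in homog (@gm_pr W (wgmod 1)) k.+1%:Z & wdiff 0 f' = f.
Proof.
move=> hf; apply: (level_pairing_lift (k := k)) => // z w lw kw; apply: level_pairing_eq0.
exact: (level0_kapz dM lw kw).
Qed.

Lemma wdiff_lift n k (f : wgmod n.+1) : level_exact K d k ->
  f \in homog (@gm_pr W (wgmod n.+1)) (n.+1 + k.+1)%:Z -> wdiff n f = 0 ->
  exists2 f', f' \in homog (@gm_pr W (wgmod n.+2)) (n.+2 + k)%:Z & wdiff n.+1 f' = f.
Proof.
move=> EX hf f0; apply: (level_pairing_lift (k := k)) => // z w lw kw.
have [w' [lw' ew']] := EX n z w lw kw.
have <- : (fun p : k.+2.-tuple G => kapz d z w' p) = w.
  by apply/funext => p; rewrite ew' extendE.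
by rewrite -level_pairing_wdiff // f0 level_pairing0 //; apply: lw'.1.
Qed.

Theorem exact_koszul_cochain : (forall k, level_exact K d k) -> koszul W.
Proof.
move=> EX; apply: (exact_koszul lc (@cochain_algebra_semisimple G K)).
  apply: (exact_of_homog (lc_he lc)) => m f hf f0; case: (ltP m 0) => [lt|le].
    by exists 0; rewrite linear0 (rf_homog_lowP lt hf).
  have [[|k] em] := @int_shift 0 m le; rewrite em in hf.
    by exists 0; rewrite linear0 (waug_inj hf).
  by have [f' _ <-] := waug_lift hf; exists f'.
move=> n; apply: (exact_of_homog (@lc_hd _ _ _ _ lc n)) => m f hf f0.
case: (ltP m n.+1%:Z) => [lt|le].
  have -> : f = 0 := @rf_homog_lowP W I (wmat K n.+1) n.+1 (@wmat0 G K n.+1) m f lt hf.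
  by exists 0; apply: linear0.
have [[|k] em] := @int_shift n.+1 m le; rewrite em in hf.
  by rewrite addn0 in hf; exists 0; rewrite (wdiff_inj hf f0); exact: linear0.
by have [f' _ <-] := wdiff_lift (EX k) hf f0; exists f'.
Qed.

(** The functional a, placed at the single vertex z, is a cycle of the complex
    of modules; it is a boundary, hence vanishes on the kernel of kapz. *)
Theorem koszul_cochain_exact : koszul W -> level_exact K d 0 -> forall k, level_exact K d k.
Proof.
move=> kos EX0 k n z w lw kw.
have EX : forall n q, wdiff n q = 0 -> exists q', wdiff n.+1 q' = q.
  apply: (koszul_exact lc kos waug_inj wdiff_inj).
    by move=> f hf _; apply: waug_lift.
  move=> m f hf f0; have := @wdiff_lift m 0 f EX0; rewrite addn1 addn0.
  exact.
apply: level_solve => a aw.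
have [f hf ef] := @level_pairing_exists n.+1 k.+1 (fun z' p => if z' == z then a p else 0).
have [|f' ef'] := EX n f.
  have hD : wdiff n f \in homog (@gm_pr W (wgmod n)) (n + k.+2)%:Z.
    by have := @graded_hom_homog _ (wgmod n.+1) (wgmod n) (wdiff n) _ _ (@lc_hd _ _ _ _ lc n) hf; rewrite addSnnS.
  apply: (level_pairing_inj hD) => z' w' lw'; rewrite level_pairing_wdiff // ef; last exact: (level_kapz).
  have [ez|_] := eqVneq z' z; last by rewrite big1 // => p _; rewrite mul0r.
  by rewrite ez in lw' *; apply: aw.
have := ef z w lw; rewrite -ef' level_pairing_wdiff // level_pairing_eq0 // => e0.
by rewrite [RHS]e0; apply: eq_bigr => p _; rewrite eqxx.
Qed.

End CochainExactness.

(** * Congruences of paths *)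

Section PathCongruences.
Variable G : digraph.
Local Notation e := (@arrow G).
Local Notation d := (@dist G).
Local Notation tsc := (@two_short_congruent G).
Implicit Types (x y z v : G) (s t a b : seq G) (p q r : gpath G).

Lemma dist_path x s : path e x s -> exists2 m, d x (last x s) = Some m & (m <= size s)%N.
Proof.
move=> ps; have : connect e x (last x s) by apply/connectP; exists s.
rewrite dist_connect; case E: (d x (last x s)) => [m|//] _; exists m => //.
by have [_] := (distP _ _ _).1 E; apply; apply/has_pathP; exists s.
Qed.

Lemma geodesic_path x y m : d x y = Some m ->
  exists s, [/\ path e x s, last x s = y & size s = m].
Proof. by move/distP => [/has_pathP[s ps [ls ss]] _]; exists s. Qed.

Lemma pcat3_val q p q' r : pcat3 q p q' = Some r ->
  [/\ ptgt q = psrc p, ptgt p = psrc q' & val r = (psrc q, (val q).2 ++ (val p).2 ++ (val q').2)].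
Proof.
rewrite /pcat3; case E: (pcat q p) => [m|//] /= /pcat_val[em er].
case/pcat_val: E => [eq vm].
have tm : ptgt m = ptgt p by rewrite /ptgt vm /= last_cat -/(ptgt q) eq.
by split=> //; [rewrite -tm | rewrite er /psrc vm /= catA].
Qed.

Lemma pcat3_verts q p q' r : pcat3 q p q' = Some r ->
  pverts r = belast (psrc q) (val q).2 ++ pverts p ++ (val q').2.
Proof.
case/pcat3_val => eq _ er; rewrite /pverts er /= -!cat_cons [_ :: (val q).2]lastI.
by rewrite -/(ptgt q) eq cat_rcons.
Qed.

Lemma pcat3_ends q p q' r : pcat3 q p q' = Some r ->
  psrc r = psrc q /\ ptgt r = last (psrc q') (val q').2.
Proof.
case/pcat3_val => eq eq' er; split; first by rewrite /psrc er.
by rewrite /ptgt er /= !last_cat -/(ptgt q) eq -/(ptgt p) eq'.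
Qed.

Lemma connect_same_trans p q r : connect_same p q -> connect_same q r -> connect_same p r.
Proof. by case=> e1 e2 [e3 e4]; split; rewrite ?e1 ?e2. Qed.

(** An invariant of vertex sequences that takes equal values on p and q in
    every context is preserved by every concatenation. *)
Lemma invariant_congruence (T : Type) (f : seq G -> T) : congruence (fun p q =>
  [/\ connect_same p q, plen p = plen q
    & forall a b, f (a ++ pverts p ++ b) = f (a ++ pverts q ++ b)]).
Proof.
split=> [p|p q [[e1 e2] e3 e4]|p q r [c1 l1 f1] [c2 l2 f2]|p q []//|p p' q q' r r' [c l f1] E E'].
- by [].
- by split.
- by split; [exact: connect_same_trans c2 | rewrite l1 | move=> a b; rewrite f1].
split.
- have [a1 a2] := pcat3_ends E; have [b1 b2] := pcat3_ends E'.
  by split; rewrite ?a1 ?a2.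
- rewrite -[LHS]/(size (pverts r)).-1 -[RHS]/(size (pverts r')).-1.
  by rewrite (pcat3_verts E) (pcat3_verts E') !size_cat /= -!/(plen _) l.
by move=> a b; rewrite (pcat3_verts E) (pcat3_verts E') -!catA !(catA a) f1.
Qed.

(** Contexts given as vertex sequences come from contexts given as paths. *)
Lemma congruence_cat R a b p p' r r' : congruence R -> R p p' ->
  pverts r = a ++ pverts p ++ b -> pverts r' = a ++ pverts p' ++ b -> R r r'.
Proof.
move=> cR Rp er er'; have [cs ct] := congr_ends cR Rp.
have sr : sorted e (a ++ pverts p ++ b) by rewrite -er; exact: (valP r).
have [m em] : exists m : gpath G, pverts m = rcons a (psrc p).
  move: sr; rewrite sorted_cat_join; case: (a) => [|x a'] /andP[h _]; exact: gpath_exists.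
have [m' em'] : exists m' : gpath G, pverts m' = ptgt p :: b.
  apply: gpath_exists; move: sr; rewrite sorted_cat_join cat_path.
  by case/and3P.
have cat3 u w : psrc u = psrc p -> ptgt u = ptgt p -> pverts w = a ++ pverts u ++ b ->
    pcat3 m u m' = Some w.
  move=> us ut ew; have tm : ptgt m = psrc u.
    by rewrite us -[LHS]/(last (psrc m) (pverts m)) em last_rcons.
  have sw : sorted e (a ++ pverts u).
      by have : sorted e (pverts w) := valP w; rewrite ew catA => /cat_sorted2[].
  have [k ek] : exists k : gpath G, pverts k = a ++ pverts u.
    by move: sw; case: (a) => [|x a'] h; exact: gpath_exists.
  have vm : pverts m ++ (val u).2 = a ++ pverts u by rewrite em -us cat_rcons.
  rewrite /pcat3; have -> /= : pcat m u = Some k.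
    apply/pcat_val; split=> //.
    by move: vm; rewrite -ek /pverts /psrc /=; case: (val k) => k1 k2 [-> <-].
  apply/pcat_val; split.
    rewrite -[LHS]/(last (psrc u) (pverts k)) ek last_cat -[LHS]/(ptgt u) ut.
    by move: em' => [].
  move: ew; rewrite catA -ek; move: em' => [_ <-].
  by rewrite /pverts /psrc; case: (val w) => w1 w2 [-> ->].
apply: (congr_cat cR Rp (q := m) (q' := m')).
  exact: cat3.
by apply: cat3.
Qed.

Lemma tsc_congruence : congruence tsc.
Proof.
split.
- by move=> p R cR _; apply: congr_refl.
- by move=> p q h R cR g; apply: (congr_sym cR); apply: h.
- by move=> p q r h h' R cR g; apply: (congr_trans cR (h R cR g) (h' R cR g)).
- move=> p q h; have [] := h _ (invariant_congruence (fun=> tt)) _ => //.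
  move=> p' q' sp sq c _; split=> //; move: sp sq; rewrite /shortest => + sq.
  by case: c => [-> ->]; rewrite sq => -[].
- move=> p p' q q' r r' h E E' R cR g; exact: (congr_cat cR (h R cR g) E E').
Qed.

(** Among the shortest paths of length at most two with common ends, only the
    detours x v y and x v' y at distance two differ; so an invariant only has
    to be tested on these. *)
Lemma tsc_invariant (T : Type) (f : seq G -> T) p q : tsc p q ->
  (forall x v v' y a b, d x y = Some 2%N -> e x v -> e v y -> e x v' -> e v' y ->
     f (a ++ [:: x, v, y & b]) = f (a ++ [:: x, v', y & b])) ->
  [/\ connect_same p q, plen p = plen q & f (pverts p) = f (pverts q)].
Proof.
move=> h hf; suff [c l ff] : [/\ connect_same p q, plen p = plen q
    & forall a b, f (a ++ pverts p ++ b) = f (a ++ pverts q ++ b)].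
  by split=> //; have := ff [::] [::]; rewrite !cats0.
apply: (h _ (invariant_congruence f)) => {h} {}p {}q sp sq c le2.
have l : plen p = plen q.
  by move: sp sq; rewrite /shortest => + sq; case: c => [-> ->]; rewrite sq => -[].
split=> // a b; move: c sp l le2; rewrite /connect_same /shortest /plen /pverts /psrc /ptgt.
have := valP p; have := valP q; case: (val p) (val q) => [p1 p2] [q1 q2] /= pq pp [ep]; rewrite ep in pp *.
case: p2 pp => [|v [|y [|]]] //= pp; case: q2 pq => [|v' [|y' [|]]] //= pq.
- by move=> ->.
move=> ey; rewrite ey in pp *; move=> dxy _ _.
case/and3P: pq => e1 e2 _.
case/and3P: pp => e3 e4 _; exact: hf.
Qed.

Lemma tsc_two x v v' y p q : d x y = Some 2%N -> pverts p = [:: x; v; y] ->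
  pverts q = [:: x; v'; y] -> tsc p q.
Proof.
move=> dxy ep eq R cR g; have [sp tp lp] : [/\ psrc p = x, ptgt p = y & plen p = 2%N].
  by move: ep; rewrite /pverts /psrc /ptgt /plen => -[-> ->].
have [sq tq lq] : [/\ psrc q = x, ptgt q = y & plen q = 2%N].
  by move: eq; rewrite /pverts /psrc /ptgt /plen => -[-> ->].
by apply: g; rewrite /shortest /connect_same ?sp ?tp ?lp ?sq ?tq ?lq.
Qed.

Lemma shortestE x s p : pverts p = x :: s -> shortest p <-> d x (last x s) = Some (size s).
Proof. by rewrite /shortest /ptgt /plen /psrc => -[-> ->]. Qed.

(** Paths of length at most one are shortest, so a long subpath of length at
    most two has length two. *)
Lemma two_reducibleE p : two_reducible p <-> long p /\
  exists a x v y b, pverts p = a ++ [:: x, v, y & b] /\ d x y <> Some 2%N.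
Proof.
split=> -[lp h]; split=> //.
  case: h => r [/infixP[a [b eb]] lr le2]; move: lr le2 eb.
  rewrite /long /shortest /plen /ptgt /psrc /pverts; have := valP r.
  case: (val r) => x [|v [|y [|]]] //=.
  - by rewrite dist_xx.
  - by move=> /andP[exv _] []; apply/eqP; rewrite dist_eq1.
  by move=> _ nd _ eb; exists a, x, v, y, b; rewrite eb.
case: h => a [x [v [y [b [ep nd]]]]].
have sp : sorted e (a ++ [:: x, v, y & b]) by rewrite -ep; exact: (valP p).
have [r er] : exists r : gpath G, pverts r = [:: x; v; y].
  by apply: gpath_exists; move: sp; rewrite sorted_cat_join /= => /and4P[_ -> -> _].
exists r; split.
- by apply/infixP; exists a, b; rewrite ep er.
- by move/(shortestE er).
by rewrite /plen; move: er => [_ ->].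
Qed.

Lemma two_quasi_reducible_tsc p q : tsc p q -> two_quasi_reducible q -> two_quasi_reducible p.
Proof.
move=> h [lq [r [hr rr]]]; have [[c1 c2] l _] := tsc_invariant (f := fun=> tt) h (fun _ _ _ _ _ _ _ _ _ _ _ => erefl).
split; first by rewrite /long /shortest c1 c2 l.
exists r; split=> //; exact (congr_trans tsc_congruence h hr).
Qed.

End PathCongruences.

(** * Constancy along 2-short congruences *)

Lemma sum_rcons (R : nmodType) (V : finType) n (F : n.+1.-tuple V -> R) :
  \sum_p F p = \sum_(q : n.-tuple V) \sum_v F [tuple of rcons q v].
Proof.
under [RHS]eq_bigr => q _ do rewrite -sum_take.
rewrite exchange_big; apply: eq_bigr => p _ /=.
have st : size (take n p) == n by rewrite size_take size_tuple ltnSn.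
rewrite (bigD1 (Tuple st)) //= eqxx big1 ?addr0 // => q nq; case: eqP => // eq.
by case/eqP: nq; apply: val_inj; rewrite /= eq.
Qed.

Section ConstancyFromCongruence.
Variables (G : digraph) (K : fieldType).
Local Notation e := (@arrow G).
Local Notation d := (@dist G).
Implicit Types (x y v : G) (s b : seq G).

Let dM := dist_metric G.

Lemma extend_unit n (t : n.-tuple G) s : extend (unit_fun K t) s = (s == t)%:R.
Proof.
rewrite /extend /unit_fun; case: insubP => [u _ <-|nt]; first by rewrite val_eqE.
by case: eqP => // et; move: nt; rewrite et size_tuple eqxx.
Qed.

Lemma face_triple i x v y s : face d i (extend (unit_fun K [tuple x; v; y])) s =
  [&& i == 0%N, s == [:: x; y] & between d x v y]%:R.
Proof.
have [lt|le] := ltnP i.+1 (size s); last first.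
  by rewrite face_oversize //; case: i le => [|i] //; case: (s =P [:: x; y]) => // ->.
have [p [x0 [y0 [q [-> <-]]]]] := gap_split lt; rewrite face_cat.
under eq_bigr => u _ do rewrite extend_unit -natrM mulnb.
case: p => [|c p] /=; last first.
  rewrite big1 // => u _; by case: p => [|c' [|c2 [|c3 p]]]; rewrite /= !eqseq_cons !andbF.
case: q => [|c q]; last by rewrite big1 ?andbF ?eqseq_cons ?andbF // => u _; rewrite !eqseq_cons !andbF.
rewrite (bigD1 v) //= big1 ?addr0 => [|u nu]; last by rewrite !eqseq_cons (negbTE nu) !andbF.
rewrite !eqseq_cons !eqxx !andbT andbC; case: (x0 =P x) => //= ->; by case: (y0 =P y) => [->|].
Qed.

Lemma detour_shortens c s b x v y t : path e c s -> c :: s = b ++ [:: x, v, y & t] ->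
  d x y <> Some 2%N -> exists2 m, d c (last c s) = Some m & (m < size s)%N.
Proof.
move=> ps es nd.
have so : sorted e (b ++ [:: x, v, y & t]) by rewrite -es.
have ls : last c s = last y t by have := congr1 (last c) es; rewrite /= last_cat.
have [evx evy pt] : [/\ e x v, e v y & path e y t].
  by move: so; rewrite sorted_cat_join /= => /and4P[].
have [m2 e2 le2] := dist_path pt.
have [m1 e1 le1] : exists2 m1, d x y = Some m1 & (m1 < 2)%N.
  have pxy : path e x [:: v; y] by rewrite /= evx evy.
  have [m1 e1 le1] := dist_path pxy; exists m1 => //.
  by rewrite ltn_neqAle le1 andbT; apply/eqP => em; rewrite em in e1.
have [m0 e0 le0] : exists2 m0, d c x = Some m0 & (m0 + size t + 2 <= size s)%N.
  have := congr1 size es; rewrite size_cat /= => sz.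
  case: b es so sz => [[-> _] _ sz|c' b [<- es] so sz].
    by exists 0%N; [exact: dist_xx | move: sz => /=; lia].
  have pb : path e c (rcons b x) by move: so; rewrite sorted_cat_join => /andP[].
  have [m0 e0 le0] := dist_path pb; exists m0; first by rewrite -e0 last_rcons.
  by move: le0 sz; rewrite size_rcons /=; lia.
have [m3 e3 le3] := metric_triangle dM e0 e1.
have [m4 e4 le4] := metric_triangle dM e3 e2.
by exists m4; [rewrite ls | lia].
Qed.

(** Let a be a functional killed by the image. Testing it on one path x v y
    with d(x, y) <> 2, or on the difference of two such paths with d(x, y) = 2,
    shows that the value of a at the first arrow of a path of length n+2 to z,
    set to zero if its target is not at distance n+1 from z, is unchanged by
    2-short moves and vanishes on 2-reducible paths. By V_2 it vanishes when x
    is not at distance n+2 from z, and otherwise depends only on x; then a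
    pairs with w like a combination of the values of kappa on w. *)
Theorem property_V2_level_exact : property_V2 G -> level_exact K d 0.
Proof.
case=> V2s V2l n z w lw kw; apply: level_solve => a aw.
(* The invariant of a path of length n+2 to z: the functional at its first
   arrow, cut off outside the level. *)
pose value x v := if d v z == Some n.+1 then a [tuple x; v] else 0.
pose pathval s := if [&& size s == n.+3, sorted e s & last z s == z]
  then (if s is [:: x, v & _] then value x v else 0) else 0.
have test x v y : e v y -> d y z = Some n ->
    \sum_p a p * kapz d z (unit_fun K [tuple x; v; y]) p = value x v.
  rewrite -dist_eq1 => /eqP evy eyz; rewrite (bigD1 [tuple x; v]) //= big1 ?addr0 => [|p np].
    rewrite /kapz /koszul_diff (bigD1 y) //= big1 ?addr0 => [|u nu].
      rewrite extend_unit [X in _ * (_ * X)](_ : _ = 1); last exact: (congr1 (fun b : bool => b%:R) (eqxx [:: x; v; y])).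
      rewrite mulr1 /koszul_step /= evy eyz /= /value.
      rewrite add1n; move: (a [tuple x; v]) => av; case: (d v z =P Some n.+1) => [->|ne].
        by rewrite mulr1.
      by rewrite andbF mulr0.
    by rewrite extend_unit /= !eqseq_cons (negbTE nu) !andbF mulr0.
  rewrite /kapz /koszul_diff big1 ?mulr0 // => u _; rewrite extend_unit.
  case: eqP => [h|_]; last by rewrite mulr0.
  have /rcons_inj[ep _] : rcons p u = rcons [:: x; v] y := h.
  by case/eqP: np; apply: val_inj.
have unit_level x v y : e x v -> e v y -> d y z = Some n ->
    (forall p, unit_fun K [tuple x; v; y] p != 0 -> sorted (unit_step d) p /\ d (lastt p) z = Some n).
  move=> exv evy eyz p; rewrite /unit_fun; case: (p =P _) => [->|_]; last by rewrite eqxx.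
  by rewrite (eq_sorted (@dist_unit_step G)) /= exv evy /lastt.
have Ha x v y : e x v -> e v y -> d y z = Some n -> d x y <> Some 2%N -> value x v = 0.
  move=> exv evy eyz nd; rewrite -(test x v y evy eyz); apply: aw.
  have ul := unit_level x v y exv evy eyz.
  split=> [|p /ul[]//]; split=> [p /ul[]//|i s]; rewrite face_triple.
  case bt: between; rewrite ?andbF //; case: nd.
  case/(betweenP dM): bt => m1 [m2 [e1 e2 ->]]; move: exv evy; rewrite -!dist_eq1 e1 e2.
  by move=> /eqP[->] /eqP[->].
have Hb x v v' y : d x y = Some 2%N -> e x v -> e v y -> e x v' -> e v' y -> d y z = Some n ->
    value x v = value x v'.
  move=> dxy exv evy exv' evy' eyz.
  have ul := unit_level x v y exv evy eyz; have ul' := unit_level x v' y exv' evy' eyz.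
  pose w' p := -1 * unit_fun K [tuple x; v'; y] p + unit_fun K [tuple x; v; y] p.
  have nz p : w' p != 0 -> sorted (unit_step d) p /\ d (lastt p) z = Some n.
    have [e1|/ul'//] := eqVneq (unit_fun K [tuple x; v'; y] p) 0.
    by rewrite /w' e1 mulr0 add0r; apply: ul.
  have lw' : level d n z w'.
    split=> [|p /nz[]//]; split=> [p /nz[]//|i s].
    have -> : face d i (extend w') s = -1 * face d i (extend (unit_fun K [tuple x; v'; y])) s +
        face d i (extend (unit_fun K [tuple x; v; y])) s.
      rewrite -face_linear; congr face; apply/funext => t.
      by rewrite /extend; case: insub => //; rewrite mulr0 addr0.
    by rewrite !face_triple !between_two // exv evy exv' evy' mulN1r addNr.
  have := aw _ lw'; under eq_bigr => p _ do rewrite kapz_linear mulrDr mulrCA.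
  rewrite big_split /= -mulr_sumr !test // mulN1r addrC => /eqP.
  by rewrite subr_eq0 => /eqP.
have norm_valid x v y b : e v y -> path e y b -> last y b = z -> size b = n ->
    d v z = Some n.+1 -> d y z = Some n.
  rewrite -dist_eq1 => /eqP evy pb lb sb evz; have [m em le] := dist_path pb.
  rewrite lb in em; have [m' em' le'] := metric_triangle dM evy em.
  by move: em'; rewrite evz em => -[em']; congr Some; lia.
have Hinv x v v' y a0 b : d x y = Some 2%N -> e x v -> e v y -> e x v' -> e v' y ->
    pathval (a0 ++ [:: x, v, y & b]) = pathval (a0 ++ [:: x, v', y & b]).
  move=> dxy exv evy exv' evy'; rewrite /pathval !size_cat !sorted_cat_join !last_cat /=.
  rewrite exv evy exv' evy' /=; case: and3P => // -[/eqP sz /andP[_ pb] /eqP lb].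
  case: a0 sz => [[sb]|c [|c' a0]] //=.
  have [dyz|nd] := eqVneq (d y z) (Some n); first exact: Hb dyz.
  have off u : e u y -> value x u = 0.
    move=> euy; rewrite /value; case: eqP => // duz.
    by rewrite (norm_valid x u y b euy pb lb sb duz) eqxx in nd.
  by rewrite !off.
have Hred p : two_reducible p -> pathval (pverts p) = 0.
  case/two_reducibleE => _ [a0 [x [v [y [b [-> nd]]]]]].
  rewrite /pathval; case: and3P => // -[/eqP sz so /eqP lz].
  case: a0 sz so lz => [|c [|c' a0]] /= sz so lz.
  - case/and3P: so => exv evy pb; rewrite /value; case: eqP => // dvz.
    have sb : size b = n by move: sz => -[].
    have dyz := norm_valid x v y b evy pb lz sb dvz.
    by have := Ha x v y exv evy dyz nd; rewrite /value dvz eqxx.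
  - case/andP: so => _ ps; have [//|m em le] := @detour_shortens x [:: v, y & b] [::] x v y b ps erefl.
    by rewrite /value; case: eqP => // dxz; move: em le; rewrite /= lz dxz => -[<-]; move: sz => -[->] /=; lia.
  case/andP: so => _ ps; have [//|m em le] := @detour_shortens c' _ (c' :: a0) x v y b ps erefl.
  rewrite /value; case: eqP => // dxz; move: em le; rewrite lz dxz => -[<-].
  by move: sz => -[->]; lia.
have geo x v : e x v -> d v z = Some n.+1 ->
    exists p : gpath G, [/\ psrc p = x, ptgt p = z, plen p = n.+2 & pathval (pverts p) = a [tuple x; v]].
  move=> exv evz; have [s [ps ls ss]] := geodesic_path evz.
  have [p ep] : exists p : gpath G, pverts p = [:: x, v & s] by apply: gpath_exists; rewrite /= exv.
  exists p; rewrite ep /pathval /= exv ps ls ss !eqxx /value evz eqxx.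
  by move: ep; rewrite /pverts /psrc /ptgt /plen => -[-> ->] /=; rewrite ss.
have C1 x v : e x v -> d v z = Some n.+1 -> d x z <> Some n.+2 -> a [tuple x; v] = 0.
  move=> exv evz nd; have [p [sp tp lp <-]] := geo x v exv evz.
  have [|_ [q [hq /Hred <-]]] := V2l p; first by rewrite /long /shortest sp tp lp.
  by have [_ _] := tsc_invariant hq Hinv.
have C2 x v v' : e x v -> d v z = Some n.+1 -> e x v' -> d v' z = Some n.+1 ->
    d x z = Some n.+2 -> a [tuple x; v] = a [tuple x; v'].
  move=> exv evz exv' evz' dxz; have [p [sp tp lp <-]] := geo x v exv evz.
  have [q [sq tq lq <-]] := geo x v' exv' evz'.
  have h : two_short_congruent p q.
    by apply: V2s; rewrite /shortest /connect_same ?sp ?tp ?lp ?sq ?tq ?lq.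
  by have [_ _] := tsc_invariant h Hinv.
pose pk x := [pick v | e x v && (d v z == Some n.+1)].
(* The common value of a at the arrows from x to the level n+1. *)
pose phi x := if (d x z == Some n.+2) then (if pk x is Some v then a [tuple x; v] else 0) else 0.
rewrite sum_rcons big1 // => q _.
have eq1 v : [tuple of rcons q v] = [tuple lastt q; v].
  by apply: val_inj; case: q => -[|x [|y q]] //= sq; rewrite /lastt (tnth_nth x).
transitivity (\sum_v phi (lastt q) * ((koszul_step d q v z)%:R * extend w (rcons q v))); last first.
  by rewrite -mulr_sumr; apply: etrans (congr1 _ (kw q)) _; rewrite mulr0.
apply: eq_bigr => v _; rewrite -[rcons q v]/(tval [tuple of rcons q v]) extendE.
have [->|nz] := eqVneq (w [tuple of rcons q v]) 0; first by rewrite !mulr0.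
have := lw.2 _ nz; rewrite lastt_rcons => dvz.
have exv : e (lastt q) v.
  by have := lw.1.1 _ nz; rewrite eq1 (eq_sorted (@dist_unit_step G)) /= andbT.
rewrite /phi eq1; case: (d (lastt q) z =P Some n.+2) => [dxz|nd]; last by rewrite C1 // !mul0r.
have -> : koszul_step d q v z by rewrite /koszul_step !dist_last_tuple dvz dist_eq1 exv dxz /= add1n eqxx.
rewrite mul1r; congr (_ * _); rewrite /pk; case: pickP => [v' /andP[exv' /eqP dvz']|/(_ v)].
  exact: C2.
by rewrite exv dvz eqxx.
Qed.

End ConstancyFromCongruence.

(** * Recovering the congruences from exactness *)

Section CongruenceFromExactness.
Variables (G : digraph) (K : fieldType).
Local Notation e := (@arrow G).
Local Notation d := (@dist G).
Local Notation tsc := (@two_short_congruent G).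
Implicit Types (u v y : G) (s t : seq G) (p q r : gpath G).

Let dM := dist_metric G.

Lemma pair_level n x u z : e x u -> d u z = Some n.+1 ->
  level d n.+1 z (unit_fun K [tuple x; u]).
Proof.
move=> exu duz; have nz (t : 2.-tuple G) : unit_fun K [tuple x; u] t != 0 -> t = [tuple x; u].
  by rewrite /unit_fun; case: (t =P _) => // _; rewrite eqxx.
split=> [|t /nz->]; last by rewrite /lastt.
split=> [t /nz->|i s]; first by rewrite (eq_sorted (@dist_unit_step G)) /= exu.
apply: face_eq0 => p a b q v _ _ _; rewrite extend_unit.
case: eqP => // h; have := congr1 size h; rewrite size_cat /=; lia.
Qed.

Lemma unit_pair x u v : unit_fun K [tuple x; u] [tuple x; v] = (v == u)%:R.
Proof.
have -> : unit_fun K [tuple x; u] [tuple x; v] = ([:: x; v] == [:: x; u])%:R by [].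
by rewrite !eqseq_cons eqxx andbT.
Qed.

Lemma kapz_pair n x u z s : e x u -> d u z = Some n.+1 ->
  kapz d z (unit_fun K [tuple x; u]) s = ((s == [:: x]) && (d x z == Some n.+2))%:R.
Proof.
move=> exu duz; have [->|ns] := eqVneq s [:: x].
  rewrite /kapz /koszul_diff (bigD1 u) //= big1 ?addr0 => [|v nv].
    rewrite extend_unit [X in _ * X](_ : _ = 1); last exact: (congr1 (fun b : bool => b%:R) (eqxx [:: x; u])).
    rewrite mulr1 /koszul_step /= duz dist_eq1 exu /= add1n.
    by case: (d x z =P Some n.+2) => [->|_]; rewrite ?andbF.
  by rewrite extend_unit /= !eqseq_cons (negbTE nv) !andbF mulr0.
rewrite /kapz /koszul_diff big1 // => v _; rewrite extend_unit.
case: eqP => [h|_]; last by rewrite mulr0.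
have /rcons_inj[es _] : rcons s v = rcons [:: x] u := h.
by rewrite es eqxx in ns.
Qed.

(** Let w = kappa w'. Expanding the sum over C and exchanging the sums, each
    end y contributes the sum of w' over the paths x u y with u in C. If one of
    them is nonzero, C contains all the middle vertices between x and y, so the
    contribution is a face of w', hence zero. *)
Lemma closed_sum (EX : level_exact K d 0) n x z (C : pred G) :
  (forall u, C u -> e x u /\ d u z = Some n.+1) ->
  (forall u y, C u -> e u y -> d y z = Some n ->
     d x y = Some 2%N /\ forall v, e x v -> e v y -> C v) ->
  forall w : 2.-tuple G -> K, level d n.+1 z w -> (forall s, kapz d z w s = 0) ->
  \sum_(u | C u) w [tuple x; u] = 0.
Proof.
move=> C1 C2 w lw kw; have [w' [lw' ew']] := EX n z w lw kw.
have nz u y : extend w' [:: x; u; y] != 0 -> [/\ e x u, e u y & d y z = Some n].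
  move=> nz; have [p ep nw] := extend_neq0 nz.
  have := lw'.1.1 _ nw; rewrite ep (eq_sorted (@dist_unit_step G)) /= => /and3P[-> -> _].
  by split=> //; rewrite -(level_extend lw' nz).
transitivity (\sum_(u | C u) \sum_y extend w' [:: x; u; y]).
  apply: eq_bigr => u /C1[exu duz]; rewrite -extendE -ew'; apply: eq_bigr => y _.
  rewrite [rcons _ _]/=; have [->|/nz[_ euy dyz]] := eqVneq (extend w' [:: x; u; y]) 0; first by rewrite mulr0.
  have -> : koszul_step d [tuple x; u] y z.
    by rewrite /koszul_step /= duz dyz dist_eq1 euy /= add1n eqxx.
  exact: mul1r.
rewrite exchange_big big1 // => y _.
(* One nonzero term makes all the middle vertices between x and y belong to
   C. *)
case: (pickP (fun u => C u && (extend w' [:: x; u; y] != 0))) => [u /andP[Cu /nz[exu euy dyz]]|none]; last first.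
  by rewrite big1 // => u Cu; apply/eqP; have := none u; rewrite Cu /=; case: eqP.
have [dxy Cv] := C2 u y Cu euy dyz; rewrite -[RHS](lw'.1.2 0%N [:: x; y]).
rewrite (@face_cat _ _ d [::] x y [::]) big_mkcond; apply: eq_bigr => v _ /=.
have [->|/nz[exv evy _]] := eqVneq (extend w' [:: x; v; y]) 0; first by rewrite mulr0 if_same.
by rewrite Cv // between_two // exv evy mul1r.
Qed.

Lemma tsc_refl p : tsc p p. Proof. exact: congr_refl (tsc_congruence G) p. Qed.
Lemma tsc_trans p q r : tsc p q -> tsc q r -> tsc p r.
Proof. exact: (congr_trans (tsc_congruence G)). Qed.

Lemma tsc_ends p q : tsc p q -> [/\ psrc p = psrc q, ptgt p = ptgt q & plen p = plen q].
Proof.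
by move=> h; have [[-> ->] -> _] := tsc_invariant (f := fun=> tt) h (fun _ _ _ _ _ _ _ _ _ _ _ => erefl).
Qed.

Lemma gpathE p x s : pverts p = x :: s -> [/\ psrc p = x, ptgt p = last x s & plen p = size s].
Proof. by rewrite /pverts /psrc /ptgt /plen => -[-> ->]. Qed.

Lemma gpath_cons p n : plen p = n.+1 -> exists u s, pverts p = [:: psrc p, u & s].
Proof. by rewrite /plen /pverts /psrc; case: (val p).2 => // u s _; exists u, s. Qed.

Lemma gpath_tail p x u s : pverts p = [:: x, u & s] -> e x u /\ exists q, pverts q = u :: s.
Proof.
move=> ep; have : sorted e (pverts p) := valP p.
by rewrite ep /= => /andP[exu ps]; split=> //; apply: gpath_exists.
Qed.

Lemma tsc_cons p q p' q' x u s v t : pverts p = [:: x, u & s] -> pverts q = [:: x, v & t] ->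
  pverts p' = u :: s -> pverts q' = v :: t -> tsc p' q' -> tsc p q.
Proof.
move=> ep eq ep' eq' h; apply: (congruence_cat (a := [:: x]) (b := [::]) (tsc_congruence G) h).
  by rewrite ep ep' cats0.
by rewrite eq eq' cats0.
Qed.

Lemma quasi_reducible_cons p p' x u s : pverts p = [:: x, u & s] -> pverts p' = u :: s ->
  long p -> two_quasi_reducible p' -> two_quasi_reducible p.
Proof.
move=> ep ep' lp [_ [r' [hr /two_reducibleE[_ [a [x0 [v0 [y0 [b [er nd]]]]]]]]]].
have [exu _] := gpath_tail ep.
have [e1 e2 e3] := tsc_ends hr; have [f1 f2 f3] := gpathE ep'.
have er' : pverts r' = u :: (val r').2 by rewrite /pverts -/(psrc r') -e1 f1.
have [r ev] : exists r : gpath G, pverts r = x :: pverts r'.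
  by apply: gpath_exists; rewrite er' /= exu; have : sorted e (pverts r') := valP r'; rewrite er'.
have h : tsc p r by apply: (tsc_cons ep _ ep' er' hr); rewrite ev er'.
split=> //; exists r; split=> //; apply/two_reducibleE; split; last first.
  by exists (x :: a), x0, v0, y0, b; rewrite ev er.
by have [g1 g2 g3] := tsc_ends h; move: lp; rewrite /long /shortest g1 g2 g3.
Qed.

Section Step.
Hypothesis EX : level_exact K d 0.
Variables (n : nat) (x z : G).
Hypothesis IHs : forall p q, plen p = n.+1 -> shortest p -> shortest q -> connect_same p q -> tsc p q.
Hypothesis IHl : forall p, plen p = n.+1 -> long p -> two_quasi_reducible p.

(** The tails are shortest paths with common ends, to which the induction
    hypothesis applies. *)
Lemma tsc_same_start p q u s t : d u z = Some n.+1 -> ptgt p = z -> ptgt q = z ->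
  plen p = n.+2 -> plen q = n.+2 ->
  pverts p = [:: x, u & s] -> pverts q = [:: x, u & t] -> tsc p q.
Proof.
move=> duz tp tq lp lq ep eq; have [_ [p' ep']] := gpath_tail ep; have [_ [q' eq']] := gpath_tail eq.
have [_ tp2 lp2] := gpathE ep; have [_ tq2 lq2] := gpathE eq.
apply: (tsc_cons ep eq ep' eq'); have [sp' tp' lp'] := gpathE ep'; have [sq' tq' lq'] := gpathE eq'.
have lp0 : plen p' = n.+1 by rewrite lp'; move: lp2; rewrite lp /= => -[].
have lq0 : plen q' = n.+1 by rewrite lq'; move: lq2; rewrite lq /= => -[].
have tp0 : ptgt p' = z by rewrite tp' -tp tp2.
have tq0 : ptgt q' = z by rewrite tq' -tq tq2.
apply: IHs => //; first by rewrite /shortest sp' tp0 lp0.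
  by rewrite /shortest sq' tq0 lq0.
by rewrite /connect_same sp' sq' tp0 tq0.
Qed.

(** A class P of paths that is closed under congruence and has no shortcut in
    its first two steps gives a set of first steps which is closed in the sense
    of closed_sum. *)
Lemma first_step_sum (P : gpath G -> Prop) : (forall p q, P p -> tsc p q -> P q) ->
  (forall p, P p -> [/\ psrc p = x, ptgt p = z & plen p = n.+2]) ->
  (forall p u s, P p -> pverts p = [:: x, u & s] -> d u z = Some n.+1) ->
  (forall p u y s, P p -> pverts p = [:: x, u, y & s] -> d x y = Some 2%N) ->
  forall w : 2.-tuple G -> K, level d n.+1 z w -> (forall s, kapz d z w s = 0) ->
  \sum_(u | `[< exists p s, pverts p = [:: x, u & s] /\ P p >]) w [tuple x; u] = 0.
Proof.
move=> P1 P2 P3 P4; apply: (closed_sum EX) => [u /asboolP[p [s [ep Pp]]]|u y /asboolP[p [s [ep Pp]]] euy dyz].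
  by have [exu _] := gpath_tail ep; rewrite (P3 p u s Pp ep).
have [exu _] := gpath_tail ep; have duz := P3 p u s Pp ep.
have [t [pt lt st]] := geodesic_path dyz.
have [p2 ep2] : exists p2 : gpath G, pverts p2 = [:: x, u, y & t].
  by apply: gpath_exists; rewrite /= exu euy.
have [_ t2 l2] := gpathE ep2; have [sp tp lp] := P2 p Pp.
have Pp2 : P p2.
  apply: (P1 p) => //; apply: (tsc_same_start duz tp _ lp _ ep ep2); first by rewrite t2.
  by rewrite l2 /= st.
have dxy := P4 p2 u y t Pp2 ep2; split=> // v exv evy.
have [p3 ep3] : exists p3 : gpath G, pverts p3 = [:: x, v, y & t].
  by apply: gpath_exists; rewrite /= exv evy.
have [q2 eq2] : exists q : gpath G, pverts q = [:: x; u; y] by apply: gpath_exists; rewrite /= exu euy.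
have [q3 eq3] : exists q : gpath G, pverts q = [:: x; v; y] by apply: gpath_exists; rewrite /= exv evy.
apply/asboolP; exists p3, (y :: t); split=> //; apply: (P1 p2) => //.
apply: (congruence_cat (a := [::]) (b := t) (tsc_congruence G) (tsc_two dxy eq2 eq3)).
  by rewrite ep2 eq2.
by rewrite ep3 eq3.
Qed.

(** If p is not 2-quasi-reducible, the class of all such paths satisfies
    first_step_sum: a long tail or a shortcut in the first two steps would make
    them so. As x is not at distance n+2 from z, kappa kills the unit function
    of the first arrow of p, whose sum is 1. *)
Lemma long_step p : psrc p = x -> ptgt p = z -> plen p = n.+2 -> long p -> two_quasi_reducible p.
Proof.
move=> sp tp lp longp; apply: contrapT => nqr.
have nd : d x z <> Some n.+2 by move: longp; rewrite /long /shortest sp tp lp.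
(* The paths from x to z of this length that are not 2-quasi-reducible. *)
pose P q := [/\ psrc q = x, ptgt q = z, plen q = n.+2 & ~ two_quasi_reducible q].
have longP q : psrc q = x -> ptgt q = z -> plen q = n.+2 -> long q.
  by move=> sq tq lq; rewrite /long /shortest sq tq lq.
have P3 q u s : P q -> pverts q = [:: x, u & s] -> d u z = Some n.+1.
  move=> [sq tq lq nq] eq; apply: contrapT => nduz; apply: nq.
  have [_ [q' eq']] := gpath_tail eq; have [sq' tq' lq'] := gpathE eq'.
  have [_ tq2 lq2] := gpathE eq.
  have lq0 : plen q' = n.+1 by rewrite lq'; move: lq2; rewrite lq /= => -[].
  apply: (quasi_reducible_cons eq eq' (longP q sq tq lq)); apply: IHl => //.
  by rewrite /long /shortest sq' lq0 tq' -[last u s]/(last x (u :: s)) -tq2 tq.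
have [u [s ep]] := gpath_cons lp; rewrite sp in ep; have [exu _] := gpath_tail ep.
have Pp : P p by [].
have duz := P3 p u s Pp ep.
have := @first_step_sum P _ _ P3 _ _ (pair_level exu duz) _.
have Cu : `[< exists p s, pverts p = [:: x, u & s] /\ P p >] by apply/asboolP; exists p, s.
rewrite (bigD1 u) //= big1 ?addr0 => [|v /andP[_ nv]]; last first.
  by rewrite unit_pair (negbTE nv).
rewrite unit_pair (eqxx u) => H; suff /eqP : (1 : K) = 0 by rewrite oner_eq0.
apply: H.
- move=> q r [sq tq lq nq] h; have [e1 e2 e3] := tsc_ends h; split; rewrite -?e1 -?e2 -?e3 //.
  by move/(two_quasi_reducible_tsc h).
- by move=> q [].
- move=> q v y t [sq tq lq nq] eq; apply: contrapT => ndxy; apply: nq.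
  split; first exact: longP.
  exists q; split; first exact: tsc_refl.
  apply/two_reducibleE; split; first exact: longP.
  by exists [::], x, v, y, t.
move=> t; rewrite (kapz_pair _ exu duz); case: eqP => // _.
by case: (d x z =P Some n.+2).
Qed.

(** The class of p satisfies first_step_sum, since a path of length d(x, z) has
    no shortcuts. The difference of the unit functions of the first arrows of p
    and q is killed by kappa, so some path congruent to p starts with the first
    arrow of q. *)
Lemma short_step p q : psrc p = x -> ptgt p = z -> plen p = n.+2 -> shortest p -> shortest q ->
  connect_same p q -> tsc p q.
Proof.
move=> sp tp lp shp shq [c1 c2].
have dxz : d x z = Some n.+2 by move: shp; rewrite /shortest sp tp lp.
have sq : psrc q = x by rewrite -c1.
have tq : ptgt q = z by rewrite -c2.
have lq : plen q = n.+2 by move: shq; rewrite /shortest sq tq dxz => -[].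
pose P r := [/\ psrc r = x, ptgt r = z, plen r = n.+2 & tsc p r].
have P3 r u s : ptgt r = z -> plen r = n.+2 -> pverts r = [:: x, u & s] -> d u z = Some n.+1.
  move=> tr lr er; have : sorted e (pverts r) := valP r; rewrite er /= => /andP[exu ps].
  have [_ tr2 lr2] := gpathE er; have [m dm le] := dist_path ps.
  move: exu; rewrite -dist_eq1 => /eqP dxu; have [m' dm' le'] := metric_triangle dM dxu dm.
  move: dm dm'; rewrite -[last u s]/(last x (u :: s)) -tr2 tr dxz => -> -[em'].
  by move: lr2; rewrite lr /= => -[es]; congr Some; lia.
have [u [s ep]] := gpath_cons lp; rewrite sp in ep; have [exu _] := gpath_tail ep.
have [v [t eq]] := gpath_cons lq; rewrite sq in eq; have [exv _] := gpath_tail eq.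
have duz := P3 p u s tp lp ep; have dvz := P3 q v t tq lq eq.
suff /asboolP[r [t' [er [sr tr lr hr]]]] : `[< exists p s, pverts p = [:: x, v & s] /\ P p >].
  exact: (tsc_trans hr (tsc_same_start dvz tr tq lr lq er eq)).
apply: contraT => nCv.
have Cu : `[< exists p s, pverts p = [:: x, u & s] /\ P p >].
  by apply/asboolP; exists p, s; split=> //; split=> //; exact: tsc_refl.
pose w (t : 2.-tuple G) : K := -1 * unit_fun K [tuple x; v] t + unit_fun K [tuple x; u] t.
have lw : level d n.+1 z w.
  have lu := pair_level exu duz; have lv := pair_level exv dvz.
  have nz (t0 : 2.-tuple G) : w t0 != 0 -> sorted (unit_step d) t0 /\ d (lastt t0) z = Some n.+1.
    rewrite /w; have [->|h _] := eqVneq (unit_fun K [tuple x; v] t0) 0.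
      by rewrite mulr0 add0r => h; split; [exact: lu.1.1 | exact: lu.2].
    by split; [exact: lv.1.1 | exact: lv.2].
  split=> [|t0 /nz[]//]; split=> [t0 /nz[]//|i s0].
  have -> : face d i (extend w) s0 = -1 * face d i (extend (unit_fun K [tuple x; v])) s0 +
      face d i (extend (unit_fun K [tuple x; u])) s0.
    rewrite -face_linear; congr face; apply/funext => t0.
    by rewrite /extend; case: insub => //; rewrite mulr0 addr0.
  by rewrite lu.1.2 lv.1.2 mulr0 addr0.
have := @first_step_sum P _ _ _ _ _ lw _.
rewrite (bigD1 u) //= big1 ?addr0 => [|v' /andP[Cv' nv']]; last first.
  rewrite /w !unit_pair (negbTE nv') addr0; case: (v' =P v) => [ev|_]; last by rewrite mulr0.
  by rewrite ev (negbTE nCv) in Cv'.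
have nuv : u != v by apply: contraNneq nCv => <-.
have -> : w [tuple x; u] = 1.
  by rewrite /w !unit_pair (eqxx u) (negbTE nuv) mulr0 add0r.
move=> H; suff /eqP : (1 : K) = 0 by rewrite oner_eq0.
apply: H.
- move=> r r' [sr tr lr hr] h; have [e1 e2 e3] := tsc_ends h; split; rewrite -?e1 -?e2 -?e3 //.
  exact: tsc_trans hr h.
- by move=> r [].
- by move=> r u' s' [_ tr lr _]; apply: P3.
- move=> r u' y s' [_ tr lr _] er; have : sorted e (pverts r) := valP r.
  rewrite er /= => /and3P[exu' euy ps]; have [_ tr2 lr2] := gpathE er.
  have [m dm le] := dist_path ps.
  move: exu' euy; rewrite -!dist_eq1 => /eqP d1 /eqP d2.
  have [m1 dm1 le1] := metric_triangle dM d1 d2; have [m2 dm2 le2] := metric_triangle dM dm1 dm.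
  move: dm2; rewrite -[last y s']/(last x [:: u', y & s']) -tr2 tr dxz => -[em2].
  by move: lr2; rewrite lr /= dm1 => -[es]; congr Some; lia.
move=> s0; rewrite /w kapz_linear (kapz_pair _ exu duz) (kapz_pair _ exv dvz).
by rewrite mulN1r addNr.
Qed.

End Step.

(** Induction on the length of the paths, which for lengths zero and one have
    no choice. *)
Theorem level_exact_property_V2 : level_exact K d 0 -> property_V2 G.
Proof.
move=> EX.
suff H l : (forall p q, plen p = l -> shortest p -> shortest q -> connect_same p q -> tsc p q) /\
    (forall p, plen p = l -> long p -> two_quasi_reducible p).
  by split=> [p q|p]; [apply: (H (plen p)).1 | apply: (H (plen p)).2].
elim: l => [|[|n] [IHs IHl]]; last first.
- split=> [p q lp|p lp]; first exact: (@short_step EX n _ _ IHs p q erefl erefl lp).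
  exact: (@long_step EX n _ _ IHs IHl p erefl erefl lp).
- split=> [p q lp shp shq [c1 c2]|p lp []].
    suff -> : p = q by apply: tsc_refl.
    have lq : plen q = 1%N by move: shp shq; rewrite /shortest c1 c2 lp => -> -[].
    have [u [[|? ?] ep]] := gpath_cons lp; last by have [_ _] := gpathE ep; rewrite lp.
    have [v [[|? ?] eq]] := gpath_cons lq; last by have [_ _] := gpathE eq; rewrite lq.
    apply: pverts_inj; rewrite ep eq c1; congr [:: _; _].
    by have [_ tp _] := gpathE ep; have [_ tq _] := gpathE eq; move: c2; rewrite tp tq.
  have [u [[|? ?] ep]] := gpath_cons lp; last by have [_ _] := gpathE ep; rewrite lp.
  have [_ tp _] := gpathE ep; have [exu _] := gpath_tail ep.
  by rewrite /shortest tp lp; apply/eqP; rewrite dist_eq1.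
split=> [p q lp shp shq [c1 c2]|p lp []].
  suff -> : p = q by apply: tsc_refl.
  have lq : plen q = 0%N by move: shp shq; rewrite /shortest c1 c2 lp => -> -[].
  by apply: pverts_inj; rewrite /pverts -!/(psrc _) c1 (size0nil lp) (size0nil lq).
by rewrite /shortest lp /ptgt (size0nil lp) dist_xx.
Qed.

End CongruenceFromExactness.

(** * The three equivalences *)

Section Equivalences.
Variable G : digraph.

Lemma off_diagonal_exact_distance (K : fieldType) :
  @off_diagonal_exact K G (@dist G) <-> koszul (distance_algebra G K).
Proof.
have dT := dist_transpose_metric G; split=> h.
  apply: exact_koszul_distance; apply: (koszul_exact_unbounded dT).
  apply: (off_diagonal_koszul_exact dT); exact/off_diagonal_exact_transpose.
apply/off_diagonal_exact_transpose; apply: (koszul_exact_off_diagonal dT).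
exact: (koszul_exact_all dT (koszul_distance_exact h)).
Qed.

Lemma off_diagonal_exact_level (K : fieldType) :
  @off_diagonal_exact K G (@dist G) <-> forall k, level_exact K (@dist G) k.
Proof.
have dM := dist_metric G; split=> h.
  move=> k; apply: exact_level_exact; apply: (koszul_exact_unbounded dM).
  exact: (off_diagonal_koszul_exact dM h).
apply: (koszul_exact_off_diagonal dM); apply: (koszul_exact_all dM) => k.
exact: (level_exact_exact dM (h k)).
Qed.

End Equivalences.

Theorem theorem6p5 (G : digraph) :
  [<-> diagonal G;
       forall K : fieldType, koszul (distance_algebra G K);
       property_V2 G /\
       forall K : fieldType, koszul (path_cochain_algebra G K)].
Proof.
tfae.
- by move=> /diagonal_off_diagonal_exact h K; apply/off_diagonal_exact_distance.
- move=> h; have lev K k : level_exact K (@dist G) k.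
    by apply: (proj1 (off_diagonal_exact_level G K)); apply/off_diagonal_exact_distance.
  split=> [|K]; first exact: level_exact_property_V2 (lev rat 0%N).
  exact: exact_koszul_cochain (lev K).
case=> V2 h; apply/diagonal_off_diagonal_exact => K.
apply/off_diagonal_exact_level; apply: koszul_cochain_exact (h K) _.
exact: property_V2_level_exact.
Qed.
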